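(* Equip $\mathbb{R}^4\times S^3$ with either the complete Bryant–Salamon $G_2$-structure (with $c>0$) or the BGGG $G_2$-structure, and let $\varphi$ be the corresponding $3$-form. Then there is an associative foliation of $\mathbb{R}^4\times S^3$, the tangent spaces of whose leaves are determined by the vector fields $\langle T_1^+,T_1^-,\partial_r\rangle$. This distribution is involutive, since $[T_1^+,T_1^-]=[T_1^+,\partial_r]=[T_1^-,\partial_r]=0$, and the leaves are calibrated by $\varphi$. These associatives are all diffeomorphic to $\mathbb{R}^2\times S^1$. The foliation does not define a global fibration, since an $S^2$-family of the leaves intersects in an $S^1$ in the zero section $S^3$. The foliation is parametrised by $S^2\times S^2$, and on the complement of the zero section one gets the associative fibration $$\mathbb{R}^+\times\mathbb{T}^2\hookrightarrow(\mathbb{R}^4\setminus 0)\times S^3\to S^2\times S^2.$$ The fibre metrics in the Bryant–Salamon and BGGG cases are respectively $$g=\frac{1}{1-c^3r^{-3}}dr^2+\frac{r^2(1-c^3r^{-3})}{9}d\theta_1^2+\frac{r^2}{3}d\theta_2^2,$$ $$g=\frac{(r-3/4)(r+3/4)}{(r-9/4)(r+9/4)}dr^2+\frac{(r-9/4)(r+9/4)}{(r-3/4)(r+3/4)}d\theta_1^2+\frac{4r^2}{9}d\theta_2^2,$$ where $\theta_1,\theta_2$ denote local coordinates on the $S^1$ factors. In the Bryant–Salamon case these metrics are asymptotically conical, and in the BGGG case they are asymptotic to a flat product metric on $\mathbb{R}^2\times S^1$.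
   Context: Invariant forms: let $T_1,T_2,T_3$ be the basis of $\mathfrak{su}_2$ with $[T_i,T_j]=2\varepsilon_{ijk}T_k$. On $S^3\times S^3=SU(2)\times SU(2)$ use the left-invariant vector fields $T_i^+=(T_i,T_i)$, $T_i^-=(T_i,-T_i)$ and denote by $\eta_i^\pm$ the dual coframe, so that $d\eta_i^+=-\varepsilon_{ijk}(\eta_j^+\wedge\eta_k^++\eta_j^-\wedge\eta_k^-)$ and $d\eta_i^-=-2\varepsilon_{ijk}\,\eta_j^-\wedge\eta_k^+$ (repeated indices summed). Write $\eta^{\pm\pm}_{ij}=\eta_i^\pm\wedge\eta_j^\pm$, etc. (adjacent forms wedged). Given functions $A_1,A_2,B_1,B_2$ of $t$, set $\omega=4A_1B_1\,\eta_{11}^{-+}+4A_2B_2(\eta_{22}^{-+}+\eta_{33}^{-+})$, $\Omega^+=8B_1B_2^2\,\eta_{123}^{---}-8A_2^2B_1\,\eta_{123}^{-++}-8A_1A_2B_2(\eta_{123}^{++-}+\eta_{123}^{+-+})$, and $\varphi=dt\wedge\omega+\Omega^+$, with metric $g_\varphi=dt^2+(2A_1)^2(\eta_1^+)^2+(2A_2)^2((\eta_2^+)^2+(\eta_3^+)^2)+(2B_1)^2(\eta_1^-)^2+(2B_2)^2((\eta_2^-)^2+(\eta_3^-)^2)$. Bryant–Salamon: $r\in[c,\infty)$, $t=\int_c^r\frac{dx}{\sqrt{1-c^3x^{-3}}}$, $A_1=A_2=\frac r3\sqrt{1-c^3r^{-3}}$, $B_1=B_2=\frac r{\sqrt3}$.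 BGGG (Brandhuber–Gomis–Gubser–Gukov): $r\in[9/4,\infty)$, $t=\int_{9/4}^r\sqrt{\frac{(x-3/4)(x+3/4)}{(x-9/4)(x+9/4)}}\,dx$, $A_1=\sqrt{\frac{(r-9/4)(r+9/4)}{(r-3/4)(r+3/4)}}$, $A_2=\sqrt{\frac{(r-9/4)(r+3/4)}{3}}$, $B_1=\frac{2r}{3}$, $B_2=\sqrt{\frac{(r+9/4)(r-3/4)}{3}}$. With $r_0=c$ (respectively $r_0=9/4$), these are torsion-free $G_2$-structures on $(r_0,\infty)\times S^3\times S^3$ which extend smoothly to $\mathbb{R}^4\times S^3$, viewed as the spinor bundle of $S^3$, where $(r_0,\infty)\times S^3\times S^3$ is the complement of the zero section $S^3=SU(2)\times SU(2)/\Delta SU(2)$ ($\Delta SU(2)$ the diagonal subgroup), located at $r=r_0$. A $3$-dimensional oriented submanifold is associative, i.e. calibrated by $\varphi$, if $\varphi$ restricts to its Riemannian volume form. The term ''foliation'' is used here with leaves that are allowed to meet along the zero section, as described in the claim.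
   Formalization: ''S²-family intersects in an S¹'' is false literally (only two leaves share a circle): proved instead that each leaf meets the zero section in an S¹ and an S² of leaves passes through each of its points; the BGGG flat product limit is stated only in local coordinates, as the periods do not match. *)

(* Defs.v *)
From HB Require Import structures.
From mathcomp Require Import all_boot all_order all_algebra.
From mathcomp Require Import all_classical all_reals all_analysis.
Set Implicit Arguments.
Unset Strict Implicit.
Unset Printing Implicit Defensive.
Import Order.TTheory GRing.Theory Num.Theory numFieldNormedType.Exports.
Local Open Scope classical_set_scope.
Local Open Scope ring_scope.

(* Submanifolds are subsets of normed spaces; smoothness on a subset means
   that there are local smooth extensions to open sets of the ambient space. *)
Section submanifolds.
Variable R : realType.
Implicit Types U V W : normedModType R.

Fixpoint Ck V W (k : nat) (O : set V) (f : V -> W) : Prop :=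
  if k is k'.+1 then
    (forall x, O x -> differentiable f x) /\
    (forall v, Ck k' O (fun x => 'D_v f x))
  else forall x, O x -> {for x, continuous f}.

Definition smooth V W (O : set V) (f : V -> W) := forall k, Ck k O f.

Definition smooth_on V W (S : set V) (f : V -> W) :=
  forall x, S x -> exists O : set V, exists F : V -> W,
    [/\ open O, O x, smooth O F & forall y, S y -> O y -> f y = F y].

Definition diffeo V W (A : set V) (B : set W) (f : V -> W) (g : W -> V) :=
  [/\ smooth_on A f, smooth_on B g,
      forall x, A x -> B (f x) /\ g (f x) = x &
      forall y, B y -> A (g y) /\ f (g y) = y].

Definition diffeomorphic V W (A : set V) (B : set W) :=
  exists f : V -> W, exists g : W -> V, diffeo A B f g.

Definition tangent_space V (S : set V) (p : V) : set V :=
  [set v | exists2 c : R^o -> V,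
     [/\ c 0 = p, derivable c 0 1 & \forall s \near (0 : R^o), S (c s)] &
     'D_1 c 0 = v].

Definition vector_field V (S : set V) (X : V -> V) :=
  smooth_on S X /\ forall p, S p -> tangent_space S p (X p).

(* Tensor fields on S are functions on the ambient space, of which only the
   values at points of S on tangent vectors of S matter. *)
Definition riemannian_metric V (S : set V) (g : V -> V -> V -> R) :=
  (forall p, S p -> forall u v w, tangent_space S p u ->
     tangent_space S p v -> tangent_space S p w ->
     [/\ g p u v = g p v u,
         forall k, g p (k *: u + v) w = k * g p u w + g p v w &
         u != 0 -> 0 < g p u u]) /\
  (forall X Y, vector_field S X -> vector_field S Y ->
     smooth_on S (fun p => g p (X p) (Y p) : R^o)).

Definition form3 V (S : set V) (phi : V -> V -> V -> V -> R) :=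
  (forall p, S p -> forall u v w z, tangent_space S p u ->
     tangent_space S p v -> tangent_space S p w -> tangent_space S p z ->
     [/\ phi p v u w = - phi p u v w,
         phi p u w v = - phi p u v w &
         forall k, phi p (k *: u + v) w z = k * phi p u w z + phi p v w z]) /\
  (forall X Y Z, vector_field S X -> vector_field S Y -> vector_field S Z ->
     smooth_on S (fun p => phi p (X p) (Y p) (Z p) : R^o)).

(* An orientation of the 3-dimensional L is given by a nowhere vanishing
   3-form tau on L. *)
Definition calibrated3 V (L : set V) (g : V -> V -> V -> R)
    (phi : V -> V -> V -> V -> R) :=
  exists tau : V -> V -> V -> V -> R,
  [/\ form3 L tau,
      forall p, L p -> exists u v w, [/\ tangent_space L p u,
        tangent_space L p v, tangent_space L p w & tau p u v w != 0] &
      forall p, L p -> forall e : 'I_3 -> V,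
        (forall i, tangent_space L p (e i)) ->
        (forall i j, g p (e i) (e j) = (i == j)%:R) ->
        0 < tau p (e 0) (e 1) (e 2) ->
        phi p (e 0) (e 1) (e 2) = 1].

Definition lie_bracket V (X Y : V -> V) (p : V) : V :=
  'D_(X p) Y p - 'D_(Y p) X p.

Definition involutive_distribution V (S : set V) (D : V -> set V) :=
  forall (O : set V) (X Y : V -> V), open O -> S `<=` O ->
    smooth O X -> smooth O Y ->
    (forall p, S p -> D p (X p) /\ D p (Y p)) ->
    forall p, S p -> D p (lie_bracket X Y p).

Definition fibre_bundle U V W (E : set V) (B : set W) (F : set U)
    (pi : V -> W) :=
  [/\ smooth_on E pi, forall x, E x -> B (pi x) &
      forall b, B b -> exists O : set W, [/\ open O, O b &
        exists f : W * U -> V, exists g : V -> W * U,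
          diffeo ((B `&` O) `*` F) (E `&` pi @^-1` O) f g /\
          forall y, ((B `&` O) `*` F) y -> pi (f y) = y.1]].

End submanifolds.

Section spheres.
Variable R : realType.

(* The library norm on row vectors is the sup norm. *)
Definition dot n (x y : 'rV[R]_n) : R := \sum_i x 0 i * y 0 i.

(* unit sphere S^(n-1) of R^n *)
Definition sphere n : set 'rV[R]_n := [set x | dot x x = 1].

Definition halfline : set R^o := [set x | 0 < x].

Definition torus : set ('rV[R]_2 * 'rV[R]_2) := @sphere 2 `*` @sphere 2.

End spheres.
Arguments sphere {R} n.
Arguments halfline {R}.
Arguments torus {R}.

(* SU(2) is the group of unit quaternions; quaternions are row vectors
   (real part, i, j, k). *)
Section quaternions.
Variable R : realType.
Local Notation H := 'rV[R]_4.

Definition qmul (x y : H) : H := \row_(n < 4) nth 0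
  [:: x 0 0 * y 0 0 - x 0 1 * y 0 1 - x 0 2 * y 0 2 - x 0 3 * y 0 3;
      x 0 0 * y 0 1 + x 0 1 * y 0 0 + x 0 2 * y 0 3 - x 0 3 * y 0 2;
      x 0 0 * y 0 2 - x 0 1 * y 0 3 + x 0 2 * y 0 0 + x 0 3 * y 0 1;
      x 0 0 * y 0 3 + x 0 1 * y 0 2 - x 0 2 * y 0 1 + x 0 3 * y 0 0] n.

Definition qconj (x : H) : H := \row_(n < 4) if n == 0 then x 0 n else - x 0 n.

(* T_1 = i, T_2 = j, T_3 = k, so that [T_i, T_j] = 2 eps_ijk T_k; indices are
   shifted by one. *)
Definition su2T (i : 'I_3) : H := delta_mx 0 (lift ord0 i).

End quaternions.

Section geometry.
Variable R : realType.
Local Notation H := 'rV[R]_4.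

(* ambient space of (r_0, oo) x S^3 x S^3 *)
Local Notation amb := (R^o * (H * H))%type.

Variant geometry := BryantSalamon of R | BGGG.

Implicit Type G : geometry.

Definition admissible G : bool := if G is BryantSalamon c then 0 < c else true.

Definition rmin G : R := if G is BryantSalamon c then c else 9 / 4.

Definition tcoord G (r : R) : R :=
  match G with
  | BryantSalamon c =>
      \int[lebesgue_measure]_(x in `[c, r]) (1 / Num.sqrt (1 - c ^+ 3 * x ^- 3))
  | BGGG =>
      \int[lebesgue_measure]_(x in `[9 / 4, r])
        Num.sqrt (((x - 3 / 4) * (x + 3 / 4)) / ((x - 9 / 4) * (x + 9 / 4)))
  end.

Definition A1 G (r : R) : R :=
  match G with
  | BryantSalamon c => r / 3 * Num.sqrt (1 - c ^+ 3 * r ^- 3)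
  | BGGG =>
      Num.sqrt (((r - 9 / 4) * (r + 9 / 4)) / ((r - 3 / 4) * (r + 3 / 4)))
  end.

Definition A2 G (r : R) : R :=
  match G with
  | BryantSalamon c => r / 3 * Num.sqrt (1 - c ^+ 3 * r ^- 3)
  | BGGG => Num.sqrt (((r - 9 / 4) * (r + 3 / 4)) / 3)
  end.

Definition B1 G (r : R) : R :=
  match G with
  | BryantSalamon c => r / Num.sqrt 3
  | BGGG => 2 * r / 3
  end.

Definition B2 G (r : R) : R :=
  match G with
  | BryantSalamon c => r / Num.sqrt 3
  | BGGG => Num.sqrt (((r + 9 / 4) * (r - 3 / 4)) / 3)
  end.

Definition cyl G : set amb :=
  [set y | rmin G < y.1 /\ (sphere 4 `*` sphere 4) y.2].

Definition Tplus (i : 'I_3) (y : amb) : amb :=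
  (0, (qmul y.2.1 (su2T R i), qmul y.2.2 (su2T R i))).
Definition Tminus (i : 'I_3) (y : amb) : amb :=
  (0, (qmul y.2.1 (su2T R i), - qmul y.2.2 (su2T R i))).
Definition partial_r (y : amb) : amb := (1, (0, 0)).

(* The dual coframe: (da, db) has components x_i = <a T_i, da> and
   y_i = <b T_i, db> in the left-invariant orthonormal frames of the two
   factors, and x_i (T_i, 0) + y_i (0, T_i)
   = (x_i + y_i)/2 T_i^+ + (x_i - y_i)/2 T_i^-. *)
Definition etaplus (i : 'I_3) (y u : amb) : R :=
  (dot (qmul y.2.1 (su2T R i)) u.2.1 + dot (qmul y.2.2 (su2T R i)) u.2.2) / 2.
Definition etaminus (i : 'I_3) (y u : amb) : R :=
  (dot (qmul y.2.1 (su2T R i)) u.2.1 - dot (qmul y.2.2 (su2T R i)) u.2.2) / 2.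

Definition dt G (y u : amb) : R := derive1 (tcoord G) y.1 * u.1.

Definition wedge11 (a b : amb -> amb -> R) (y u v : amb) : R :=
  a y u * b y v - a y v * b y u.
Definition wedge12 (a : amb -> amb -> R) (w : amb -> amb -> amb -> R)
    (y u v z : amb) : R :=
  a y u * w y v z - a y v * w y u z + a y z * w y u v.
Definition wedge111 (a b c : amb -> amb -> R) := wedge12 a (wedge11 b c).

Local Notation ep := etaplus.
Local Notation em := etaminus.

Definition omega G (y u v : amb) : R :=
  let r := y.1 in
  4 * A1 G r * B1 G r * wedge11 (em 0) (ep 0) y u v
  + 4 * A2 G r * B2 G r *
    (wedge11 (em 1) (ep 1) y u v + wedge11 (em 2) (ep 2) y u v).

Definition Omegaplus G (y u v w : amb) : R :=
  let r := y.1 in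
  8 * B1 G r * B2 G r ^+ 2 * wedge111 (em 0) (em 1) (em 2) y u v w
  - 8 * A2 G r ^+ 2 * B1 G r * wedge111 (em 0) (ep 1) (ep 2) y u v w
  - 8 * A1 G r * A2 G r * B2 G r *
    (wedge111 (ep 0) (ep 1) (em 2) y u v w
     + wedge111 (ep 0) (em 1) (ep 2) y u v w).

Definition phi_cyl G (y u v w : amb) : R :=
  wedge12 (dt G) (omega G) y u v w + Omegaplus G y u v w.

Definition g_cyl G (y u v : amb) : R :=
  let r := y.1 in
  dt G y u * dt G y v
  + (2 * A1 G r) ^+ 2 * (ep 0 y u * ep 0 y v)
  + (2 * A2 G r) ^+ 2 * (ep 1 y u * ep 1 y v + ep 2 y u * ep 2 y v)
  + (2 * B1 G r) ^+ 2 * (em 0 y u * em 0 y v)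
  + (2 * B2 G r) ^+ 2 * (em 1 y u * em 1 y v + em 2 y u * em 2 y v).

(* R^4 x S^3 *)
Definition R4S3 : set (H * H) := [set: H] `*` sphere 4.
Definition zero_section : set (H * H) := [set 0] `*` sphere 4.

(* The identification of (r_0, oo) x S^3 x S^3 with the complement of the zero
   section.  The spinor bundle is (SU(2) x SU(2)) x_{Delta SU(2)} H, trivialised
   by [a, b, v] |-> (a v, a b^-1); the class of (a, b) in
   SU(2) x SU(2) / Delta SU(2) is a b^-1.  The radius sqrt (r - r_0) in the
   fibres gives the same smooth structure along the zero section as t does,
   because t^2 is a smooth function of r - r_0 with nonzero derivative at 0. *)
Definition toR4S3 G (y : amb) : H * H :=
  (Num.sqrt (y.1 - rmin G) *: y.2.1, qmul y.2.1 (qconj y.2.2)).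

(* g and phi are the smooth extensions of the G_2-structure to R^4 x S^3;
   they are determined by G since the zero section has empty interior. *)
Definition g2_extension G (g : H * H -> H * H -> H * H -> R)
    (phi : H * H -> H * H -> H * H -> H * H -> R) :=
  let f := toR4S3 G in
  [/\ riemannian_metric R4S3 g, form3 R4S3 phi,
      forall y, cyl G y -> forall u v, tangent_space (cyl G) y u ->
        tangent_space (cyl G) y v ->
        g (f y) ('D_u f y) ('D_v f y) = g_cyl G y u v &
      forall y, cyl G y -> forall u v w, tangent_space (cyl G) y u ->
        tangent_space (cyl G) y v -> tangent_space (cyl G) y w ->
        phi (f y) ('D_u f y) ('D_v f y) ('D_w f y) = phi_cyl G y u v w].

Definition distr (y : amb) : set amb :=
  [set u | exists k : 'I_3 -> R,
     u = k 0 *: Tplus 0 y + k 1 *: Tminus 0 y + k 2 *: partial_r y].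

(* Leaves indexed by S^2 x S^2, disjoint off the zero section, where their
   tangent spaces are the images of distr. *)
Definition foliation_of G (leaf : 'rV[R]_3 * 'rV[R]_3 -> set (H * H)) :=
  let S2S2 := sphere 3 `*` sphere 3 in
  [/\ forall s, S2S2 s -> leaf s `<=` R4S3,
      forall p, R4S3 p -> exists2 s, S2S2 s & leaf s p,
      forall s s' p, S2S2 s -> S2S2 s' -> leaf s p -> leaf s' p ->
        ~ zero_section p -> s = s' &
      forall s y, S2S2 s -> cyl G y -> leaf s (toR4S3 G y) ->
        tangent_space (leaf s) (toR4S3 G y) =
        (fun u => 'D_u (toR4S3 G) (y : amb)) @` distr y].

(* Metrics in the coordinates (r, theta_1, theta_2). *)
Definition fibre_metric G (x : 'rV[R]_3) : 'M[R]_3 :=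
  let r := x 0 0 in
  diag_mx (\row_(i < 3) nth 0
    match G with
    | BryantSalamon c =>
        [:: 1 / (1 - c ^+ 3 * r ^- 3);
            r ^+ 2 * (1 - c ^+ 3 * r ^- 3) / 9;
            r ^+ 2 / 3]
    | BGGG =>
        [:: ((r - 3 / 4) * (r + 3 / 4)) / ((r - 9 / 4) * (r + 9 / 4));
            ((r - 9 / 4) * (r + 9 / 4)) / ((r - 3 / 4) * (r + 3 / 4));
            4 * r ^+ 2 / 9]
    end i).

(* (a exp(i alpha), b exp(i beta)) with alpha = (theta_1 + theta_2)/2 and
   beta = (theta_1 - theta_2)/2 sweeps out the torus orbit of (a, b); the
   coordinates theta_1, theta_2 are well defined up to this lattice. *)
Definition same_torus_point (x y : 'rV[R]_3) :=
  exists m n : int, x 0 1 - y 0 1 = 2 * pi * (m + n)%:~R /\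
                    x 0 2 - y 0 2 = 2 * pi * (m - n)%:~R.

(* Coordinates (r, theta_1, theta_2) on L minus the zero section, with
   2 d/dtheta_1 = T_1^+ and 2 d/dtheta_2 = T_1^-. *)
Definition torus_coordinates G (L : set (H * H)) (Psi : 'rV[R]_3 -> H * H) :=
  let dom := [set x : 'rV[R]_3 | rmin G < x 0 0] in
  let f := toR4S3 G in
  [/\ smooth dom Psi, Psi @` dom = L `\` zero_section,
      forall x y, dom x -> dom y ->
        (Psi x = Psi y <-> x 0 0 = y 0 0 /\ same_torus_point x y) &
      forall x, dom x -> exists2 y : amb, cyl G y /\ Psi x = f y &
        [/\ y.1 = x 0 0,
            'D_(delta_mx 0 0) Psi x = 'D_(partial_r y) f y,
            2 *: 'D_(delta_mx 0 1) Psi x = 'D_(Tplus 0 y) f y &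
            2 *: 'D_(delta_mx 0 2) Psi x = 'D_(Tminus 0 y) f y]].

End geometry.
Arguments BryantSalamon {R} _.
Arguments BGGG {R}.
Arguments R4S3 {R}.
Arguments zero_section {R}.

Section asymptotics.
Variable R : realType.
Local Notation E := 'rV[R]_3.
Implicit Types g h : E -> 'M[R]_3.

Definition pd (k : 'I_3) (f : E -> R^o) (x : E) : R := 'D_(delta_mx 0 k) f x.

Definition christoffel g (l i j : 'I_3) (x : E) : R :=
  \sum_m invmx (g x) l m *
    (pd i (fun y => g y j m) x + pd j (fun y => g y i m) x
     - pd m (fun y => g y i j) x) / 2.

(* A covariant k-tensor is given by its components on multi-indices of size k;
   nabla puts the differentiation index first. *)
Definition nabla g (T : E -> seq 'I_3 -> R) (x : E) (I : seq 'I_3) : R :=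
  if I is k :: J then
    pd k (fun y => T y J) x
    - \sum_(s < size J) \sum_l
        christoffel g l k (nth 0 J s) x * T x (set_nth 0 J s l)
  else 0.

Definition tensor_norm g (k : nat) (T : E -> seq 'I_3 -> R) (x : E) : R :=
  Num.sqrt (\sum_(I : k.-tuple 'I_3) \sum_(J : k.-tuple 'I_3)
    (\prod_(s < k) invmx (g x) (tnth I s) (tnth J s)) * T x I * T x J).

Definition metric_diff g h (x : E) (I : seq 'I_3) : R :=
  (g x - h x) (nth 0 I 0) (nth 0 I 1).

(* |nabla^j (g - h)| = O(r^(nu - j)) for all j, for some rate nu < 0, with
   nabla and the norm taken with respect to h. *)
Definition asymptotic_metrics g h :=
  exists2 nu : R, nu < 0 & forall j : nat, exists C R0 : R,
    forall x : E, R0 < x 0 0 ->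
      tensor_norm h j.+2 (iter j (nabla h) (metric_diff g h)) x
      <= C * (x 0 0) `^ (nu - j%:R).

(* dr^2 + r^2 k.  A metric k on the link is a function of (theta_1, theta_2)
   up to the period lattice; the second clause of link_metric also says that k
   does not depend on r. *)
Definition cone_metric (k : E -> 'M[R]_2) (x : E) : 'M[R]_3 :=
  block_mx (1%:M : 'M[R]_1) 0 0 ((x 0 0) ^+ 2 *: k x).

Definition link_metric (k : E -> 'M[R]_2) :=
  [/\ smooth [set: E] k,
      forall x y, same_torus_point x y -> k x = k y &
      forall x, (k x)^T = k x /\
        forall v : 'rV[R]_2, v != 0 -> 0 < (v *m k x *m v^T) 0 0].

Definition asymptotically_conical g :=
  exists2 k, link_metric k & asymptotic_metrics g (cone_metric k).

(* Polar coordinates (r, b theta_2) on R^2 and the coordinate a theta_1 on the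
   circle (or its universal cover). *)
Definition cylindrical (a b : R) (x : E) : E :=
  \row_(i < 3) nth 0 [:: x 0 0 * cos (b * x 0 2);
                         x 0 0 * sin (b * x 0 2);
                         a * x 0 1] i.

(* The pullback of the Euclidean metric of R^2 x R.  The flatness and the
   product decomposition are local: no condition relates a, b to the periods
   of theta_1, theta_2. *)
Definition flat_product_metric (a b : R) (x : E) : 'M[R]_3 :=
  \matrix_(i < 3, j < 3) dot ('D_(delta_mx 0 i) (cylindrical a b) x)
                             ('D_(delta_mx 0 j) (cylindrical a b) x).

Definition asymptotically_flat_product g :=
  exists a b : R, [/\ 0 < a, 0 < b &
    asymptotic_metrics g (flat_product_metric a b)].

End asymptotics.

(* Main.v *)
From HB Require Import structures.
Require Import Defs.
From mathcomp Require Import all_boot all_order all_algebra.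
From mathcomp Require Import all_classical all_reals all_analysis.
From mathcomp Require Import measurable_realfun.
From mathcomp Require Import ring lra.
Import Order.TTheory GRing.Theory Num.Theory numFieldNormedType.Exports.
Set Implicit Arguments.
Unset Strict Implicit.
Unset Printing Implicit Defensive.
Local Open Scope classical_set_scope.
Local Open Scope ring_scope.

(** Write (x, q) for the points of R^4 x S^3, with x a quaternion and q a unit
   quaternion; the point (r, a, b) of the cylinder becomes x = rho a, q = a b^-1
   with rho^2 = r - r_0. The flows of T_1^+ and T_1^- multiply a and b on the
   right by exp(i t), so a i a^-1 and b i b^-1 are constant along the
   distribution. Their values (s1, s2) in S^2 x S^2 index the leaves, and the
   equations a i a^-1 = s1, b i b^-1 = s2 can be written without inverses as
     x i = s1 x,   q s2 = s1 q,   |q| = 1,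
   which define the leaf also on the zero section. If a and b are fixed unit
   quaternions carrying i to s1 and s2, the solutions are x = a z, q = a w b^-1
   with z complex and w complex of modulus 1. Hence a leaf is a plane times a
   circle (leaf_diffeo), it meets the zero section in the circle z = 0
   (leaf_zero_diffeo), and a point q of the zero section lies in the leaves with
   s2 = q^-1 s1 q, a 2-sphere of them (leaf_family). For x nonzero, s1 = x i x^-1
   and s2 = q^-1 s1 q are functions of the point (leaf_proj), and the two local
   sections p - s p i, p = 1 or j, of the Hopf fibration trivialise the resulting
   fibration (proj_fibre_bundle).

   The tangent space of a leaf is the image of the distribution, since it is cut
   out by the same equations (leaf_tangent, leaf_tangent_distr). The vectors
   d/dr, T_1^-, T_1^+ are orthogonal of lengths dt/dr, 2 B_1, 2 A_1, and phi takes
   the product of these lengths on them; so off the zero section phi is the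
   volume form of the leaf (calibrated_off_zero). The fields (a, 0), (0, s1 q),
   (a i, 0) frame the leaf also at x = 0, and they are smooth on R^4 x S^3; hence
   the statement that phi on them is the square root of their Gram determinant
   passes to the limit (calibrated_frame, leaf_calibrated). The lengths also give
   the fibre metrics (Psi_metric), where dt/dr is the integrand of the arc length
   by the fundamental theorem of calculus: its singularity at r_0 is of order 1/2,
   hence integrable (integrable_sqrt_singularity, derive_tcoord).

   For the asymptotics, the coefficients of the metrics are symbols in r: their
   m-th derivative loses m powers of r. Giving each angle the weight 1 if its
   circle grows linearly and 0 if not, the Christoffel symbols of the model and
   the components of a tensor have orders which depend only on the weights of
   their indices, and nabla lowers the order by 1 (symbolE_nabla). So it suffices
   to compare three functions of r (asymptotic_diag). *)

(** * Smooth maps *)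

Section smooth_calculus.
Variable R : realType.
Implicit Types U V W : normedModType R.

(** Differentiability at a point depends only on the germ. *)
Lemma near_eq_differentiable V W (f g : V -> W) x :
  (\near x, f x = g x) -> differentiable f x -> differentiable g x.
Proof.
move=> fg df.
have fgx : f x = g x by exact: nbhs_singleton fg.
have H : g \o shift x = cst (g x) + ('d f x : V -> W) +o_ 0 id.
  have /eqaddoP Hf := diff_locally df.
  apply/eqaddoP => e e0; move: (Hf e e0).
  have fg0 : \forall y \near (0 : V), f (y + x) = g (y + x).
    by by move: fg; rewrite (near_shift 0 x) subr0.
  rewrite !near_simpl; apply: filterS2 fg0 => y.
  rewrite !fctE /= => ->.
  by rewrite -fgx.
have dc : continuous ('d f x) by exact: diff_continuous.
have E : 'd g x = 'd f x :> (V -> W) by exact: diff_unique dc H.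
by apply/diff_locallyP; rewrite E.
Qed.

Lemma open_near V (O : set V) x (P : V -> Prop) : open O -> O x ->
  (forall y, O y -> P y) -> \near x, P x.
Proof.
move=> oO Ox HP; have : nbhs x O by exact: open_nbhs_nbhs.
by apply: filterS.
Qed.

(** The rules of differentiation hold only where the functions are
   differentiable, that is on O; this lets the inductions below replace a
   derivative by its formula there. *)
Lemma Ck_ext V W k (O : set V) (f g : V -> W) : open O ->
  (forall x, O x -> f x = g x) -> Ck k O f -> Ck k O g.
Proof.
move=> oO; elim: k f g => [|k IH] f g fg /=.
  move=> cf x Ox.
  have N : \near x, f x = g x by exact: open_near fg.
  have H : f @ x --> g x by rewrite -(fg _ Ox); exact: cf.
  by apply: cvg_trans H; apply: near_eq_cvg.
move=> [df dk]; split.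
  move=> x Ox; apply: near_eq_differentiable (df x Ox); exact: open_near fg.
move=> v; apply: IH (dk v) => x Ox.
apply: near_eq_derive; exact: open_near fg.
Qed.

Lemma Ck_sub V W k (O O' : set V) (f : V -> W) : O' `<=` O ->
  Ck k O f -> Ck k O' f.
Proof.
move=> sub; elim: k f => [|k IH] f /=; first by move=> H x /sub; exact: H.
by move=> [df dk]; split; [move=> x /sub; exact: df|move=> v; exact: IH].
Qed.

Lemma Ck_pred V W k (O : set V) (f : V -> W) : Ck k.+1 O f -> Ck k O f.
Proof.
elim: k f => [|k IH] f.
  by move=> [df _] x Ox; apply: differentiable_continuous; exact: df.
by move=> [df dk]; split=> // v; apply: IH; exact: dk.
Qed.

Lemma Ck_cst V W k (O : set V) (c : W) : Ck k O (fun=> c).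
Proof.
elim: k c => [|k IH] c /=; first by move=> x _; exact: cst_continuous.
split=> [x _|v]; first exact: differentiable_cst.
have -> : 'D_v (fun=> c) = (fun=> 0) :> (V -> W); last exact: IH.
by apply/funext => x; exact: (derive_cst c x v).
Qed.

Lemma Ck_add V W k (O : set V) (f g : V -> W) : open O ->
  Ck k O f -> Ck k O g -> Ck k O (fun x => f x + g x).
Proof.
move=> oO; elim: k f g => [|k IH] f g /=.
  by move=> cf cg x Ox; apply: continuousD; [exact: (cf _ Ox)|exact: (cg _ Ox)].
move=> [df dkf] [dg dkg]; split.
  by move=> x Ox; apply: differentiableD; [exact: df|exact: dg].
move=> v; apply: (@Ck_ext _ _ _ _ (fun x => 'D_v f x + 'D_v g x)) => //.
  by move=> x Ox; rewrite deriveD//; apply: diff_derivable; auto.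
exact: IH.
Qed.

(** A directional derivative commutes with a continuous linear map even where
   the function is not differentiable, so it can be computed by coordinates. *)
Lemma is_derive_lin V W W' (L : {linear W -> W'}) (f : V -> W) x v df :
  continuous L -> is_derive x v f df -> is_derive x v (L \o f) (L df).
Proof.
move=> cL [/derivableP [Df _] <-].
have H : (fun h => h^-1 *: (((L \o f) \o shift x) (h *: v) - (L \o f) x)) @ 0^'
   --> L ('D_v f x).
  rewrite (_ : (fun h => _) = L \o
     (fun h => h^-1 *: ((f \o shift x) (h *: v) - f x))); last first.
    by apply/funext => h /=; rewrite -linearB -linearZ_LR.
  by apply: cvg_comp; [exact: Df|exact: cL].
split; first by apply/cvg_ex; exists (L ('D_v f x)).
exact/cvg_lim.
Qed.

Lemma Ck_lin V W W' k (L : {linear W -> W'}) (O : set V) (f : V -> W) :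
  open O -> continuous L -> Ck k O f -> Ck k O (L \o f).
Proof.
move=> oO cL; elim: k f => [|k IH] f /=.
  by move=> cf x Ox; apply: continuous_comp; [exact: (cf _ Ox)|exact: cL].
move=> [df dk]; split.
  move=> x Ox; apply: differentiable_comp; first exact: df.
  exact: linear_differentiable.
move=> v; apply: (@Ck_ext _ _ _ _ (L \o 'D_v f)) => //; last exact: IH.
move=> x Ox; apply/esym.
by apply: (@derive_val _ _ _ _ _ _ _ (is_derive_lin cL _)); apply/derivableP/diff_derivable/df.
Qed.

Lemma Ck_mul V k (O : set V) (f g : V -> R^o) : open O ->
  Ck k O f -> Ck k O g -> Ck k O (fun x => f x * g x : R^o).
Proof.
move=> oO; elim: k f g => [|k IH] f g.
  by move=> /= cf cg x Ox; apply: continuousM; [exact: (cf _ Ox)|exact: (cg _ Ox)].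
move=> hf hg; have hf' := Ck_pred hf; have hg' := Ck_pred hg.
move: hf hg => [df dkf] [dg dkg]; split.
  by move=> x Ox; apply: differentiableM; [exact: df|exact: dg].
move=> v; apply: (@Ck_ext _ _ _ _ (fun x => f x * 'D_v g x + 'D_v f x * g x)) => //.
  move=> x Ox.
  rewrite [RHS](@deriveM _ _ f g)//; [|exact/diff_derivable/df|exact/diff_derivable/dg].
  by congr (_ + _); exact: mulrC.
by apply: Ck_add => //; apply: IH => //; [exact: dkg|exact: dkf].
Qed.

(** With a scalar h the derivative of the composite along v is the product of
   the scalar functions (D_1 h) o f and D_v f, so the induction never needs the
   derivative of a map along a varying direction. All maps below are polynomial
   in their coordinates and such composites, and need no other chain rule. *)
Lemma Ck_comp V k (O : set V) (D : set R^o) (h : R^o -> R^o) (f : V -> R^o) :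
  open O -> (forall x, O x -> D (f x)) ->
  Ck k D h -> Ck k O f -> Ck k O (h \o f).
Proof.
move=> oO OD; elim: k h => [|k IH] h.
  by move=> /= ch cf x Ox; apply: continuous_comp; [exact: (cf _ Ox)|exact: (ch _ (OD _ Ox))].
move=> hh hf; have hf' := Ck_pred hf.
move: hh hf => [dh dkh] [df dkf]; split.
  by move=> x Ox; apply: differentiable_comp; [exact: df|exact/dh/OD].
move=> v; apply: (@Ck_ext _ _ _ _ (fun x => ('D_1 h \o f) x * 'D_v f x)) => //.
  move=> x Ox /=.
  have dhx := dh _ (OD _ Ox); have dfx := df _ Ox.
  rewrite [RHS]deriveE; last exact: differentiable_comp.
  rewrite diff_comp//= !deriveE//.
  rewrite mulrC -[_ * _]/('d f x v *: ('d h (f x) (1 : R^o) : R^o)).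
  by rewrite -linearZ_LR /GRing.scale/= mulr1.
apply: Ck_mul => //; last exact: dkf.
by apply: IH => //; exact: dkh.
Qed.



Lemma smooth_subset V W (O O' : set V) (f : V -> W) : O' `<=` O ->
  smooth O f -> smooth O' f.
Proof. by move=> S H k; exact: Ck_sub (H k). Qed.

Lemma smooth_cst V W (O : set V) (c : W) : smooth O (fun=> c).
Proof. by move=> k; exact: Ck_cst. Qed.

Lemma smooth_add V W (O : set V) (f g : V -> W) : open O ->
  smooth O f -> smooth O g -> smooth O (fun x => f x + g x).
Proof. by move=> oO hf hg k; exact: Ck_add. Qed.

Lemma smooth_lin V W W' (L : {linear W -> W'}) (O : set V) (f : V -> W) :
  open O -> continuous L -> smooth O f -> smooth O (fun x => L (f x)).
Proof. by move=> oO cL hf k; exact: Ck_lin. Qed.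

Lemma smooth_mul V (O : set V) (f g : V -> R^o) : open O ->
  smooth O f -> smooth O g -> smooth O (fun x => f x * g x : R^o).
Proof. by move=> oO hf hg k; exact: Ck_mul. Qed.

Lemma smooth_comp V (O : set V) (D : set R^o) (h : R^o -> R^o) (f : V -> R^o) :
  smooth D h -> open O -> (forall x, O x -> D (f x)) ->
  smooth O f -> smooth O (fun x => h (f x)).
Proof. by move=> hh oO OD hf k; exact: (@Ck_comp _ k O D h f). Qed.

Lemma smooth_differentiable V W (O : set V) (f : V -> W) x :
  smooth O f -> O x -> differentiable f x.
Proof. by move=> /(_ 1)[+ _]; apply. Qed.

Lemma smooth_continuous V W (O : set V) (f : V -> W) x :
  smooth O f -> O x -> {for x, continuous f}.
Proof. by move=> /(_ 0); apply. Qed.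

Lemma smooth_id V (O : set V) : smooth O (fun x => x).
Proof.
case=> [|k] /=; first by move=> x _; exact: cvg_id.
split=> [x _|v].
  by apply: (@linear_differentiable _ _ _ idfun) => y; exact: cvg_id.
have -> : 'D_v (fun x => x) = (fun=> v) :> (V -> V); last exact: Ck_cst.
by apply/funext => x; exact: derive_id.
Qed.


Lemma smooth_scalel V W (O : set V) (c : W) (f : V -> R^o) : open O ->
  smooth O f -> smooth O (fun x => f x *: c).
Proof.
move=> oO hf.
have lc : linear (fun k : R^o => k *: c : W).
  by move=> a x y; rewrite scalerDl scalerA.
pose LM := GRing.isLinear.Build _ _ _ _ _ lc.
pose L : {linear R^o -> W} := HB.pack (fun k : R^o => k *: c : W) LM.
apply: (@smooth_lin _ _ _ L) => //.
by move=> x; apply: cvgZr_tmp; exact: cvg_id.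
Qed.

Lemma smooth_opp V W (O : set V) (f : V -> W) : open O ->
  smooth O f -> smooth O (fun x => - f x).
Proof.
move=> oO hf; apply: (@smooth_lin _ _ _ (-%R : {linear W -> W})) => //.
exact: opp_continuous.
Qed.

Lemma smooth_sub_fun V W (O : set V) (f g : V -> W) : open O ->
  smooth O f -> smooth O g -> smooth O (fun x => f x - g x).
Proof. by move=> oO hf hg; apply: smooth_add => //; exact: smooth_opp. Qed.

Lemma smooth_sum V W n (O : set V) (f : 'I_n -> V -> W) : open O ->
  (forall i, smooth O (f i)) -> smooth O (fun x => \sum_i f i x).
Proof.
move=> oO; elim: n f => [|n IH] f hf.
  rewrite (_ : (fun x => _) = fun=> 0); first exact: smooth_cst.
  by apply/funext => x; rewrite big_ord0.
rewrite (_ : (fun x => _) = fun x => f ord0 x + \sum_i f (lift ord0 i) x).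
  by apply: smooth_add => //; apply: IH.
by apply/funext => x; rewrite big_ord_recl.
Qed.

Lemma smooth_coord V n (O : set V) (f : V -> 'rV[R]_n.+1) i : open O ->
  smooth O f -> smooth O (fun x => f x 0 i : R^o).
Proof.
move=> oO hf.
have lc : linear (fun v : 'rV[R]_n.+1 => v 0 i : R^o).
  by move=> a x y; rewrite !mxE.
pose LM := GRing.isLinear.Build _ _ _ _ _ lc.
pose L : {linear 'rV[R]_n.+1 -> R^o} :=
  HB.pack (fun v : 'rV[R]_n.+1 => v 0 i : R^o) LM.
apply: (@smooth_lin _ _ _ L) => //.
exact: coord_continuous.
Qed.

Lemma smooth_rowP V n (O : set V) (f : V -> 'rV[R]_n.+1) : open O ->
  (forall i, smooth O (fun x => f x 0 i : R^o)) -> smooth O f.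
Proof.
move=> oO hf.
rewrite (_ : f = fun x => \sum_i (f x 0 i : R^o) *: (delta_mx 0 i : 'rV[R]_n.+1)).
  by apply: smooth_sum => // i; apply: smooth_scalel.
by apply/funext => x; rewrite [LHS]row_sum_delta.
Qed.

Lemma smooth_fst V W W' (O : set V) (f : V -> W * W') : open O ->
  smooth O f -> smooth O (fun x => (f x).1).
Proof.
move=> oO hf.
apply: (@smooth_lin _ _ _ (fst : {linear (W * W')%type -> W})) => //.
by move=> x; exact: cvg_fst.
Qed.

Lemma smooth_snd V W W' (O : set V) (f : V -> W * W') : open O ->
  smooth O f -> smooth O (fun x => (f x).2).
Proof.
move=> oO hf.
apply: (@smooth_lin _ _ _ (snd : {linear (W * W')%type -> W'})) => //.
by move=> x; exact: cvg_snd.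
Qed.

Lemma smooth_pair V W W' (O : set V) (f : V -> W) (g : V -> W') : open O ->
  smooth O f -> smooth O g -> smooth O (fun x => (f x, g x)).
Proof.
move=> oO hf hg.
have l1 : linear (fun w : W => (w, 0) : W * W').
  by move=> a x y; congr (_, _); rewrite /= scaler0 addr0.
have l2 : linear (fun w : W' => (0, w) : W * W').
  by move=> a x y; congr (_, _); rewrite /= scaler0 addr0.
pose LM1 := GRing.isLinear.Build _ _ _ _ _ l1.
pose L1 : {linear W -> (W * W')%type} := HB.pack (fun w : W => (w, 0) : W * W') LM1.
pose LM2 := GRing.isLinear.Build _ _ _ _ _ l2.
pose L2 : {linear W' -> (W * W')%type} := HB.pack (fun w : W' => (0, w) : W * W') LM2.
rewrite (_ : (fun x => _) = fun x => L1 (f x) + L2 (g x)).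
  apply: smooth_add => //; apply: smooth_lin => // x.
    by apply: cvg_pair; [exact: cvg_id|exact: cvg_cst].
  by apply: cvg_pair; [exact: cvg_cst|exact: cvg_id].
by apply/funext => x; congr (_, _); rewrite /= ?addr0 ?add0r.
Qed.

Lemma smooth_on_smooth V W (S O : set V) (f : V -> W) :
  open O -> S `<=` O -> smooth O f -> smooth_on S f.
Proof. by move=> oO SO hf x Sx; exists O, f; split=> //; exact: SO. Qed.

End smooth_calculus.

Section smooth_functions.
Variable R : realType.
Implicit Types V W : normedModType R.

(** For a function of one variable one derivative is enough, since the others
   are its multiples by constants. *)
Lemma Ck_real k (D : set R^o) (h dh : R^o -> R^o) : open D ->
  (forall x, D x -> is_derive x 1 h (dh x)) -> Ck k D dh -> Ck k.+1 D h.
Proof.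
move=> oD H hk; split.
  by move=> x Dx; apply/derivable1_diffP; have [] := H x Dx.
move=> v; apply: (@Ck_ext _ _ _ _ _ (fun x => dh x * v : R^o)) => //.
  move=> x Dx; have [dx <-] := H x Dx; move/derivable1_diffP in dx.
  rewrite !deriveE// mulrC -[_ * _]/(v *: ('d h x (1 : R^o) : R^o)).
  by rewrite -linearZ_LR /GRing.scale/= mulr1.
by apply: Ck_mul => //; exact: Ck_cst.
Qed.

Lemma open_neq0 : open [set x : R^o | x != 0].
Proof. exact: open_neq. Qed.

Lemma open_gt0 : open [set x : R^o | 0 < x].
Proof. exact: open_gt. Qed.

Lemma smooth_inv : smooth [set x : R^o | x != 0] (fun x : R^o => x^-1 : R^o).
Proof.
elim=> [|k IH]; first by move=> x x0; exact: inv_continuous.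
apply: (@Ck_real _ _ _ (fun x : R^o => -1 * (x^-1 * x^-1) : R^o)).
- exact: open_neq0.
- move=> x x0; apply: is_derive_eq.
    exact: is_deriveV.
  by rewrite /GRing.scale/= mulr1 -exprVn expr2 mulN1r.
apply: Ck_mul; [exact: open_neq0|exact: Ck_cst|].
by apply: Ck_mul => //; exact: open_neq0.
Qed.

Lemma smooth_sqrt : smooth [set x : R^o | 0 < x] (Num.sqrt : R^o -> R^o).
Proof.
elim=> [|k IH]; first by move=> x x0; exact: sqrt_continuous.
have D (x : R^o) : 0 < x -> is_derive x 1 (Num.sqrt : R^o -> R^o) (2 * Num.sqrt x)^-1.
  exact: is_derive1_sqrt.
apply: (Ck_real open_gt0 D).
apply: (@Ck_comp _ _ _ _ [set x : R^o | x != 0] (fun x : R^o => x^-1 : R^o)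
  (fun x => 2 * Num.sqrt x : R^o)).
- exact: open_gt0.
- by move=> x /= x0; rewrite mulf_neq0 ?pnatr_eq0// gt_eqF ?sqrtr_gt0.
- exact: smooth_inv.
by apply: Ck_mul => //; exact: open_gt0 || exact: Ck_cst.
Qed.

(** Each of the two functions is up to sign the derivative of the other. *)
Lemma smooth_cos_sin k : Ck k [set: R^o] (@cos R : R^o -> R^o) /\
   Ck k [set: R^o] (@sin R : R^o -> R^o).
Proof.
elim: k => [|k [IHc IHs]].
  by split=> x _; [exact: continuous_cos|exact: continuous_sin].
split.
  have D (x : R^o) : [set: R^o] x ->
      is_derive x 1 (@cos R : R^o -> R^o) (-1 * sin x).
    by move=> _; rewrite mulN1r; exact: is_derive_cos.
  apply: (Ck_real openT D).
  by apply: Ck_mul => //; exact: openT || exact: Ck_cst.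
have D (x : R^o) : [set: R^o] x -> is_derive x 1 (@sin R : R^o -> R^o) (cos x).
  by move=> _; exact: is_derive_sin.
exact: (Ck_real openT D).
Qed.

Lemma smooth_cos : smooth [set: R^o] (@cos R : R^o -> R^o).
Proof. by move=> k; have [] := smooth_cos_sin k. Qed.
Lemma smooth_sin : smooth [set: R^o] (@sin R : R^o -> R^o).
Proof. by move=> k; have [] := smooth_cos_sin k. Qed.

Lemma smooth_compT V (O : set V) (h : R^o -> R^o) (f : V -> R^o) :
  smooth [set: R^o] h -> open O -> smooth O f -> smooth O (fun x => h (f x)).
Proof. by move=> hh oO; exact: smooth_comp hh oO _. Qed.

Lemma smooth_invf V (O : set V) (f : V -> R^o) : open O ->
  (forall x, O x -> f x != 0) -> smooth O f -> smooth O (fun x => (f x)^-1 : R^o).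
Proof. by move=> oO f0; apply: (smooth_comp smooth_inv). Qed.

Lemma smooth_sqrtf V (O : set V) (f : V -> R^o) : open O ->
  (forall x, O x -> 0 < f x) -> smooth O f ->
  smooth O (fun x => Num.sqrt (f x) : R^o).
Proof. by move=> oO f0; apply: (smooth_comp smooth_sqrt). Qed.

Lemma smooth_scale V n (O : set V) (f : V -> R^o) (g : V -> 'rV[R]_n.+1) :
  open O -> smooth O f -> smooth O g -> smooth O (fun x => f x *: g x).
Proof.
move=> oO hf hg; apply: smooth_rowP => // i.
have -> : (fun x => (f x *: g x) 0 i) = (fun x => f x * g x 0 i).
  by apply/funext => x; rewrite mxE.
by apply: smooth_mul => //; exact: smooth_coord.
Qed.

Lemma smooth_dot V n (O : set V) (f g : V -> 'rV[R]_n.+1) :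
  open O -> smooth O f -> smooth O g -> smooth O (fun x => dot (f x) (g x) : R^o).
Proof.
move=> oO hf hg; apply: smooth_sum => // i.
by apply: smooth_mul => //; exact: smooth_coord.
Qed.

Lemma smooth_open_gt V (O : set V) (f : V -> R^o) : open O -> smooth O f ->
  open (O `&` [set x | 0 < f x]).
Proof.
move=> oO hf; rewrite openE => x [Ox fx].
apply: filterI; first exact: open_nbhs_nbhs.
have cf := smooth_continuous hf Ox.
apply: (cf [set y | 0 < y]).
by apply: open_nbhs_nbhs; split => //; exact: open_gt0.
Qed.

(** * Directional derivatives *)

Lemma is_derive_row V n (f : V -> 'rV[R]_n) x v (df : 'rV[R]_n) :
  (forall i, is_derive x v (fun y => f y 0 i : R^o) (df 0 i)) ->
  is_derive x v f df.
Proof.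
move=> H.
have D : derivable f x v.
  by apply/derivable_mxP => i j; rewrite ord1; have [] := H j.
split=> //; rewrite derive_mx//; apply/rowP => j; rewrite mxE.
by have [] := H j.
Qed.

Lemma is_derive_coord V n (f : V -> 'rV[R]_n) x v (df : 'rV[R]_n) i :
  is_derive x v f df -> is_derive x v (fun y => f y 0 i : R^o) (df 0 i).
Proof.
move=> [D <-]; have := D => /derivable_mxP/(_ 0 i) Di.
by split => //; rewrite derive_mx// mxE.
Qed.

Lemma is_derive_pair V W W' (f : V -> W) (g : V -> W') x v df dg :
  is_derive x v f df -> is_derive x v g dg ->
  is_derive x v (fun y => (f y, g y)) (df, dg).
Proof.
move=> [Df <-] [Dg <-].
have H : (fun h : R => h^-1 *: (((fun y => (f y, g y)) \o shift x) (h *: v) -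
    (f x, g x))) @ 0^' --> ('D_v f x, 'D_v g x).
  by apply: cvg_pair; [exact: Df|exact: Dg].
split; first by apply/cvg_ex; exists ('D_v f x, 'D_v g x).
exact/cvg_lim.
Qed.

Lemma is_derive_fst V W W' (f : V -> W * W') x v df :
  is_derive x v f df -> is_derive x v (fun y => (f y).1) df.1.
Proof.
move=> H; apply: (is_derive_lin (L := (fst : {linear (W * W')%type -> W}))) => //.
by move=> p; exact: cvg_fst.
Qed.

Lemma is_derive_snd V W W' (f : V -> W * W') x v df :
  is_derive x v f df -> is_derive x v (fun y => (f y).2) df.2.
Proof.
move=> H; apply: (is_derive_lin (L := (snd : {linear (W * W')%type -> W'}))) => //.
by move=> p; exact: cvg_snd.
Qed.

Lemma is_derive_mul V (f g : V -> R^o) x v (df dg : R) :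
  is_derive x v f df -> is_derive x v g dg ->
  is_derive x v (fun y => f y * g y : R^o) (df * g x + f x * dg).
Proof.
move=> hf hg; have H := is_deriveM hf hg.
have -> : df * g x + f x * dg = f x *: dg + g x *: df.
  by rewrite /GRing.scale/= addrC [df * _]mulrC.
exact: H.
Qed.

Lemma is_derive_add V W (f g : V -> W) x v df dg :
  is_derive x v f df -> is_derive x v g dg ->
  is_derive x v (fun y => f y + g y) (df + dg).
Proof. by move=> hf hg; exact: is_deriveD. Qed.

Lemma is_derive_oppf V W (f : V -> W) x v df :
  is_derive x v f df -> is_derive x v (fun y => - f y) (- df).
Proof. by move=> hf; exact: is_deriveN. Qed.

Lemma is_derive_sub V W (f g : V -> W) x v df dg :
  is_derive x v f df -> is_derive x v g dg ->
  is_derive x v (fun y => f y - g y) (df - dg).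
Proof. by move=> hf hg; exact: is_deriveB. Qed.

Lemma is_derive_scale V n (f : V -> R^o) (g : V -> 'rV[R]_n) x v (df : R) dg :
  is_derive x v f df -> is_derive x v g dg ->
  is_derive x v (fun y => f y *: g y) (df *: g x + f x *: dg).
Proof.
move=> hf hg; apply: is_derive_row => i.
have -> : (fun y => (f y *: g y) 0 i) = (fun y => f y * g y 0 i).
  by apply/funext => y; rewrite mxE.
rewrite !mxE; apply: is_derive_mul => //; exact: is_derive_coord.
Qed.

Lemma is_derive_dot V n (f g : V -> 'rV[R]_n) x v df dg :
  is_derive x v f df -> is_derive x v g dg ->
  is_derive x v (fun y => dot (f y) (g y) : R^o) (dot df (g x) + dot (f x) dg).
Proof.
move=> hf hg; rewrite /dot -big_split/=.
have -> : (fun y => \sum_i f y 0 i * g y 0 i) =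
    \sum_i (fun y => f y 0 i * g y 0 i : R^o).
  by apply/funext => y; rewrite fct_sumE.
by apply: is_derive_sum => i; apply: is_derive_mul; exact: is_derive_coord.
Qed.

Lemma is_derive_curve V W (F : V -> W) (c : R^o -> V) t dc :
  differentiable F (c t) -> is_derive t 1 c dc ->
  is_derive t 1 (F \o c) ('D_dc F (c t)).
Proof.
move=> dF [/derivable1_diffP dcc <-].
have D : differentiable (F \o c) t by exact: differentiable_comp.
split; first exact/derivable1_diffP.
by rewrite deriveE// diff_comp//= !deriveE.
Qed.

Lemma is_derive_uniq V W (f : V -> W) x v df df' :
  is_derive x v f df -> is_derive x v f df' -> df = df'.
Proof. by move=> [_ <-] [_ <-]. Qed.



End smooth_functions.

(** * Quaternions *)

Section quaternion_algebra.
Variable R : realType.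
Local Notation H := 'rV[R]_4.
Implicit Types x y z : H.

Definition quat (a b c d : R) : H := \row_(n < 4) nth 0 [:: a; b; c; d] n.
Definition qone : H := quat 1 0 0 0.
Definition qI : H := su2T R 0.
Definition im (s : 'rV[R]_3) : H := quat 0 (s 0 0) (s 0 1) (s 0 2).
Definition imv x : 'rV[R]_3 :=
  \row_(n < 3) nth 0 [:: x 0 1; x 0 2; x 0 3] n.
Definition cplx (w : 'rV[R]_2) : H := quat (w 0 0) (w 0 1) 0 0.
Definition cplxv x : 'rV[R]_2 := \row_(n < 2) nth 0 [:: x 0 0; x 0 1] n.

Lemma ord4P (P : 'I_4 -> Prop) : P 0 -> P 1 -> P 2 -> P 3 -> forall i, P i.
Proof.
move=> P0 P1 P2 P3 [[|[|[|[|i]]]] Hi] //.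
- by rewrite (_ : Ordinal Hi = 0)//; exact: val_inj.
- by rewrite (_ : Ordinal Hi = 1)//; exact: val_inj.
- by rewrite (_ : Ordinal Hi = 2)//; exact: val_inj.
- by rewrite (_ : Ordinal Hi = 3)//; exact: val_inj.
Qed.

Lemma ord3P (P : 'I_3 -> Prop) : P 0 -> P 1 -> P 2 -> forall i, P i.
Proof.
move=> P0 P1 P2 [[|[|[|i]]] Hi] //.
- by rewrite (_ : Ordinal Hi = 0)//; exact: val_inj.
- by rewrite (_ : Ordinal Hi = 1)//; exact: val_inj.
- by rewrite (_ : Ordinal Hi = 2)//; exact: val_inj.
Qed.

Lemma ord2P (P : 'I_2 -> Prop) : P 0 -> P 1 -> forall i, P i.
Proof.
move=> P0 P1 [[|[|i]] Hi] //.
- by rewrite (_ : Ordinal Hi = 0)//; exact: val_inj.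
- by rewrite (_ : Ordinal Hi = 1)//; exact: val_inj.
Qed.

Lemma row4P x y : x 0 0 = y 0 0 -> x 0 1 = y 0 1 -> x 0 2 = y 0 2 ->
  x 0 3 = y 0 3 -> x = y.
Proof. by move=> *; apply/rowP; apply: ord4P. Qed.

Lemma row3P (x y : 'rV[R]_3) : x 0 0 = y 0 0 -> x 0 1 = y 0 1 ->
  x 0 2 = y 0 2 -> x = y.
Proof. by move=> *; apply/rowP; apply: ord3P. Qed.

Lemma row2P (x y : 'rV[R]_2) : x 0 0 = y 0 0 -> x 0 1 = y 0 1 -> x = y.
Proof. by move=> *; apply/rowP; apply: ord2P. Qed.

Lemma sum_ord4 (F : 'I_4 -> R) : \sum_i F i = F 0 + F 1 + F 2 + F 3.
Proof.
rewrite !big_ord_recl big_ord0 addr0 !addrA.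
by congr (F _ + F _ + F _ + F _); exact: val_inj.
Qed.

Lemma sum_ord3 (F : 'I_3 -> R) : \sum_i F i = F 0 + F 1 + F 2.
Proof.
rewrite !big_ord_recl big_ord0 addr0 !addrA.
by congr (F _ + F _ + F _); exact: val_inj.
Qed.

Lemma sum_ord2 (F : 'I_2 -> R) : \sum_i F i = F 0 + F 1.
Proof.
rewrite !big_ord_recl big_ord0 addr0.
by congr (F _ + F _); exact: val_inj.
Qed.

Lemma dot4E x y :
  dot x y = x 0 0 * y 0 0 + x 0 1 * y 0 1 + x 0 2 * y 0 2 + x 0 3 * y 0 3.
Proof. exact: sum_ord4. Qed.

Lemma dot3E (x y : 'rV[R]_3) :
  dot x y = x 0 0 * y 0 0 + x 0 1 * y 0 1 + x 0 2 * y 0 2.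
Proof. exact: sum_ord3. Qed.

Lemma dot2E (x y : 'rV[R]_2) : dot x y = x 0 0 * y 0 0 + x 0 1 * y 0 1.
Proof. exact: sum_ord2. Qed.

Lemma qIE : qI = quat 0 1 0 0.
Proof. by apply: row4P; rewrite !mxE. Qed.

End quaternion_algebra.

Ltac qring := apply: row4P; rewrite ?qIE !mxE /=; ring.
Ltac qdot := rewrite ?dot4E ?dot3E ?dot2E ?qIE !mxE /=; ring.

Section quaternion_identities.
Variable R : realType.
Local Notation H := 'rV[R]_4.
Implicit Types x y z : H.
Local Notation one := (qone R).
Local Notation i := (qI R).

Lemma qmulA x y z : qmul x (qmul y z) = qmul (qmul x y) z.
Proof. qring. Qed.
Lemma qmul1 x : qmul x one = x.
Proof. qring. Qed.
Lemma mul1q x : qmul one x = x.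
Proof. qring. Qed.
Lemma qmulDl x y z : qmul (x + y) z = qmul x z + qmul y z.
Proof. qring. Qed.
Lemma qmulDr x y z : qmul x (y + z) = qmul x y + qmul x z.
Proof. qring. Qed.
Lemma qmulZl k x y : qmul (k *: x) y = k *: qmul x y.
Proof. qring. Qed.
Lemma qmulZr k x y : qmul x (k *: y) = k *: qmul x y.
Proof. qring. Qed.
Lemma qmulNl x y : qmul (- x) y = - qmul x y.
Proof. qring. Qed.
Lemma qmulNr x y : qmul x (- y) = - qmul x y.
Proof. qring. Qed.
Lemma qmul0 x : qmul x 0 = 0.
Proof. qring. Qed.
Lemma mul0q x : qmul 0 x = 0.
Proof. qring. Qed.
Lemma qconjM x y : qconj (qmul x y) = qmul (qconj y) (qconj x).
Proof. qring. Qed.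
Lemma qconjK x : qconj (qconj x) = x.
Proof. qring. Qed.
Lemma qconjN x : qconj (- x) = - qconj x.
Proof. qring. Qed.
Lemma qconjI : qconj i = - i.
Proof. qring. Qed.
Lemma qmulII : qmul i i = - one.
Proof. qring. Qed.
Lemma qmul_conjr x : qmul x (qconj x) = dot x x *: one.
Proof. rewrite dot4E; qring. Qed.
Lemma qmul_conjl x : qmul (qconj x) x = dot x x *: one.
Proof. rewrite dot4E; qring. Qed.
Lemma dot_qmul x y : dot (qmul x y) (qmul x y) = dot x x * dot y y.
Proof. qdot. Qed.
Lemma dot_qmull x y z : dot (qmul x y) (qmul x z) = dot x x * dot y z.
Proof. qdot. Qed.
Lemma dot_qconj x : dot (qconj x) (qconj x) = dot x x.
Proof. qdot. Qed.
Lemma dot_cplx (w : 'rV[R]_2) : dot (cplx w) (cplx w) = dot w w.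
Proof. qdot. Qed.
Lemma dot_im (s : 'rV[R]_3) : dot (im s) (im s) = dot s s.
Proof. qdot. Qed.
Lemma dotI : dot i i = 1.
Proof. qdot. Qed.
Lemma cplx_commI w : qmul (cplx w) i = qmul i (cplx w).
Proof. qring. Qed.
Lemma cplxvK w : cplxv (cplx w) = w :> 'rV[R]_2.
Proof. by apply: row2P; rewrite !mxE. Qed.
Lemma imvK s : imv (im s) = s :> 'rV[R]_3.
Proof. by apply: row3P; rewrite !mxE. Qed.
Lemma imv_im x : x 0 0 = 0 -> im (imv x) = x.
Proof. by move=> x0; apply: row4P; rewrite !mxE. Qed.

(** The centraliser of i is the complex line spanned by 1 and i. *)
Lemma commI_cplx x : qmul x i = qmul i x -> x = cplx (cplxv x).
Proof.
move=> E; have := congr1 (fun u : H => u 0 2) E; have := congr1 (fun u : H => u 0 3) E.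
rewrite qIE !mxE /= => E3 E2.
by apply: row4P; rewrite !mxE /=; lra.
Qed.

(** Imaginary quaternions commute only if they are parallel. *)
Lemma comm_im x s : dot s s = 1 -> x 0 0 = 0 ->
  qmul x (im s) = qmul (im s) x -> x = dot x (im s) *: im s.
Proof.
move=> s1 x0 E; have E1 := congr1 (fun u : H => u 0 1) E.
have E2 := congr1 (fun u : H => u 0 2) E; have E3 := congr1 (fun u : H => u 0 3) E.
move: E1 E2 E3; rewrite !mxE /= !x0 => E1 E2 E3.
have F1 : x 0 2 * s 0 2 = x 0 3 * s 0 1 by lra.
have F2 : x 0 3 * s 0 0 = x 0 1 * s 0 2 by lra.
have F3 : x 0 1 * s 0 1 = x 0 2 * s 0 0 by lra.
move: s1; rewrite dot3E => s1.
apply: row4P; rewrite dot4E !mxE /= ?x0; first by rewrite mulr0.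
- have := congr1 ( *%R (x 0 1)) s1; have := congr1 ( *%R (s 0 1)) F3.
  by have := congr1 ( *%R (s 0 2)) F2; lra.
- have := congr1 ( *%R (x 0 2)) s1; have := congr1 ( *%R (s 0 0)) F3.
  by have := congr1 ( *%R (s 0 2)) F1; lra.
- have := congr1 ( *%R (x 0 3)) s1; have := congr1 ( *%R (s 0 0)) F2.
  by have := congr1 ( *%R (s 0 1)) F1; lra.
Qed.

Lemma dot_ge0 n (x : 'rV[R]_n) : 0 <= dot x x.
Proof. by apply: sumr_ge0 => j _; rewrite -expr2 sqr_ge0. Qed.

Lemma dot_eq0 n (x : 'rV[R]_n) : dot x x = 0 -> x = 0.
Proof.
move=> /eqP; rewrite psumr_eq0 => [/allP H|j _]; last by rewrite -expr2 sqr_ge0.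
apply/rowP => j; rewrite mxE; have := H j; rewrite mem_index_enum => /(_ isT).
by rewrite /= -expr2 sqrf_eq0 => /eqP.
Qed.

Lemma dot_gt0 n (x : 'rV[R]_n) : x != 0 -> 0 < dot x x.
Proof.
move=> x0; rewrite lt_neqAle dot_ge0 andbT eq_sym.
by apply: contra_neq x0 => /dot_eq0.
Qed.

Lemma dotZ n k (x : 'rV[R]_n) : dot (k *: x) (k *: x) = k ^+ 2 * dot x x.
Proof. by rewrite /dot mulr_sumr; apply: eq_bigr => j _; rewrite !mxE; ring. Qed.

Section unit.
Variable a : H.
Hypothesis a1 : dot a a = 1.
Lemma qunitr : qmul a (qconj a) = one.
Proof. by rewrite qmul_conjr a1 scale1r. Qed.
Lemma qunitl : qmul (qconj a) a = one.
Proof. by rewrite qmul_conjl a1 scale1r. Qed.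
Lemma qmulKl x : qmul (qconj a) (qmul a x) = x.
Proof. by rewrite qmulA qunitl mul1q. Qed.
Lemma qmulVKl x : qmul a (qmul (qconj a) x) = x.
Proof. by rewrite qmulA qunitr mul1q. Qed.
Lemma qmulKr x : qmul (qmul x a) (qconj a) = x.
Proof. by rewrite -qmulA qunitr qmul1. Qed.
Lemma qmulVKr x : qmul (qmul x (qconj a)) a = x.
Proof. by rewrite -qmulA qunitl qmul1. Qed.
End unit.


(** For every quaternion p the element x = p - s p i satisfies x i = s x, because
   s and i have square -1. This is x for p = 1 and for p = j; it vanishes only
   at s = - i and at s = i respectively. *)
Definition frame (b : bool) (s : 'rV[R]_3) : H :=
  if b then quat (1 + s 0 0) 0 (- s 0 2) (s 0 1)
  else quat (- s 0 2) (s 0 1) (1 - s 0 0) 0.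

Lemma frameI b s : dot s s = 1 -> qmul (frame b s) i = qmul (im s) (frame b s).
Proof.
by rewrite dot3E => s1; case: b; apply: row4P; rewrite qIE !mxE /=; lra.
Qed.

Definition chartsign (b : bool) : R := if b then 1 else -1.

Lemma dot_frame b s : dot s s = 1 ->
  dot (frame b s) (frame b s) = 2 + 2 * chartsign b * s 0 0.
Proof.
move=> s1.
transitivity (2 + 2 * chartsign b * s 0 0 + (dot s s - 1)).
  by case: b; rewrite /chartsign dot4E dot3E !mxE /=; ring.
by rewrite s1 subrr addr0.
Qed.

(** The section of the Hopf fibration a |-> a i a^-1 over the chart b. *)
Definition hsec b (s : 'rV[R]_3) : H :=
  (Num.sqrt (2 + 2 * chartsign b * s 0 0))^-1 *: frame b s.

Definition hchart b : set 'rV[R]_3 := [set s | 0 < 2 + 2 * chartsign b * s 0 0].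

Lemma hsec_unit b s : dot s s = 1 -> hchart b s -> dot (hsec b s) (hsec b s) = 1.
Proof.
move=> s1 bs; rewrite /hsec dotZ dot_frame// exprVn sqr_sqrtr ?ltW//.
by rewrite mulVf// gt_eqF.
Qed.

Lemma hsecI b s : dot s s = 1 -> qmul (hsec b s) i = qmul (im s) (hsec b s).
Proof. by move=> s1; rewrite /hsec qmulZl qmulZr frameI. Qed.

Lemma hchart_cover (s : 'rV[R]_3) : exists b, hchart b s.
Proof.
have [s0|s0] := lerP 0 (s 0 0).
  by exists true; rewrite /hchart /chartsign/=; lra.
by exists false; rewrite /hchart /chartsign/=; lra.
Qed.

Lemma hopf_surj s : dot s s = 1 ->
  exists2 a : H, dot a a = 1 & qmul a i = qmul (im s) a.
Proof.
move=> s1; have [b bs] := hchart_cover s; exists (hsec b s).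
  exact: hsec_unit. 
exact: hsecI.
Qed.

Definition hopf (a : H) : 'rV[R]_3 := imv (qmul (qmul a i) (qconj a)).

Lemma im_hopf a : im (hopf a) = qmul (qmul a i) (qconj a).
Proof. by rewrite /hopf imv_im// qIE !mxE /=; ring. Qed.

Lemma dot_hopf a : dot (hopf a) (hopf a) = dot a a ^+ 2.
Proof. by rewrite -dot_im im_hopf !dot_qmul dotI dot_qconj mulr1. Qed.



End quaternion_identities.

Section smooth_quaternions.
Variable R : realType.
Local Notation H := 'rV[R]_4.
Variables (V : normedModType R) (O : set V).
Hypothesis oO : open O.

Lemma smooth_row_eq n (f : V -> 'rV[R]_n.+1) (F : 'I_n.+1 -> V -> R) :
  (forall x i, f x 0 i = F i x) -> (forall i, smooth O (F i : V -> R^o)) ->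
  smooth O f.
Proof.
move=> E h; apply: smooth_rowP => // i.
by have -> : (fun x => f x 0 i) = F i by apply/funext => x; rewrite E.
Qed.

Lemma smooth_quat (a b c d : V -> R^o) : smooth O a -> smooth O b ->
  smooth O c -> smooth O d -> smooth O (fun x => quat (a x) (b x) (c x) (d x)).
Proof.
move=> ha hb hc hd.
apply: (@smooth_row_eq _ _ (fun i x => nth 0 [:: a x; b x; c x; d x] i)).
  by move=> x i; rewrite mxE.
by apply: ord4P.
Qed.

Lemma smooth_qmul (f g : V -> H) : smooth O f -> smooth O g ->
  smooth O (fun x => qmul (f x) (g x)).
Proof.
move=> hf hg.
have cf i := smooth_coord i oO hf; have cg i := smooth_coord i oO hg.
apply: smooth_quat; (repeat apply: smooth_add => //); try apply: smooth_opp => //;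
  exact: smooth_mul.
Qed.

Lemma smooth_qconj (f : V -> H) : smooth O f -> smooth O (fun x => qconj (f x)).
Proof.
move=> hf; have cf i := smooth_coord i oO hf.
apply: (@smooth_row_eq _ _ (fun i x => if i == 0 then f x 0 i else - f x 0 i)).
  by move=> x i; rewrite mxE.
by move=> i; case: eqP => // _; exact: smooth_opp.
Qed.

Lemma smooth_im (f : V -> 'rV[R]_3) : smooth O f -> smooth O (fun x => im (f x)).
Proof.
move=> hf; apply: smooth_quat; first exact: smooth_cst.
all: exact: smooth_coord.
Qed.

Lemma smooth_imv (f : V -> H) : smooth O f -> smooth O (fun x => imv (f x)).
Proof.
move=> hf; have cf i := smooth_coord i oO hf.
apply: (@smooth_row_eq _ _ (fun i x => nth 0 [:: f x 0 1; f x 0 2; f x 0 3] i)).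
  by move=> x i; rewrite mxE.
by apply: ord3P; exact: cf.
Qed.

Lemma smooth_cplx (f : V -> 'rV[R]_2) : smooth O f -> smooth O (fun x => cplx (f x)).
Proof.
by move=> hf; apply: smooth_quat; exact: smooth_coord || exact: smooth_cst.
Qed.

Lemma smooth_cplxv (f : V -> H) : smooth O f -> smooth O (fun x => cplxv (f x)).
Proof.
move=> hf; have cf i := smooth_coord i oO hf.
apply: (@smooth_row_eq _ _ (fun i x => nth 0 [:: f x 0 0; f x 0 1] i)).
  by move=> x i; rewrite mxE.
by apply: ord2P; exact: cf.
Qed.

Lemma smooth_hsec b (f : V -> 'rV[R]_3) : (forall x, O x -> hchart b (f x)) ->
  smooth O f -> smooth O (fun x => hsec b (f x)).
Proof.
move=> Ob hf; have cf i := smooth_coord i oO hf.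
have hc := @smooth_cst R V R^o O.
have hn : smooth O (fun x => 2 + 2 * chartsign R b * f x 0 0 : R^o).
  by apply: smooth_add => //; apply: smooth_mul.
apply: smooth_scale => //.
  apply: smooth_invf => // [x /Ob bx|]; first by rewrite gt_eqF// sqrtr_gt0.
  exact: smooth_sqrtf.
case: b {hn Ob}; apply: smooth_quat => //; try exact: smooth_opp.
  exact: smooth_add.
exact: smooth_sub_fun.
Qed.

End smooth_quaternions.

Ltac smooth := repeat first [ assumption | exact: openT
  | apply: smooth_cst | apply: smooth_id
  | apply: smooth_pair | apply: smooth_qmul | apply: smooth_qconj
  | apply: smooth_imv | apply: smooth_im | apply: smooth_cplxv
  | apply: smooth_cplx | apply: smooth_scale | apply: smooth_dot
  | apply: smooth_coord | apply: smooth_fst | apply: smooth_snd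
  | apply: smooth_add | apply: smooth_opp | apply: smooth_mul ].

(** * The leaves *)

Section leaves.
Variable R : realType.
Local Notation H := 'rV[R]_4.
Local Notation index := ('rV[R]_3 * 'rV[R]_3)%type.
Local Notation S2S2 := (sphere 3 `*` sphere 3 : set index).
Local Notation i := (qI R).

(** In R^4 x S^3 the leaf with index (s1, s2) is the closure of the set of
   (a v, a b^-1) with a i a^-1 = s1 and b i b^-1 = s2; written without
   inverses these equations are linear. *)
Definition leaf (s : index) : set (H * H) :=
  [set p | [/\ qmul p.1 i = qmul (im s.1) p.1,
               qmul p.2 (im s.2) = qmul (im s.1) p.2 & dot p.2 p.2 = 1]].

Definition leaf_param (a b : H) (p : 'rV[R]_2 * 'rV[R]_2) : H * H :=
  (qmul a (cplx p.1), qmul a (qmul (cplx p.2) (qconj b))).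
Definition leaf_coord (a b : H) (p : H * H) : 'rV[R]_2 * 'rV[R]_2 :=
  (cplxv (qmul (qconj a) p.1), cplxv (qmul (qconj a) (qmul p.2 b))).

(** a i a^-1 = s: right multiplication by i becomes left multiplication by s
   in the frame a. *)
Definition framing (s : 'rV[R]_3) (a : H) := dot a a = 1 /\ qmul a i = qmul (im s) a.

Lemma framing_conj s a : framing s a -> qmul i (qconj a) = qmul (qconj a) (im s).
Proof.
move=> [a1 E].
by rewrite -[X in qmul X _](qmulKl a1 i) E qmulA qmulKr.
Qed.

Lemma framing_exists s : sphere 3 s -> exists a, framing s a.
Proof. by move=> /hopf_surj[a a1 E]; exists a. Qed.

Lemma leaf_paramK a b : dot a a = 1 -> dot b b = 1 ->
  cancel (leaf_param a b) (leaf_coord a b).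
Proof.
move=> a1 b1 [z w]; congr (_, _).
  by rewrite /= qmulKl// cplxvK.
by rewrite /= -qmulA -qmulA qmulKl// qunitl// qmul1 cplxvK.
Qed.

Lemma leaf_param_leaf s a b p : framing s.1 a -> framing s.2 b ->
  dot p.2 p.2 = 1 -> leaf s (leaf_param a b p).
Proof.
move=> fa fb p1; have [a1 Ea] := fa; have [b1 Eb] := fb; split => /=.
- by rewrite -qmulA cplx_commI qmulA Ea qmulA.
- rewrite -!qmulA -(framing_conj fb) [qmul (cplx _) _]qmulA cplx_commI.
  by rewrite !qmulA Ea.
- by rewrite !dot_qmul dot_qconj a1 b1 dot_cplx p1 !mul1r.
Qed.

(** a^-1 x and a^-1 q b commute with i, hence are complex numbers. *)
Lemma leaf_coordK s a b p : framing s.1 a -> framing s.2 b -> leaf s p ->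
  leaf_param a b (leaf_coord a b p) = p.
Proof.
move=> fa fb [/= E1 E2 _]; have [a1 Ea] := fa; have [b1 Eb] := fb.
rewrite /leaf_param /leaf_coord /= -!commI_cplx.
- rewrite qmulVKl// [qmul (qconj a) (qmul _ b)]qmulA qmulKr// qmulVKl//.
  by case: p E1 E2.
- by rewrite -!qmulA Eb [qmul p.2 _]qmulA E2 !qmulA -(framing_conj fa).
- by rewrite -qmulA E1 !qmulA -(framing_conj fa).
Qed.

Lemma dot_leaf_coord a b p : dot a a = 1 -> dot b b = 1 ->
  leaf_param a b (leaf_coord a b p) = p -> dot p.2 p.2 = 1 ->
  dot (leaf_coord a b p).2 (leaf_coord a b p).2 = 1.
Proof.
move=> a1 b1 <-; rewrite leaf_paramK//= !dot_qmul dot_qconj a1 b1 dot_cplx.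
by rewrite mul1r mulr1.
Qed.

Lemma smooth_onT (V W : normedModType R) (S : set V) (f : V -> W) :
  smooth [set: V] f -> smooth_on S f.
Proof. by move=> hf; apply: (smooth_on_smooth openT). Qed.

Lemma smooth_leaf_param a b : smooth setT (leaf_param a b).
Proof. by rewrite /leaf_param; smooth. Qed.

Lemma smooth_leaf_coord a b : smooth setT (leaf_coord a b).
Proof. by rewrite /leaf_coord; smooth. Qed.

(** In the frames a and b the linear equations of the leaf say that both
   components are complex, so it is the product of a plane and a circle. *)
Lemma leaf_diffeo s : S2S2 s -> diffeomorphic (leaf s)
  ([set: 'rV[R]_2] `*` (sphere 2 : set 'rV[R]_2)).
Proof.
move=> [s1 s2]; have [a fa] := framing_exists s1; have [b fb] := framing_exists s2.
have [[a1 _] [b1 _]] := (fa, fb).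
exists (leaf_coord a b), (leaf_param a b); split.
- exact/smooth_onT/smooth_leaf_coord.
- exact/smooth_onT/smooth_leaf_param.
- move=> p Lp; have K := leaf_coordK fa fb Lp; split=> //; split=> //.
  by apply: dot_leaf_coord => //; have [] := Lp.
- move=> p [_ p1]; split; first exact: leaf_param_leaf.
  exact: leaf_paramK.
Qed.

Lemma leaf_zero_diffeo s : S2S2 s ->
  diffeomorphic (leaf s `&` zero_section) (sphere 2 : set 'rV[R]_2).
Proof.
move=> [s1 s2]; have [a fa] := framing_exists s1; have [b fb] := framing_exists s2.
have [[a1 _] [b1 _]] := (fa, fb).
exists (fun p => (leaf_coord a b p).2), (fun w => leaf_param a b (0, w)); split.
- apply/smooth_onT; rewrite /leaf_coord; smooth.
- apply/smooth_onT; rewrite /leaf_param /=; smooth.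
- move=> p [Lp [/= p0 p1]]; have K := leaf_coordK fa fb Lp; split.
    by apply: dot_leaf_coord => //; have [] := Lp.
  rewrite -[RHS]K; congr leaf_param; congr (_, _).
  by rewrite /= p0 qmul0; apply: row2P; rewrite !mxE.
- move=> w w1; rewrite leaf_paramK//; split=> //; split.
    exact: leaf_param_leaf.
  have [_ _ ?] := @leaf_param_leaf s a b (0, w) fa fb w1.
  by split=> //=; apply: row4P; rewrite !mxE /=; ring.
Qed.

Lemma leaf_R4S3 s : leaf s `<=` R4S3.
Proof. by move=> p [_ _ p1]. Qed.

(** Conjugation by a unit quaternion as a rotation of R^3. *)
Definition rot (q : H) (s : 'rV[R]_3) : 'rV[R]_3 :=
  imv (qmul (qmul (qconj q) (im s)) q).

Lemma im_rot q s : im (rot q s) = qmul (qmul (qconj q) (im s)) q.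
Proof. by rewrite /rot imv_im// !mxE /=; ring. Qed.

Lemma dot_rot q s : dot q q = 1 -> dot (rot q s) (rot q s) = dot s s.
Proof.
by move=> q1; rewrite -dot_im im_rot !dot_qmul dot_qconj q1 dot_im mul1r mulr1.
Qed.

(** Multiplication by q^-1 solves the second equation for s2, so a point
   determines s2 from s1. *)
Lemma leaf_rot s p : leaf s p <->
  [/\ qmul p.1 i = qmul (im s.1) p.1, s.2 = rot p.2 s.1 & dot p.2 p.2 = 1].
Proof.
split=> [[E1 E2 p1]|[E1 E2 p1]]; split=> //.
  by rewrite -[LHS]imvK /rot -qmulA -E2 qmulKl.
by rewrite E2 im_rot -qmulA qmulVKl.
Qed.

(** On the zero section the first equation is void and s1 remains free. *)
Lemma leaf_zeroP s p : zero_section p -> leaf s p <-> s.2 = rot p.2 s.1.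
Proof.
move=> [/= p0 p1]; rewrite leaf_rot; split=> [[]//|E]; split=> //.
by rewrite p0 qmul0 mul0q.
Qed.

Lemma leaf_family p : zero_section p ->
  diffeomorphic [set s | S2S2 s /\ leaf s p] (sphere 3 : set 'rV[R]_3).
Proof.
move=> p0; have [_ p1] := p0.
exists fst, (fun s => (s, rot p.2 s)); split.
- by apply/smooth_onT; smooth.
- by apply/smooth_onT; rewrite /rot; smooth.
- move=> s [[s1 s2] /(leaf_zeroP s p0) E]; split=> //.
  by rewrite -E; case: s {s1 s2 E}.
- move=> s s1; split=> //; split; last exact/(leaf_zeroP _ p0).
  by split=> //; rewrite /sphere/= dot_rot.
Qed.

(** The index of the leaf through a point off the zero section: s1 = x i x^-1. *)
Definition proj (p : H * H) : index :=
  let s := (dot p.1 p.1)^-1 *: hopf p.1 in (s, rot p.2 s).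

Lemma im_scale k s : im (k *: s) = k *: im s :> H.
Proof. by apply: row4P; rewrite !mxE //= mulr0. Qed.

Lemma notin_zero (p : H * H) : R4S3 p -> ~ zero_section p -> p.1 != 0.
Proof. by move=> [_ p1]; apply: contra_notN => /eqP p0; split. Qed.

Lemma leaf_proj s p : R4S3 p -> p.1 != 0 -> leaf s p <-> s = proj p.
Proof.
move=> [_ p1] p0.
have d0 : dot p.1 p.1 != 0 by rewrite gt_eqF// dot_gt0.
rewrite leaf_rot; split=> [[E1 E2 _]|->]; last first.
  split=> //=; rewrite im_scale im_hopf qmulZl -qmulA qmul_conjl qmulZr qmul1.
  by rewrite scalerA mulVf// scale1r.
have E : s.1 = (dot p.1 p.1)^-1 *: hopf p.1.
  rewrite /hopf E1 -qmulA qmul_conjr qmulZr qmul1 -im_scale imvK scalerA.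
  by rewrite mulVf// scale1r.
by rewrite /proj -E -E2; case: s {E1 E2 E}.
Qed.

Lemma proj_S2S2 p : R4S3 p -> p.1 != 0 -> S2S2 (proj p).
Proof.
move=> [_ p1] p0; rewrite /proj /=.
have d0 : dot p.1 p.1 != 0 by rewrite gt_eqF// dot_gt0.
have E : dot ((dot p.1 p.1)^-1 *: hopf p.1) ((dot p.1 p.1)^-1 *: hopf p.1) = 1.
  by rewrite dotZ dot_hopf exprVn mulVf// expf_neq0.
by split=> //; rewrite /sphere/= dot_rot.
Qed.

Lemma leaf_cover p : R4S3 p -> exists2 s, S2S2 s & leaf s p.
Proof.
move=> Rp; have [p0|p0] := eqVneq p.1 0.
  have s1 : dot (\row_(k < 3) (k == 0)%:R : 'rV[R]_3) (\row_(k < 3) (k == 0)%:R) = 1.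
    by rewrite dot3E !mxE /=; ring.
  have [_ p1] := Rp.
  exists (\row_(k < 3) (k == 0)%:R, rot p.2 (\row_(k < 3) (k == 0)%:R)).
    by split=> //; rewrite /sphere/= dot_rot.
  by apply/(leaf_zeroP _ (conj p0 p1)).
by exists (proj p); [exact: proj_S2S2|exact/leaf_proj].
Qed.

Lemma leaf_disjoint s s' p : leaf s p -> leaf s' p -> ~ zero_section p -> s = s'.
Proof.
move=> Lp Lp' p0; have Rp := leaf_R4S3 Lp; have n0 := notin_zero Rp p0.
by move/(leaf_proj _ Rp n0): Lp => ->; move/(leaf_proj _ Rp n0): Lp' => ->.
Qed.

Lemma leaf_nonzero s : S2S2 s -> exists2 p, leaf s p & p.1 != 0.
Proof.
move=> [s1 s2]; have [a fa] := framing_exists s1; have [b fb] := framing_exists s2.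
pose e : 'rV[R]_2 := \row_k (k == 0)%:R.
have e1 : dot e e = 1 by rewrite dot2E !mxE /=; ring.
exists (leaf_param a b (e, e)); first exact: leaf_param_leaf.
apply/eqP => E0; have := congr1 (fun x => dot x x) E0.
have [a1 _] := fa.
rewrite /= dot_qmul a1 dot_cplx e1 dot4E !mxE mulr1 !mulr0 !addr0.
by move/eqP; rewrite oner_eq0.
Qed.

Lemma leaf_inj s s' : S2S2 s -> S2S2 s' -> leaf s = leaf s' -> s = s'.
Proof.
move=> hs hs' E; have [p Lp p0] := leaf_nonzero hs.
apply: (@leaf_disjoint _ _ p) => //; first by rewrite -E.
by case=> /eqP; rewrite (negPf p0).
Qed.

(** Leaves which meet would be the same fibre, but the leaves with indices
   (e0, e0) and (e1, e1) both contain the point (0, 1). *)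
Lemma leaf_no_fibration : ~ exists (X : Type) (pr : H * H -> X),
  forall s, S2S2 s -> exists x, leaf s = R4S3 `&` [set p | pr p = x].
Proof.
move=> [X [pr F]].
pose e (k : 'I_3) : 'rV[R]_3 := \row_j (j == k)%:R.
have e1 k : dot (e k) (e k) = 1.
  by move: k; apply: ord3P; rewrite dot3E !mxE /=; ring.
pose p : H * H := (0, qone R).
have p1 : dot p.2 p.2 = 1 by rewrite dot4E !mxE /=; ring.
have L k : leaf (e k, e k) p.
  by split=> //=; rewrite ?qmul0 ?mul0q// mul1q qmul1.
have [x0 E0] := F (e 0, e 0) (conj (e1 0) (e1 0)).
have [x1 E1] := F (e 1, e 1) (conj (e1 1) (e1 1)).
have := L 0; rewrite E0 => -[_ /= X0]; have := L 1; rewrite E1 => -[_ /= X1].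
have : leaf (e 0, e 0) = leaf (e 1, e 1) by rewrite E0 E1 -X0 -X1.
move=> /leaf_inj -/(_ (conj (e1 0) (e1 0)) (conj (e1 1) (e1 1)))[].
move=> /rowP/(_ 0); rewrite !mxE /= => /eqP; by rewrite oner_eq0.
Qed.

End leaves.

(** * The fibration off the zero section *)

Section fibration.
Variable R : realType.
Local Notation H := 'rV[R]_4.
Local Notation index := ('rV[R]_3 * 'rV[R]_3)%type.
Local Notation fibre := (R^o * ('rV[R]_2 * 'rV[R]_2))%type.
Local Notation S2S2 := (sphere 3 `*` sphere 3 : set index).

Definition off_zero : set (H * H) := [set p | 0 < dot p.1 p.1].

Lemma off_zeroP p : (@R4S3 R `\` zero_section) p <-> R4S3 p /\ p.1 != 0.
Proof.
split=> [[Rp p0]|[Rp p0]]; split=> //; first exact: notin_zero.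
by case=> /eqP; rewrite (negPf p0).
Qed.

Lemma open_pos (V : normedModType R) (f : V -> R^o) : smooth setT f ->
  open [set x | 0 < f x].
Proof. by move=> hf; have := smooth_open_gt openT hf; rewrite setTI. Qed.

Lemma open_off_zero : open off_zero.
Proof. by apply: open_pos; smooth. Qed.

Lemma smooth_proj : smooth off_zero (@proj R).
Proof.
have oO := open_off_zero.
have hs : smooth off_zero (fun p => (dot p.1 p.1)^-1 *: hopf p.1).
  apply: smooth_scale => //; last by rewrite /hopf; smooth.
  by apply: smooth_invf => // [p|]; [rewrite /off_zero/= lt0r => /andP[]|smooth].
by rewrite /proj /rot; smooth.
Qed.

Lemma leaf_minus_zero (s : index) : leaf s `\` zero_section =
  (R4S3 `\` zero_section) `&` [set p | proj p = s].
Proof.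
apply/seteqP; split=> p.
  move=> [Lp Zp]; have Rp := leaf_R4S3 Lp; split=> //=.
  by apply/esym/leaf_proj => //; exact: notin_zero.
move=> [/off_zeroP[Rp p0] /= E]; split; first exact/leaf_proj.
by case=> /eqP; rewrite (negPf p0).
Qed.

Variables b c : bool.

Definition chart2 : set index := [set s | hchart b s.1 /\ hchart c s.2].

(** With sections of the Hopf fibration over two charts as frames, all fibres
   are identified with the half-line times the torus. *)
Definition triv (y : index * fibre) : H * H :=
  leaf_param (hsec b y.1.1) (hsec c y.1.2) (y.2.1 *: y.2.2.1, y.2.2.2).
Definition untriv (p : H * H) : index * fibre :=
  let s := proj p in
  let w := leaf_coord (hsec b s.1) (hsec c s.2) p in
  (s, (Num.sqrt (dot p.1 p.1), ((Num.sqrt (dot p.1 p.1))^-1 *: w.1, w.2))).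

Lemma open_chart2 : open chart2.
Proof.
by apply: openI; apply: open_pos; smooth.
Qed.

Lemma framing_hsec (s : 'rV[R]_3) d : sphere 3 s -> hchart d s ->
  framing s (hsec d s).
Proof. by move=> s1 ds; split; [exact: hsec_unit|exact: hsecI]. Qed.

Lemma dot_leaf_coord1 (a a' : H) p : dot a a = 1 ->
  leaf_param a a' (leaf_coord a a' p) = p ->
  dot (leaf_coord a a' p).1 (leaf_coord a a' p).1 = dot p.1 p.1.
Proof. by move=> a1 E; rewrite -[in RHS]E /= dot_qmul a1 mul1r dot_cplx. Qed.

Lemma smooth_triv : smooth [set y | chart2 y.1] triv.
Proof.
have oO : open [set y : index * fibre | chart2 y.1].
  apply: (@open_comp _ _ fst); last exact: open_chart2.
  by move=> y _; exact: cvg_fst.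
have h1 : smooth [set y : index * fibre | chart2 y.1] (fun y => hsec b y.1.1).
  by apply: smooth_hsec => [//|y []//|]; smooth.
have h2 : smooth [set y : index * fibre | chart2 y.1] (fun y => hsec c y.1.2).
  by apply: smooth_hsec => [//|y []//|]; smooth.
by rewrite /triv /leaf_param /=; smooth.
Qed.

Lemma open_proj_chart2 : open (off_zero `&` [set p | chart2 (proj p)]).
Proof.
rewrite openE => p [p0 cp]; apply: filterI.
  by apply: open_nbhs_nbhs; split => //; exact: open_off_zero.
have cp' := smooth_continuous smooth_proj p0.
have : nbhs (proj p) chart2.
  by apply: open_nbhs_nbhs; split => //; exact: open_chart2.
exact: cp'.
Qed.

Lemma smooth_untriv : smooth (off_zero `&` [set p | chart2 (proj p)]) untriv.
Proof.
have oO := open_proj_chart2; set O := (X in smooth X) in oO *.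
have hp : smooth O (@proj R) by apply: smooth_subset smooth_proj => p [].
have h1 : smooth O (fun p => hsec b (proj p).1).
  by apply: smooth_hsec => [//|p [_ []]//|]; exact: smooth_fst.
have h2 : smooth O (fun p => hsec c (proj p).2).
  by apply: smooth_hsec => [//|p [_ []]//|]; exact: smooth_snd.
have h3 : smooth O (fun p => Num.sqrt (dot p.1 p.1) : R^o).
  by apply: smooth_sqrtf => // [p []//|]; smooth.
have h4 : smooth O (fun p => (Num.sqrt (dot p.1 p.1))^-1 : R^o).
  by apply: smooth_invf => // p [p0 _]; rewrite gt_eqF// sqrtr_gt0.
by rewrite /untriv /leaf_coord /=; smooth.
Qed.

Lemma triv_proj y : (S2S2 `&` chart2) y.1 -> (halfline `*` torus) y.2 ->
  [/\ R4S3 (triv y), (triv y).1 != 0, dot (triv y).1 (triv y).1 = y.2.1 ^+ 2 &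
      proj (triv y) = y.1].
Proof.
move: y => [[s1 s2] [r [z w]]] [[/= s11 s21] [/= c1 c2]] [/= r0 [z1 w1]].
have f1 := framing_hsec s11 c1; have f2 := framing_hsec s21 c2.
have L := @leaf_param_leaf _ (s1, s2) _ _ (r *: z, w) f1 f2 w1.
have Rp := leaf_R4S3 L.
have D : dot (triv (s1, s2, (r, (z, w)))).1 (triv (s1, s2, (r, (z, w)))).1 = r ^+ 2.
  by have [a1 _] := f1; rewrite /triv /= dot_qmul a1 mul1r dot_cplx dotZ z1 mulr1.
have n0 : (triv (s1, s2, (r, (z, w)))).1 != 0.
  apply/eqP => E; move: D; rewrite E dot4E !mxE !mulr0 !addr0 => /esym/eqP.
  by rewrite sqrf_eq0 gt_eqF.
by split=> //; apply/esym/(leaf_proj _ Rp n0).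
Qed.

Lemma triv_diffeo : diffeo ((S2S2 `&` chart2) `*` (halfline `*` torus))
  ((R4S3 `\` zero_section) `&` (@proj R) @^-1` chart2) triv untriv.
Proof.
split.
- apply: smooth_on_smooth smooth_triv; last by move=> y [[_]].
  apply: (@open_comp _ _ fst); last exact: open_chart2.
  by move=> y _; exact: cvg_fst.
- apply: smooth_on_smooth smooth_untriv; first exact: open_proj_chart2.
  by move=> p [/off_zeroP[Rp p0] cp]; split=> //; exact: dot_gt0.
- move=> y [y1 y2]; have [Rp p0 D E] := triv_proj y1 y2; split.
    by split; [exact/off_zeroP|rewrite /= E; have [] := y1].
  rewrite /untriv E D /triv; cbv zeta; move: y1 y2 {Rp p0 D E}.
  case: y => [[s1 s2] [r [z w]]] [[s11 s21] [c1 c2]] [r0 [z1 w1]].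
  have [a1 _] : framing s1 (hsec b s1) by exact: framing_hsec.
  have [b1 _] : framing s2 (hsec c s2) by exact: framing_hsec.
  have K := leaf_paramK a1 b1 (r *: z, w).
  rewrite -[leaf_coord _ _ _]/(leaf_coord (hsec b s1) (hsec c s2)
    (leaf_param (hsec b s1) (hsec c s2) (r *: z, w))) K /= sqrtr_sqr gtr0_norm// scalerA mulVf ?scale1r//.
  by rewrite gt_eqF.
- move=> p [/off_zeroP[Rp p0] cp]; have [c1 c2] := cp.
  have [s1 s2] := proj_S2S2 Rp p0.
  have f1 := framing_hsec s1 c1; have f2 := framing_hsec s2 c2.
  have L : leaf (proj p) p by exact/leaf_proj.
  have K := leaf_coordK f1 f2 L; have [[a1 _] [b1 _]] := (f1, f2).
  have d0 := dot_gt0 p0; have q0 : Num.sqrt (dot p.1 p.1) != 0.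
    by rewrite gt_eqF// sqrtr_gt0.
  split; last first.
    rewrite /triv /= scalerA mulfV// scale1r -[RHS]K.
    by congr leaf_param; case: leaf_coord.
  split; first by split.
  split; first by rewrite /halfline/= sqrtr_gt0.
  split; rewrite /sphere /=.
    rewrite dotZ (dot_leaf_coord1 a1 K) exprVn sqr_sqrtr ?dot_ge0// mulVf//.
    by rewrite gt_eqF.
  by apply: dot_leaf_coord => //; have [] := L.
Qed.

End fibration.

Lemma proj_fibre_bundle (R : realType) :
  fibre_bundle (R4S3 `\` zero_section) (sphere 3 `*` sphere 3)
    (halfline `*` torus) (@proj R).
Proof.
split.
- apply: smooth_on_smooth (@smooth_proj R); first exact: open_off_zero.
  by move=> p /off_zeroP[_ p0]; exact: dot_gt0.
- by move=> p /off_zeroP[Rp p0]; exact: proj_S2S2.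
- move=> s hs; have [b cb] := hchart_cover s.1; have [c cc] := hchart_cover s.2.
  exists (chart2 b c); split=> //; first exact: open_chart2.
  exists (triv b c), (untriv b c); split; first exact: triv_diffeo.
  by move=> y [y1 y2]; have [] := triv_proj y1 y2.
Qed.

(** * The distribution and the tangent spaces of the leaves *)

Section quaternion_derivatives.
Variable R : realType.
Local Notation H := 'rV[R]_4.
Implicit Types V W : normedModType R.

Lemma is_derive_quat V (f1 f2 f3 f4 : V -> R^o) x v d1 d2 d3 d4 :
  is_derive x v f1 d1 -> is_derive x v f2 d2 -> is_derive x v f3 d3 ->
  is_derive x v f4 d4 ->
  is_derive x v (fun y => quat (f1 y) (f2 y) (f3 y) (f4 y)) (quat d1 d2 d3 d4).
Proof.
move=> h1 h2 h3 h4; apply: is_derive_row => j.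
have -> : (fun y => quat (f1 y) (f2 y) (f3 y) (f4 y) 0 j) =
   (fun y => nth 0 [:: f1 y; f2 y; f3 y; f4 y] j).
  by apply/funext => y; rewrite mxE.
by rewrite mxE; move: j; apply: ord4P.
Qed.

Lemma is_derive_qmul V (f g : V -> H) x v df dg :
  is_derive x v f df -> is_derive x v g dg ->
  is_derive x v (fun y => qmul (f y) (g y)) (qmul df (g x) + qmul (f x) dg).
Proof.
move=> hf hg; have cf j := is_derive_coord j hf; have cg j := is_derive_coord j hg.
apply: is_derive_eq.
  apply: is_derive_quat; (repeat apply: is_derive_add); try apply: is_derive_oppf;
    by apply: is_derive_mul; (exact: cf) || (exact: cg).
by apply: row4P; rewrite !mxE /= /GRing.scale /=; ring.
Qed.

Lemma is_derive_qconj V (f : V -> H) x v df :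
  is_derive x v f df -> is_derive x v (fun y => qconj (f y)) (qconj df).
Proof.
move=> hf; apply: is_derive_row => j.
have -> : (fun y => qconj (f y) 0 j) =
  (fun y => if j == 0 then f y 0 j else - f y 0 j).
  by apply/funext => y; rewrite mxE.
rewrite mxE; have := is_derive_coord j hf.
by case: eqP => // _; exact: is_derive_oppf.
Qed.

Lemma is_derive_comp1 V (h : R^o -> R^o) (f : V -> R^o) x v (dh : R) :
  is_derive (f x) 1 h dh -> differentiable f x ->
  is_derive x v (fun y => h (f y) : R^o) (dh * 'D_v f x).
Proof.
move=> [/derivable1_diffP Dh <-] Df.
have D : differentiable (h \o f) x by exact: differentiable_comp.
split; first exact: diff_derivable.
rewrite deriveE// diff_comp//= !deriveE//.
rewrite mulrC -[_ * _]/('d f x v *: ('d h (f x) (1 : R^o) : R^o)).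
by rewrite -linearZ_LR /GRing.scale/= mulr1.
Qed.

Lemma is_derive_cstf V W (w : W) x v : is_derive x v (fun _ : V => w) 0.
Proof. exact: is_derive_cst. Qed.

Lemma is_derive_idf V x v : is_derive x v (fun y : V => y) v.
Proof. exact: is_derive_id. Qed.

Lemma is_derive_lin1 (k : R) x v : is_derive x v (fun t : R^o => k * t : R^o) (k * v).
Proof.
have := is_derive_mul (is_derive_cstf (k : R^o) x v) (is_derive_idf x v).
by rewrite mul0r add0r.
Qed.

(** A great circle, if x and y are orthonormal. *)
Definition circle n (k : R) (x y : 'rV[R]_n) (t : R^o) : 'rV[R]_n :=
  cos (k * t) *: x + sin (k * t) *: y.

Lemma circle0 n k (x y : 'rV[R]_n) : circle k x y 0 = x.
Proof. by rewrite /circle mulr0 cos0 sin0 scale1r scale0r addr0. Qed.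

Lemma is_derive_circle n (k : R) (x y : 'rV[R]_n) :
  is_derive (0 : R^o) 1 (circle k x y) (k *: y).
Proof.
have D : differentiable (fun t : R^o => k * t : R^o) 0.
  by apply/derivable1_diffP; have [] := is_derive_lin1 k 0 1.
have E : 'D_1 (fun t : R^o => k * t : R^o) 0 = k.
  by have [_ ->] := is_derive_lin1 k 0 1; rewrite mulr1.
have dc := is_derive_comp1 (1 : R^o) (is_derive_cos (k * 0)) D.
have ds := is_derive_comp1 (1 : R^o) (is_derive_sin (k * 0)) D.
have := is_derive_add (is_derive_scale dc (is_derive_cstf x _ _))
  (is_derive_scale ds (is_derive_cstf y _ _)).
by rewrite E mulr0 sin0 cos0 !scaler0 !addr0 oppr0 mul0r scale0r add0r mul1r.
Qed.

Lemma dot_comb n (c s : R) (x y : 'rV[R]_n) : dot x x = 1 -> dot y y = 1 ->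
  dot x y = 0 -> dot (c *: x + s *: y) (c *: x + s *: y) = c ^+ 2 + s ^+ 2.
Proof.
move=> x1 y1 xy.
transitivity (c ^+ 2 * dot x x + s ^+ 2 * dot y y + 2 * c * s * dot x y).
  by rewrite /dot !mulr_sumr -!big_split/=; apply: eq_bigr => j _; rewrite !mxE; ring.
by rewrite x1 y1 xy mulr0 addr0 !mulr1.
Qed.

Lemma dot_circle n k (x y : 'rV[R]_n) t : dot x x = 1 -> dot y y = 1 ->
  dot x y = 0 -> dot (circle k x y t) (circle k x y t) = 1.
Proof. by move=> *; rewrite dot_comb// cos2Dsin2. Qed.

Lemma dot_xI (x : H) : dot x (qmul x (qI R)) = 0.
Proof. by rewrite dot4E qIE !mxE /=; ring. Qed.

Lemma dot_imx (s : 'rV[R]_3) (x : H) : dot x (qmul (im s) x) = 0.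
Proof. by rewrite dot4E !mxE /=; ring. Qed.

Lemma dotC n (x y : 'rV[R]_n) : dot x y = dot y x.
Proof. by apply: eq_bigr => j _; rewrite mulrC. Qed.

End quaternion_derivatives.

Section leaf_tangent.
Variable R : realType.
Local Notation H := 'rV[R]_4.
Local Notation index := ('rV[R]_3 * 'rV[R]_3)%type.
Local Notation i := (qI R).

(** The equations of the leaf are linear except |q| = 1. A velocity of the
   second component q thus satisfies the linear equation of q and is orthogonal
   to q; its product with q^-1 is then imaginary and commutes with s1, hence is a
   multiple of s1. Conversely lines and great circles stay in the leaf. *)
Lemma leaf_tangent (s : index) (p : H * H) : dot s.1 s.1 = 1 -> leaf s p ->
  tangent_space (leaf s) p =
  [set u | qmul u.1 i = qmul (im s.1) u.1 /\
           exists k, u.2 = k *: qmul (im s.1) p.2].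
Proof.
move=> s1 [/= E1 E2 p1]; apply/seteqP; split=> u.
  move=> [c [c0 dc cL] cu].
  have D : is_derive (0 : R^o) 1 c u by split.
  have Dx := is_derive_fst D; have Dq := is_derive_snd D.
  have Dk w : is_derive (0 : R^o) 1 (fun=> w : H) 0 by exact: is_derive_cstf.
  have F1 : qmul u.1 i = qmul (im s.1) u.1.
    have A := is_derive_qmul Dx (Dk i); have B := is_derive_qmul (Dk (im s.1)) Dx.
    rewrite qmul0 addr0 in A; rewrite mul0q add0r in B.
    apply: (is_derive_uniq A); apply: near_eq_is_derive B.
    by apply: filterS cL => t [].
  have F2 : qmul u.2 (im s.2) = qmul (im s.1) u.2.
    have A := is_derive_qmul Dq (Dk (im s.2)); have B := is_derive_qmul (Dk (im s.1)) Dq.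
    rewrite qmul0 addr0 in A; rewrite mul0q add0r in B.
    apply: (is_derive_uniq A); apply: near_eq_is_derive B.
    by apply: filterS cL => t [].
  have F3 : dot u.2 p.2 = 0.
    have A := is_derive_dot Dq Dq; rewrite c0 in A.
    have : dot u.2 p.2 + dot p.2 u.2 = 0.
      apply: (is_derive_uniq A); apply: near_eq_is_derive (is_derive_cstf (1 : R^o) _ _).
      by apply: filterS cL => t [].
    rewrite [dot p.2 _]dotC; lra.
  split=> //; pose m := qmul u.2 (qconj p.2).
  have m0 : m 0 0 = 0 by rewrite -F3 dot4E !mxE /=; ring.
  have E2' : qmul (qconj p.2) (im s.1) = qmul (im s.2) (qconj p.2).
    by rewrite -[RHS](qmulKl p1) [qmul p.2 _]qmulA E2 qmulKr.
  have mc : qmul m (im s.1) = qmul (im s.1) m.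
    by rewrite /m -qmulA E2' !qmulA F2.
  exists (dot m (im s.1)).
  by rewrite -qmulZl -(comm_im s1 m0 mc) /m qmulVKr.
move=> [F1 [k F2]].
pose c (t : R^o) : H * H := (p.1 + t *: u.1, circle k p.2 (qmul (im s.1) p.2) t).
have D : is_derive (0 : R^o) 1 c u.
  have -> : u = (u.1, u.2) by case: u {F1 F2 c}.
  apply: is_derive_pair; last by rewrite F2; exact: is_derive_circle.
  have := is_derive_add (is_derive_cstf p.1 (0 : R^o) 1)
    (is_derive_scale (is_derive_idf (0 : R^o) 1) (is_derive_cstf u.1 _ _)).
  by rewrite add0r scaler0 addr0 scale1r.
have [Dc Du] := D; exists c => //; split=> //.
  by rewrite /c circle0 scale0r addr0; case: p {c D Dc Du E1 E2 p1 F2}.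
near=> t; split=> /=.
- by rewrite qmulDl qmulDr qmulZl qmulZr E1 F1.
- by rewrite /circle qmulDl qmulDr !qmulZl !qmulZr -[qmul (qmul _ _) (im _)]qmulA E2.
- by rewrite dot_circle// ?dot_imx// dot_qmul dot_im s1 p1 mulr1.
Unshelve. all: by end_near. Qed.

(** The plane x i = s x is a complex line with basis a. *)
Lemma framing_cplx (s : 'rV[R]_3) (a x : H) : framing s a ->
  qmul x i = qmul (im s) x -> exists z, x = qmul a (cplx z).
Proof.
move=> fa E; have [a1 _] := fa; exists (cplxv (qmul (qconj a) x)).
rewrite -commI_cplx ?qmulVKl//.
by rewrite -qmulA E !qmulA (framing_conj fa).
Qed.

Lemma qmul_cplx (a : H) z : qmul a (cplx z) = z 0 0 *: a + z 0 1 *: qmul a i.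
Proof.
have -> : cplx z = z 0 0 *: qone R + z 0 1 *: i.
  by apply: row4P; rewrite qIE !mxE /=; ring.
by rewrite qmulDr !qmulZr qmul1.
Qed.

End leaf_tangent.

Lemma pairP (A B : Type) (x y : A * B) : x.1 = y.1 -> x.2 = y.2 -> x = y.
Proof. by case: x y => [? ?] [? ?] /= -> ->. Qed.

Lemma dotZl (R : realType) n k (x y : 'rV[R]_n) : dot (k *: x) y = k * dot x y.
Proof. by rewrite /dot mulr_sumr; apply: eq_bigr => j _; rewrite !mxE mulrA. Qed.

Lemma dotZr (R : realType) n k (x y : 'rV[R]_n) : dot x (k *: y) = k * dot x y.
Proof. by rewrite dotC dotZl dotC. Qed.

Section distribution.
Variable R : realType.
Local Notation H := 'rV[R]_4.
Local Notation amb := (R^o * (H * H))%type.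
Local Notation i := (qI R).
Variable G : geometry R.

Lemma cylP (y : amb) : cyl G y ->
  [/\ rmin G < y.1, dot y.2.1 y.2.1 = 1 & dot y.2.2 y.2.2 = 1].
Proof. by move=> [? []]. Qed.

(** The span of T_1^+ and T_1^- is that of (a i, 0) and (0, b i). *)
Lemma distrP (y u : amb) : distr y u <-> exists l m,
  u.2.1 = l *: qmul y.2.1 i /\ u.2.2 = m *: qmul y.2.2 i.
Proof.
split=> [[k ->]|[l [m [E1 E2]]]].
  exists (k 0 + k 1), (k 0 - k 1); split; rewrite /= scaler0 addr0.
    by rewrite scalerDl.
  by rewrite scalerN scalerBl.
exists (fun j => nth 0 [:: (l + m) / 2; (l - m) / 2; u.1] j) => /=.
apply: pairP => /=; first by rewrite /GRing.scale/= !mulr0 mulr1 !add0r.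
apply: pairP => /=; rewrite ?E1 ?E2.
  by rewrite scaler0 addr0 -scalerDl; congr (_ *: _); field.
by rewrite scaler0 addr0 scalerN -scalerBl; congr (_ *: _); field.
Qed.

(** For small t the curve (r + k t, (a exp(i l t), b exp(i m t))) stays in the
   cylinder. *)
Lemma distr_curve (y u : amb) : cyl G y -> distr y u ->
  exists c : R^o -> amb, [/\ c 0 = y, is_derive (0 : R^o) 1 c u &
    \forall t \near (0 : R^o), cyl G (c t)].
Proof.
move=> cy /distrP[l [m [E1 E2]]]; have [r0 a1 b1] := cylP cy.
exists (fun t : R^o => (y.1 + t * u.1, (circle l y.2.1 (qmul y.2.1 i) t,
   circle m y.2.2 (qmul y.2.2 i) t))); split.
- by rewrite !circle0 mul0r addr0; case: y {cy E1 E2 r0 a1 b1} => ? [].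
- case: u E1 E2 => u0 [u1 u2] /= -> ->.
  apply: is_derive_pair; last by apply: is_derive_pair; exact: is_derive_circle.
  have := is_derive_add (is_derive_cstf (y.1 : R^o) (0 : R^o) 1)
    (is_derive_mul (is_derive_idf (0 : R^o) 1) (is_derive_cstf (u0 : R^o) _ _)).
  by rewrite mulr0 addr0 add0r mul1r.
have sm : smooth [set: R^o] (fun t : R^o => y.1 + t * u.1 : R^o) by smooth.
have cont := smooth_continuous (x := 0) sm Logic.I.
have N : nbhs (y.1 + 0 * u.1 : R^o) [set z | rmin G < z].
  apply: open_nbhs_nbhs; split; first exact: open_gt.
  by rewrite /= mul0r addr0.
have := cont _ N; rewrite /nbhs /=; apply: (@filterS _ (nbhs (0 : R^o))) => t rt.
split=> //=; split; apply: dot_circle => //; rewrite ?dot_xI// dot_qmul dotI mulr1 //.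
Qed.

Lemma distr_tangent (y u : amb) : cyl G y -> distr y u ->
  tangent_space (cyl G) y u.
Proof.
by move=> cy Du; have [c [c0 [dc Dc] cc]] := distr_curve cy Du; exists c.
Qed.

Lemma distr_Tplus (y : amb) : distr y (Tplus 0 y).
Proof. by apply/distrP; exists 1, 1; rewrite !scale1r. Qed.
Lemma distr_Tminus (y : amb) : distr y (Tminus 0 y).
Proof. by apply/distrP; exists 1, (-1); rewrite scale1r scaleN1r. Qed.
Lemma distr_partial_r (y : amb) : distr y (partial_r y).
Proof. by apply/distrP; exists 0, 0; rewrite !scale0r. Qed.

Lemma is_derive_Tplus j (y v : amb) : is_derive y v (@Tplus R j) (Tplus j v).
Proof.
have I := is_derive_idf y v.
have k := is_derive_cstf (su2T R j) y v.
have h1 := is_derive_qmul (is_derive_fst (is_derive_snd I)) k.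
have h2 := is_derive_qmul (is_derive_snd (is_derive_snd I)) k.
rewrite qmul0 addr0 in h1; rewrite qmul0 addr0 in h2.
exact: (is_derive_pair (is_derive_cstf (0 : R^o) y v) (is_derive_pair h1 h2)).
Qed.

Lemma is_derive_Tminus j (y v : amb) : is_derive y v (@Tminus R j) (Tminus j v).
Proof.
have I := is_derive_idf y v.
have k := is_derive_cstf (su2T R j) y v.
have h1 := is_derive_qmul (is_derive_fst (is_derive_snd I)) k.
have h2 := is_derive_oppf (is_derive_qmul (is_derive_snd (is_derive_snd I)) k).
rewrite qmul0 addr0 in h1; rewrite qmul0 addr0 in h2.
exact: (is_derive_pair (is_derive_cstf (0 : R^o) y v) (is_derive_pair h1 h2)).
Qed.

Lemma brackets (y : amb) :
  [/\ lie_bracket (@Tplus R 0) (@Tminus R 0) y = 0,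
      lie_bracket (@Tplus R 0) (@partial_r R) y = 0 &
      lie_bracket (@Tminus R 0) (@partial_r R) y = 0].
Proof.
have Dr v : 'D_v (@partial_r R) y = 0.
  by have [_ ->] := is_derive_cstf ((1, (0, 0)) : amb) y v.
rewrite /lie_bracket; split.
- have [_ ->] := is_derive_Tminus 0 y (Tplus 0 y).
  have [_ ->] := is_derive_Tplus 0 y (Tminus 0 y).
  by rewrite /Tplus /Tminus /= qmulNl subrr.
- have [_ ->] := is_derive_Tplus 0 y (partial_r y).
  by rewrite Dr /Tplus /= !mul0q subrr.
- have [_ ->] := is_derive_Tminus 0 y (partial_r y).
  by rewrite Dr /Tminus /= !mul0q oppr0 subrr.
Qed.

(** Along a curve in the cylinder a section of the distribution stays a
   multiple of the left-invariant frame; differentiating this multiple leaves,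
   up to the frame itself, only a term symmetric in the two fields. *)
Lemma derive_distr (O : set amb) (Y : amb -> amb) (p u : amb) :
  cyl G `<=` O -> smooth O Y -> (forall z, cyl G z -> distr z (Y z)) ->
  cyl G p -> distr p u ->
  exists2 k : R * R,
    ('D_u Y p).2.1 = k.1 *: qmul p.2.1 i - (dot (Y p).2.1 u.2.1) *: p.2.1 &
    ('D_u Y p).2.2 = k.2 *: qmul p.2.2 i - (dot (Y p).2.2 u.2.2) *: p.2.2.
Proof.
move=> cO sY DY cp Du; have [c [c0 Dc cc]] := distr_curve cp Du.
have dY : differentiable Y (c 0).
  by rewrite c0; apply: smooth_differentiable sY _; exact: cO.
have DYc := is_derive_curve dY Dc; rewrite c0 in DYc.
have [_ p1 p2] := cylP cp.
have aux (pr : amb -> H) : (forall x v (F : R^o -> amb) dF, is_derive x v F dF ->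
     is_derive x v (fun t => pr (F t)) (pr dF)) ->
   (forall z, cyl G z -> dot (pr z) (pr z) = 1) ->
   (forall z v, cyl G z -> distr z v -> exists l, pr v = l *: qmul (pr z) i) ->
   exists k, pr ('D_u Y p) = k *: qmul (pr p) i - dot (pr (Y p)) (pr u) *: pr p.
  move=> prD pr1 prl; have A := prD _ _ _ _ DYc; have B := prD _ _ _ _ Dc.
  have Bi := is_derive_qmul B (is_derive_cstf i (0 : R^o) 1).
  rewrite qmul0 addr0 in Bi.
  have C := is_derive_scale (is_derive_dot A Bi) Bi.
  rewrite /= c0 in C; eexists; rewrite -[RHS]addrC.
  have E z v : cyl G z -> distr z v ->
      pr v = dot (pr v) (qmul (pr z) i) *: qmul (pr z) i.
    move=> cz dv; have [l E] := prl _ _ cz dv.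
    by rewrite E dotZl dot_qmul dotI pr1// !mulr1.
  have N : \forall t \near (0 : R^o), dot (pr (Y (c t))) (qmul (pr (c t)) i) *:
      qmul (pr (c t)) i = pr (Y (c t)).
    by apply: filterS cc => t ct; rewrite -E//; exact: DY.
  have F := is_derive_uniq A (near_eq_is_derive N C).
  rewrite F addrC; congr (_ + _).
  have [l El] := prl _ _ cp Du; have [m Em] := prl _ _ cp (DY _ cp).
  rewrite El Em !qmulZl -qmulA qmulII qmulNr qmul1 !scalerN scalerA.
  congr (- (_ *: _)).
  have q1 : dot (qmul (pr p) i) (qmul (pr p) i) = 1.
    by rewrite dot_qmul dotI pr1// mulr1.
  by rewrite !dotZl dotZr q1 !mulr1.
have [k1 E1] := aux (fun z => z.2.1)
  (fun x v F dF D => is_derive_fst (is_derive_snd D))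
  (fun z cz => let: And3 _ h _ := cylP cz in h)
  (fun z v _ dv => let: ex_intro l (ex_intro m (conj h _)) := (distrP z v).1 dv in
     ex_intro _ l h).
have [k2 E2] := aux (fun z => z.2.2)
  (fun x v F dF D => is_derive_snd (is_derive_snd D))
  (fun z cz => let: And3 _ _ h := cylP cz in h)
  (fun z v _ dv => let: ex_intro l (ex_intro m (conj _ h)) := (distrP z v).1 dv in
     ex_intro _ m h).
by exists (k1, k2).
Qed.

Lemma distr_involutive : involutive_distribution (cyl G) (@distr R).
Proof.
move=> O X Y oO cO sX sY D p cp; have [DX DY] := D p cp.
have [k E1 E2] := derive_distr cO sY (fun z cz => (D z cz).2) cp DX.
have [l F1 F2] := derive_distr cO sX (fun z cz => (D z cz).1) cp DY.
apply/distrP; exists (k.1 - l.1), (k.2 - l.2); rewrite /lie_bracket /=.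
split.
  by rewrite [X in X - _]E1 [X in _ - X]F1 dotC scalerBl opprB addrA addrNK.
by rewrite [X in X - _]E2 [X in _ - X]F2 dotC scalerBl opprB addrA addrNK.
Qed.

(** * The identification with the complement of the zero section *)

Lemma smooth_toR4S3 : smooth [set y : amb | rmin G < y.1] (toR4S3 G).
Proof.
have oO : open [set y : amb | rmin G < y.1].
  apply: (@open_comp _ _ fst [set r | rmin G < r]); last exact: open_gt.
  by move=> y _; exact: cvg_fst.
have h : smooth [set y : amb | rmin G < y.1]
    (fun y => Num.sqrt (y.1 - rmin G) : R^o).
  apply: smooth_sqrtf => // [y|]; first by rewrite subr_gt0.
  by smooth.
by rewrite /toR4S3; smooth.
Qed.

Lemma is_derive_toR4S3 (y u : amb) : rmin G < y.1 ->
  is_derive y u (toR4S3 G)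
   (((2 * Num.sqrt (y.1 - rmin G))^-1 * u.1) *: y.2.1 +
       Num.sqrt (y.1 - rmin G) *: u.2.1,
    qmul u.2.1 (qconj y.2.2) + qmul y.2.1 (qconj u.2.2)).
Proof.
move=> ry; have I := is_derive_idf y u.
have D1 : is_derive y u (fun z : amb => z.1 - rmin G : R^o) u.1.
  have := is_derive_sub (is_derive_fst I) (is_derive_cstf (rmin G : R^o) y u).
  by rewrite subr0.
have D2 : is_derive y u (fun z : amb => Num.sqrt (z.1 - rmin G) : R^o)
    ((2 * Num.sqrt (y.1 - rmin G))^-1 * u.1).
  have [_ <-] := D1; apply: is_derive_comp1.
    by apply: is_derive1_sqrt; rewrite subr_gt0.
  by apply: (smooth_differentiable (O := setT)) => //; smooth.
apply: is_derive_pair.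
  exact: is_derive_scale D2 (is_derive_fst (is_derive_snd I)).
exact: is_derive_qmul (is_derive_fst (is_derive_snd I))
  (is_derive_qconj (is_derive_snd (is_derive_snd I))).
Qed.

Lemma toR4S3_off_zero y : cyl G y ->
  R4S3 (toR4S3 G y) /\ (toR4S3 G y).1 != 0.
Proof.
move=> /cylP[ry a1 b1]; split.
  by split=> //=; rewrite /sphere/= dot_qmul dot_qconj a1 b1 mul1r.
apply/eqP => /= E; have := congr1 (fun x => dot x x) E; move/eqP.
rewrite dotZ a1 mulr1 sqr_sqrtr ?subr_ge0 ?ltW// dot4E !mxE !mulr0 !addr0.
by rewrite subr_eq0 gt_eqF.
Qed.

Lemma toR4S3_surj p : (@R4S3 R `\` zero_section) p ->
  exists2 y, cyl G y & toR4S3 G y = p.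
Proof.
move=> /off_zeroP[[_ q1] p0]; have d0 := dot_gt0 p0.
pose n := Num.sqrt (dot p.1 p.1); have n0 : n != 0 by rewrite gt_eqF// sqrtr_gt0.
have a1 : dot (n^-1 *: p.1) (n^-1 *: p.1) = 1.
  by rewrite dotZ exprVn sqr_sqrtr ?ltW// mulVf// gt_eqF.
exists (rmin G + dot p.1 p.1, (n^-1 *: p.1, qmul (qconj p.2) (n^-1 *: p.1))).
  by split; rewrite /= ?ltrDl//; split; rewrite /sphere/= ?dot_qmul ?dot_qconj ?q1 a1 ?mul1r.
rewrite /toR4S3 /= addrC addrA addNr add0r -/n scalerA mulfV// scale1r.
by rewrite qconjM qconjK qmulA qunitr// mul1q; case: p {q1 p0 d0 n n0 a1}.
Qed.

Section derivatives.
Variable y : amb.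
Hypothesis cy : cyl G y.
Local Notation rho := (Num.sqrt (y.1 - rmin G)).
Local Notation a := y.2.1.
Local Notation q := (qmul y.2.1 (qconj y.2.2)).

Lemma derive_partial_r : 'D_(partial_r y) (toR4S3 G) y = ((2 * rho)^-1 *: a, 0).
Proof.
have [ry _ _] := cylP cy; have [_ ->] := is_derive_toR4S3 (partial_r y) ry.
congr (_, _); rewrite /= ?mulr1 ?scaler0 ?addr0// mul0q add0r.
by rewrite (_ : qconj 0 = 0) ?qmul0//; apply: row4P; rewrite !mxE /= ?oppr0.
Qed.

Lemma derive_Tplus : 'D_(Tplus 0 y) (toR4S3 G) y = (rho *: qmul a i, 0).
Proof.
have [ry _ _] := cylP cy; have [_ ->] := is_derive_toR4S3 (Tplus 0 y) ry.
congr (_, _); rewrite /= -/i ?mulr0 ?scale0r ?add0r//.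
by rewrite qconjM qconjI qmulNl qmulNr qmulA subrr.
Qed.

Lemma derive_Tminus : 'D_(Tminus 0 y) (toR4S3 G) y =
  (rho *: qmul a i, 2 *: qmul (qmul a i) (qconj y.2.2)).
Proof.
have [ry _ _] := cylP cy; have [_ ->] := is_derive_toR4S3 (Tminus 0 y) ry.
congr (_, _); rewrite /= -/i ?mulr0 ?scale0r ?add0r//.
by rewrite qconjN qconjM qconjI qmulNl opprK qmulA scaler_nat mulr2n.
Qed.

Lemma rho_gt0 : 0 < rho.
Proof. by have [ry _ _] := cylP cy; rewrite sqrtr_gt0 subr_gt0. Qed.

Lemma leaf_framing s : leaf s (toR4S3 G y) -> framing s.1 a.
Proof.
have [_ a1 _] := cylP cy; move=> [/= E _ _]; split=> //.
apply: (@scalerI _ _ rho); first by rewrite gt_eqF// rho_gt0.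
by rewrite -qmulZl -qmulZr.
Qed.

Lemma derive_toR4S3_distr (u : amb) (k : 'I_3 -> R) : u = k 0 *: Tplus 0 y + k 1 *: Tminus 0 y +
    k 2 *: partial_r y ->
  'D_u (toR4S3 G) y = k 0 *: 'D_(Tplus 0 y) (toR4S3 G) y +
    k 1 *: 'D_(Tminus 0 y) (toR4S3 G) y + k 2 *: 'D_(partial_r y) (toR4S3 G) y.
Proof.
move=> ->; have [ry _ _] := cylP cy.
have df : differentiable (toR4S3 G) y by exact: smooth_differentiable smooth_toR4S3 _.
by rewrite !deriveE// !linearD !linearZ.
Qed.

(** d/dr moves x radially, T_1^+ moves x along the circle x exp(i t) and fixes q,
   and T_1^- also moves q along its great circle. *)
Lemma leaf_tangent_distr s : sphere 3 s.1 -> leaf s (toR4S3 G y) ->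
  tangent_space (leaf s) (toR4S3 G y) =
  (fun u => 'D_u (toR4S3 G) y) @` distr y.
Proof.
move=> s1 Ls; have [a1 Ea] := leaf_framing Ls; have r0 := rho_gt0.
have r0' : rho != 0 by rewrite gt_eqF.
rewrite leaf_tangent//; apply/seteqP; split=> u /=.
  move=> [E1 [k E2]].
  have fa : framing s.1 a by [].
  have [z] := framing_cplx fa E1; rewrite qmul_cplx => Eu.
  pose K (j : 'I_3) := nth 0 [:: rho^-1 * z 0 1 - k / 2; k / 2; 2 * rho * z 0 0] j.
  exists (K 0 *: Tplus 0 y + K 1 *: Tminus 0 y + K 2 *: partial_r y).
    by exists K.
  rewrite (derive_toR4S3_distr (k := K))// derive_Tplus derive_Tminus derive_partial_r.
  apply: pairP; rewrite /K /= ?Eu ?E2.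
    rewrite !scalerA -scalerDl addrC; congr (_ *: _ + _ *: _); last first.
      by field.
    by field.
  rewrite !scaler0 add0r addr0 scalerA divfK ?pnatr_eq0// Ea.
  by rewrite qmulA.
move=> [v [k ->]] <-; rewrite (derive_toR4S3_distr (k := k))//.
rewrite derive_Tplus derive_Tminus derive_partial_r /=; split.
  have Eai : qmul (qmul a i) i = qmul (im s.1) (qmul a i) by rewrite {1}Ea -qmulA.
  by rewrite !qmulDl !qmulDr !qmulZl !qmulZr Eai Ea.
exists (2 * k 1); rewrite !scaler0 add0r addr0 scalerA mulrC Ea.
by rewrite qmulA.
Qed.

End derivatives.

Lemma leaf_foliation : foliation_of G (@leaf R).
Proof.
split.
- by move=> s _; exact: leaf_R4S3.
- exact: leaf_cover.
- by move=> s s' p _ _; exact: leaf_disjoint.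
- by move=> s y [s1 _] cy L; exact: leaf_tangent_distr.
Qed.

End distribution.

(** * The arc length coordinate *)

Section arclength.
Variable R : realType.
Local Notation mu := (@lebesgue_measure R).

Lemma is_derive_2sqrt (a x : R) : a < x ->
  is_derive x 1 (fun z : R => 2 * Num.sqrt (z - a)) (Num.sqrt (x - a))^-1.
Proof.
move=> ax; have xa : 0 < x - a by rewrite subr_gt0.
have D : is_derive (x : R^o) 1 (fun z : R^o => z - a : R^o) 1.
  have := is_derive_sub (is_derive_idf (x : R^o) 1) (is_derive_cstf (a : R^o) (x : R^o) 1).
  by rewrite subr0.
have [/derivable1_diffP dD D1] := D.
have := is_derive_mul (is_derive_cstf (2 : R^o) (x : R^o) 1)
  (is_derive_comp1 (f := fun z : R^o => z - a : R^o) (1 : R^o)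
     (is_derive1_sqrt xa) dD).
rewrite mul0r add0r D1 mulr1 invfM mulrA mulfV ?mul1r// pnatr_eq0.
Qed.

(** A singularity of order 1/2 is integrable: the integrals over [a + d/(n+2), u]
   are bounded by the increments of the square root. *)
Lemma integrable_sqrt_singularity (h : R -> R) (a u K : R) : a < u -> 0 <= K ->
  (forall x, a < x -> {for x, continuous h}) ->
  (forall x, a < x -> x <= u -> 0 <= h x <= K * (Num.sqrt (x - a))^-1) ->
  mu.-integrable `[a, u] (EFin \o h).
Proof.
move=> au K0 ch hb.
have mo : measurable_fun `]a, u] h.
  apply: (@measurable_funS _ _ _ _ `]a, +oo[) => //.
    by apply: subset_itvl.
  apply: open_continuous_measurable_fun => // x.
  by rewrite inE/= in_itv/= andbT; exact: ch.
have mc : measurable_fun `[a, u] h by apply/measurable_fun_itv_obnd_cbndP.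
apply/integrableP; split; first exact/measurable_EFinP.
rewrite -integral_itv_obnd_cbnd; last first.
  by apply/measurable_EFinP; exact: measurableT_comp.
pose d := u - a; have d0 : 0 < d by rewrite subr_gt0.
(* n + 2 rather than n + 1 keeps b n strictly below u *)
pose b n : R := a + d * (n.+2%:R)^-1.
have ab n : a < b n by rewrite /b ltrDl divr_gt0.
have bu n : b n < u.
  by rewrite /b -ltrBrDl -/d gtr_pMr// invf_lt1// ltr1n.
pose S n : set R := `[b n, u]%classic.
have US : \bigcup_n S n = `]a, u]%classic.
  apply/seteqP; split=> x.
    move=> [n _]; rewrite /S /= !in_itv/= => /andP[bx xu]; rewrite xu andbT.
    exact: lt_le_trans bx.
  rewrite /= in_itv/= => /andP[ax xu].
  have xa : 0 < x - a by rewrite subr_gt0.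
  pose N := Num.truncn (d / (x - a)).
  exists N => //; rewrite /S /= in_itv/= xu andbT /b -lerBrDl.
  rewrite ler_pdivrMr ?ltr0n// mulrC -ler_pdivrMr// ltW//.
  have := truncnS_gt (d / (x - a)); rewrite -/N => H.
  by apply: (lt_trans H); rewrite ltr_nat.
have ndS : nondecreasing_seq S.
  apply/nondecreasing_seqP => n; rewrite subsetEset; apply: subset_itvr.
  rewrite bnd_simp /b lerD2l ler_pM2l// lef_pV2 ?posrE ?ltr0n// ler_nat.
  by rewrite ltnW.
have subS n : S n `<=` `]a, u]%classic by rewrite -US; exact: bigcup_sup.
have cvS : (\int[mu]_(x in S n) `|(EFin \o h) x| @[n --> \oo] -->
    \int[mu]_(x in `]a, u]) `|(EFin \o h) x|)%E.
  rewrite -US; apply: ge0_nondecreasing_set_cvg_integral => //.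
  - by move=> n; exact: measurable_itv.
  - move=> n; apply: (@measurable_funS _ _ _ _ `]a, u]) => //.
    by apply/measurable_EFinP; exact: measurableT_comp.
rewrite -(cvg_lim _ cvS)//.
apply: (@le_lt_trans _ _ ((K * (2 * Num.sqrt (u - a)))%:E)); last exact: ltry.
apply: lime_le; first by apply/cvg_ex; eexists; exact: cvS.
near=> n.
pose f x := K * (Num.sqrt (x - a))^-1.
pose F x := K * (2 * Num.sqrt (x - a)).
have DF x : a < x -> is_derive (x : R^o) 1 (F : R^o -> R^o) (f x).
  move=> ax; have := is_derive_mul (is_derive_cstf (K : R^o) (x : R^o) 1) (is_derive_2sqrt ax).
  by rewrite mul0r add0r.
have cF x : a < x -> {for x, continuous F}.
  by move=> ax; apply/differentiable_continuous/derivable1_diffP; have [] := DF x ax.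
have cf x : a < x -> {for x, continuous f}.
  move=> ax; have sm : smooth [set z : R^o | a < z] (f : R^o -> R^o).
    have oO : open [set z : R^o | a < z] by exact: open_gt.
    apply: smooth_mul => //; first exact: smooth_cst.
    apply: smooth_invf => // [z /= az|].
      by rewrite gt_eqF// sqrtr_gt0 subr_gt0.
    apply: smooth_sqrtf => // [z /= az|]; first by rewrite subr_gt0.
    by smooth.
  exact: smooth_continuous sm ax.
apply: (@le_trans _ _ (\int[mu]_(x in S n) (f x)%:E)%E).
  apply: ge0_le_integral => //.
  - exact: measurable_itv.
  - apply: (@measurable_funS _ _ _ _ `]a, u]) => //.
    by apply/measurable_EFinP; exact: measurableT_comp.
  - apply/measurable_EFinP; apply: (@measurable_funS _ _ _ _ `]a, +oo[) => //.
      by apply: subset_itv; rewrite ?bnd_simp.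
    apply: open_continuous_measurable_fun => // x.
    by rewrite inE/= in_itv/= andbT; exact: cf.
  - move=> x /subS; rewrite /= in_itv/= => /andP[ax xu]; have /andP[h0 hf] := hb x ax xu.
    by rewrite lee_fin ger0_norm.
rewrite (@continuous_FTC2 _ f F)//.
- rewrite -EFinB lee_fin /F lerBlDr lerDl.
  by rewrite !mulr_ge0// sqrtr_ge0.
- apply: continuous_in_subspaceT => x; rewrite inE/= in_itv/= => /andP[bx _].
  by apply: cf; exact: lt_le_trans bx.
- split.
  + move=> x; rewrite in_itv/= => /andP[bx _].
    by have [] := DF x (lt_trans (ab n) bx).
  + by apply: cvg_at_right_filter; exact: cF.
  + by apply: cvg_at_left_filter; exact: cF.
- move=> x; rewrite in_itv/= => /andP[bx _].
  by rewrite derive1E; have [_ ->] := DF x (lt_trans (ab n) bx).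
Unshelve. all: by end_near. Qed.

(** The derivative dt/dr of the arc length coordinate. *)
Definition speed (G : geometry R) (r : R) : R :=
  match G with
  | BryantSalamon c => 1 / Num.sqrt (1 - c ^+ 3 * r ^- 3)
  | BGGG => Num.sqrt (((r - 3 / 4) * (r + 3 / 4)) / ((r - 9 / 4) * (r + 9 / 4)))
  end.

Lemma BS_gt0 (c r : R) : 0 < c -> c < r -> 0 < 1 - c ^+ 3 * r ^- 3.
Proof.
move=> c0 cr; rewrite subr_gt0 ltr_pdivrMr ?exprn_gt0 ?(lt_trans c0)// mul1r.
by rewrite ltrXn2r// ltW// (lt_trans c0).
Qed.

Lemma BGGG_gt0 (r : R) : 9 / 4 < r ->
  0 < ((r - 3 / 4) * (r + 3 / 4)) / ((r - 9 / 4) * (r + 9 / 4)).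
Proof. by move=> r0; rewrite divr_gt0// mulr_gt0//; lra. Qed.

Lemma rmin_gt0 (G : geometry R) : admissible G -> 0 < rmin G.
Proof. by case: G => //= _; lra. Qed.

Lemma continuous_speed (G : geometry R) (r : R) : admissible G -> rmin G < r ->
  {for r, continuous (speed G)}.
Proof.
move=> hG rr; have sm : smooth [set x : R^o | rmin G < x] (speed G : R^o -> R^o).
  have oO : open [set x : R^o | rmin G < x] by exact: open_gt.
  case: G hG rr oO => [c|] /= hG rr oO.
    apply: smooth_mul => //; first exact: smooth_cst.
    have sx k : smooth [set x : R^o | c < x] (fun x : R^o => x ^+ k : R^o).
      elim: k => [|k IH]; first exact: smooth_cst.
      have -> : (fun x : R^o => x ^+ k.+1) = (fun x => x * x ^+ k).
        by apply/funext => x; rewrite exprS.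
      by apply: smooth_mul => //; exact: smooth_id.
    apply: smooth_invf => // [x /= cx|].
      by rewrite gt_eqF// sqrtr_gt0 BS_gt0.
    apply: smooth_sqrtf => // [x /= cx|]; first exact: BS_gt0.
    apply: smooth_sub_fun => //; first exact: smooth_cst.
    apply: smooth_mul => //; first exact: smooth_cst.
    apply: smooth_invf => // x /= cx.
    by rewrite expf_neq0// gt_eqF// (lt_trans hG).
  apply: smooth_sqrtf => // [x /= cx|]; first exact: BGGG_gt0.
  apply: smooth_mul => //; first by smooth.
  apply: smooth_invf => // [x /= cx|]; last by smooth.
  by rewrite gt_eqF// mulr_gt0//; lra.
exact: smooth_continuous sm rr.
Qed.

Lemma speed_gt0 (G : geometry R) (r : R) : admissible G -> rmin G < r -> 0 < speed G r.
Proof.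
case: G => [c|] /= hG rr.
  by rewrite divr_gt0// sqrtr_gt0 BS_gt0.
by rewrite sqrtr_gt0 BGGG_gt0.
Qed.

(** The square of the speed has a simple pole at r_0. *)
Lemma speed_le (G : geometry R) (u r : R) : admissible G -> rmin G < r -> r <= u ->
  speed G r <= Num.sqrt u * (Num.sqrt (r - rmin G))^-1.
Proof.
move=> hG rr ru; have r0 := rmin_gt0 hG; have rp : 0 < r by exact: lt_trans rr.
rewrite -ler_sqr; first last.
- by rewrite nnegrE mulr_ge0// ?invr_ge0 sqrtr_ge0.
- by rewrite nnegrE ltW// speed_gt0.
have sr : 0 < r - rmin G by rewrite subr_gt0.
have u0 : 0 <= u by rewrite ltW// (lt_le_trans rp).
rewrite exprMn exprVn !sqr_sqrtr ?(ltW sr)// {u0}.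
case: G hG rr r0 sr => [c|] /= c0 cr _ sr.
  have h := BS_gt0 c0 cr.
  rewrite mul1r exprVn sqr_sqrtr ?(ltW h)// ler_pdivlMr// mulrC ler_pdivrMr//.
  apply: (@le_trans _ _ (r * (1 - c ^+ 3 * r ^- 3))); last by rewrite ler_pM2r.
  have -> : r * (1 - c ^+ 3 * r ^- 3) = r - c * (c / r) ^+ 2.
    by rewrite expr_div_n; field; rewrite gt_eqF.
  rewrite lerD2l lerN2 ger_pMr// expr_le1// ?divr_ge0 ?ltW//.
  by rewrite ltr_pdivrMr// mul1r.
rewrite sqr_sqrtr ?(ltW (BGGG_gt0 cr))// ler_pdivlMr//.
have -> : (r - 3 / 4) * (r + 3 / 4) / ((r - 9 / 4) * (r + 9 / 4)) * (r - 9 / 4) =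
   (r - 3 / 4) * (r + 3 / 4) / (r + 9 / 4).
  by field; rewrite !gt_eqF//; lra.
rewrite ler_pdivrMr; last by lra.
apply: (@le_trans _ _ (r * (r + 9 / 4))); last by rewrite ler_pM2r//; lra.
by nra.
Qed.

(** The fundamental theorem of calculus; it requires the integrability of the
   speed, which is unbounded near r_0. *)
Lemma derive_tcoord (G : geometry R) (r : R) : admissible G -> rmin G < r ->
  derive1 (tcoord G) r = speed G r.
Proof.
move=> hG rr.
have E : tcoord G = fun x => (\int[mu]_(t in `[rmin G, x]) speed G t)%R.
  by apply/funext => x; case: G {hG rr}.
have ru : r < r + 1 by rewrite ltrDl.
have I : mu.-integrable `[rmin G, r + 1] (EFin \o speed G).
  apply: (@integrable_sqrt_singularity _ _ _ (Num.sqrt (r + 1))).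
  - exact: lt_trans ru.
  - exact: sqrtr_ge0.
  - by move=> x; exact: continuous_speed.
  - by move=> x rx xu; rewrite ltW ?speed_gt0// speed_le.
by rewrite E; have [_ ->] := continuous_FTC1_closed ru I rr (continuous_speed hG rr).
Qed.

End arclength.

(** * Calibration *)

Section multilinear.
Variable R : realType.

Lemma det2E (M : 'M[R]_2) : \det M = M 0 0 * M 1 1 - M 0 1 * M 1 0.
Proof.
have l0 k : lift (0 : 'I_2) (k : 'I_1) = 1 by rewrite ord1; exact: val_inj.
have l1 k : lift (1 : 'I_2) (k : 'I_1) = 0 by rewrite ord1; exact: val_inj.
rewrite (expand_det_row _ 0) sum_ord2 /cofactor !det_mx11 !mxE !l0 !l1 /=.
by rewrite expr0 expr1 mul1r mulN1r mulrN.
Qed.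

Lemma det3E (M : 'M[R]_3) : \det M =
  M 0 0 * (M 1 1 * M 2 2 - M 1 2 * M 2 1) -
  M 0 1 * (M 1 0 * M 2 2 - M 1 2 * M 2 0) +
  M 0 2 * (M 1 0 * M 2 1 - M 1 1 * M 2 0).
Proof.
have l k : lift (0 : 'I_3) (k : 'I_2) = if k == 0 then 1 else 2 :> 'I_3.
  by move: k; apply: ord2P; apply: val_inj.
have l1 k : lift (1 : 'I_3) (k : 'I_2) = if k == 0 then 0 else 2 :> 'I_3.
  by move: k; apply: ord2P; apply: val_inj.
have l2 k : lift (2 : 'I_3) (k : 'I_2) = if k == 0 then 0 else 1 :> 'I_3.
  by move: k; apply: ord2P; apply: val_inj.
rewrite (expand_det_row _ 0) sum_ord3 /cofactor !det2E !mxE !l !l1 !l2 /=.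
rewrite (_ : (0 + 1 %% 3)%N = 1%N)// (_ : (0 + (1 %% 3 + 1 %% 3) %% 3)%N = 2%N)//.
by rewrite addn0 expr0 expr1 sqrrN expr1n !mul1r mulN1r mulrN.
Qed.

Variables (V : lmodType R) (T : V -> Prop).
Hypotheses (T0 : T 0) (TC : forall k u v, T u -> T v -> T (k *: u + v)).
Implicit Types (m : 'I_3 -> R) (E : 'I_3 -> V).

Definition comb m E := \sum_j m j *: E j.

Lemma comb3 m E : comb m E = m 0 *: E 0 + m 1 *: E 1 + m 2 *: E 2.
Proof.
rewrite /comb !big_ord_recl big_ord0 addr0 addrA.
by congr (m _ *: E _ + m _ *: E _ + m _ *: E _); exact: val_inj.
Qed.

Lemma T_comb m E : (forall j, T (E j)) -> T (comb m E).
Proof. by move=> TE; rewrite /comb; elim/big_rec: _ => // j v _; exact: TC. Qed.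

Lemma lin_comb (f : V -> R) m E :
  (forall k u v, T u -> T v -> f (k *: u + v) = k * f u + f v) ->
  (forall j, T (E j)) -> f (comb m E) = \sum_j m j * f (E j).
Proof.
move=> fl TE; have f0 : f 0 = 0.
  by have := fl 1 0 0 T0 T0; rewrite scaler0 addr0; lra.
rewrite /comb; suff [] : T (\sum_j m j *: E j) /\
    f (\sum_j m j *: E j) = \sum_j m j * f (E j) by [].
by elim/big_rec2: _ => [//|j x v _ [Tv Ev]]; rewrite fl// Ev; split=> //; exact: TC.
Qed.

Variable phi : V -> V -> V -> R.
Hypothesis phi12 : forall u v w, T u -> T v -> T w -> phi v u w = - phi u v w.
Hypothesis phi23 : forall u v w, T u -> T v -> T w -> phi u w v = - phi u v w.
Hypothesis philin : forall u v w z k, T u -> T v -> T w -> T z ->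
  phi (k *: u + v) w z = k * phi u w z + phi v w z.

(** Antisymmetry leaves six of the 27 terms, those of the determinant. *)
Lemma alt_comb (M : 'I_3 -> 'I_3 -> R) E : (forall j, T (E j)) ->
  phi (comb (M 0) E) (comb (M 1) E) (comb (M 2) E) =
  \det (\matrix_(i, j) M i j) * phi (E 0) (E 1) (E 2).
Proof.
move=> TE; have TM i : T (comb (M i) E) by exact: T_comb.
rewrite (lin_comb (f := fun x => phi x _ _))//; last by move=> *; exact: philin.
have E2 j : phi (E j) (comb (M 1) E) (comb (M 2) E) =
    \sum_k M 1 k * phi (E j) (E k) (comb (M 2) E).
  rewrite (lin_comb (f := fun x => phi (E j) x _))// => k u v Tu Tv.
  rewrite phi12// ?philin//; last exact: TC.
  by rewrite (phi12 (u := u))// (phi12 (u := v))//; lra.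
have E3 j k : phi (E j) (E k) (comb (M 2) E) = \sum_l M 2 l * phi (E j) (E k) (E l).
  rewrite (lin_comb (f := fun x => phi (E j) (E k) x))// => c u v Tu Tv.
  have H x : T x -> phi (E j) (E k) x = phi x (E j) (E k).
    by move=> Tx; rewrite phi23// phi12// opprK.
  by rewrite !H// ?philin//; exact: TC.
pose a i j k := phi (E i) (E j) (E k).
have a12 i j k : a j i k = - a i j k by exact: phi12.
have a23 i j k : a i k j = - a i j k by exact: phi23.
have z12 i k : a i i k = 0 by have := a12 i i k; lra.
have z23 i k : a i k k = 0 by have := a23 i k k; lra.
have z13 i k : a i k i = 0 by have := a12 i k i; rewrite z23; lra.
under eq_bigr => j _.
  rewrite E2; under eq_bigr do rewrite E3 sum_ord3.
  rewrite sum_ord3; over.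
rewrite sum_ord3 -/(a _ _ _) det3E !mxE.
rewrite -!/(a _ _ _) !z12 !z23 !z13.
rewrite (a23 0 1 2) (a12 0 1 2) (a12 0 2 1) (a23 0 1 2).
rewrite (a12 1 2 0) (a23 1 0 2) (a12 0 1 2).
move: (M 0 0) (M 0 1) (M 0 2) (M 1 0) (M 1 1) (M 1 2) (M 2 0) (M 2 1) (M 2 2).
move: (a 0 1 2) => A m1 m2 m3 m4 m5 m6 m7 m8 m9.
ring.
Qed.

Variable g : V -> V -> R.
Hypothesis gsym : forall u v, T u -> T v -> g u v = g v u.
Hypothesis glin : forall k u v w, T u -> T v -> T w ->
  g (k *: u + v) w = k * g u w + g v w.

Lemma bilin_comb m n E : (forall j, T (E j)) ->
  g (comb m E) (comb n E) = \sum_i \sum_j m i * n j * g (E i) (E j).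
Proof.
move=> TE; have Tn := T_comb n TE.
rewrite (lin_comb (f := fun x => g x _))//; last by move=> *; exact: glin.
apply: eq_bigr => j _; rewrite gsym// (lin_comb (f := fun x => g x _))//.
  by rewrite mulr_sumr; apply: eq_bigr => k _; rewrite gsym// mulrA.
by move=> *; exact: glin.
Qed.

Definition gram E : 'M[R]_3 := \matrix_(i, j) g (E i) (E j).

(** The Gram matrix of the combinations is M G M^T. *)
Lemma gram_comb (M : 'I_3 -> 'I_3 -> R) E : (forall j, T (E j)) ->
  \det (gram (fun i => comb (M i) E)) =
  \det (\matrix_(i, j) M i j) ^+ 2 * \det (gram E).
Proof.
move=> TE; set A := \matrix_(i, j) M i j.
have -> : gram (fun i => comb (M i) E) = A *m gram E *m A^T.
  apply/matrixP => i j; rewrite !mxE bilin_comb//.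
  rewrite exchange_big/=; apply: eq_bigr => k _; rewrite !mxE mulr_suml.
  by apply: eq_bigr => l _; rewrite !mxE; ring.
by rewrite !det_mulmx det_tr; ring.
Qed.

End multilinear.

Lemma cvg_punctured (R : realType) (k1 k2 : R^o -> R^o) :
  {for 0, continuous k1} -> {for 0, continuous k2} ->
  (forall t, t != 0 -> k1 t = k2 t) -> k1 0 = k2 0.
Proof.
move=> c1 c2 E.
have C (k : R^o -> R^o) : {for 0, continuous k} -> k @ 0^' --> k 0.
  by move=> ck; apply: cvg_trans ck; apply: cvg_app; exact: cvg_within.
have C1 := C _ c1; have C2 := C _ c2.
apply: (@cvg_unique _ (@Rhausdorff R) (k1 @ 0^')) => //.
apply: cvg_trans C2; apply: near_eq_cvg.
near=> t; rewrite E//; near: t; exact: nbhs_dnbhs_neq.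
Unshelve. all: by end_near. Qed.

Section leaf_frame.
Variable R : realType.
Local Notation H := 'rV[R]_4.
Local Notation index := ('rV[R]_3 * 'rV[R]_3)%type.
Local Notation amb := (R^o * (H * H))%type.
Local Notation i := (qI R).

(** Lines in the first factor and great circles in the second one. *)
Lemma tangent_R4S3 (p : H * H) (s : 'rV[R]_3) (u : H) (k : R) : sphere 3 s -> R4S3 p ->
  tangent_space R4S3 p (u, k *: qmul (im s) p.2).
Proof.
move=> s1 [_ p1].
pose c (t : R^o) : H * H := (p.1 + t *: u, circle k p.2 (qmul (im s) p.2) t).
have D : is_derive (0 : R^o) 1 c (u, k *: qmul (im s) p.2).
  apply: is_derive_pair; last exact: is_derive_circle.
  have := is_derive_add (is_derive_cstf p.1 (0 : R^o) 1)
    (is_derive_scale (is_derive_idf (0 : R^o) 1) (is_derive_cstf u _ _)).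
  by rewrite add0r scaler0 addr0 scale1r.
have [Dc Du] := D; exists c => //; split=> //.
  by rewrite /c circle0 scale0r addr0; case: p {c D Dc Du p1}.
near=> t; split=> //=.
by apply: dot_circle; rewrite ?dot_imx// dot_qmul dot_im s1 p1 mulr1.
Unshelve. all: by end_near. Qed.

Variables (s : index) (a : H).
Hypotheses (s1 : sphere 3 s.1) (fa : framing s.1 a).

(** These fields frame the leaf, and they are defined on all of R^4 x S^3: so
   the values of g and phi on them are smooth functions, to which continuity at
   the zero section applies. *)
Definition lframe (j : 'I_3) (p : H * H) : H * H :=
  nth 0 [:: (a, 0); (0, qmul (im s.1) p.2); (qmul a i, 0)] j.

Definition lcoord (p u : H * H) (j : 'I_3) : R :=
  nth 0 [:: dot a u.1; dot (qmul (im s.1) p.2) u.2; dot (qmul a i) u.1] j.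

Lemma lframe_field j : vector_field R4S3 (lframe j).
Proof.
split.
  apply/smooth_onT; move: j; apply: ord3P; rewrite /lframe /=; by smooth.
move=> p Rp; move: j; apply: ord3P; rewrite /lframe /=.
- by have := tangent_R4S3 a 0 s1 Rp; rewrite scale0r.
- by have := tangent_R4S3 0 1 s1 Rp; rewrite scale1r.
- by have := tangent_R4S3 (qmul a i) 0 s1 Rp; rewrite scale0r.
Qed.

Variable p : H * H.
Hypothesis Lp : leaf s p.
Local Notation T := (tangent_space (leaf s) p).

Lemma T_R4S3 u : T u -> tangent_space R4S3 p u.
Proof.
move=> [c [c0 dc cL] cu]; exists c => //; split=> //.
by apply: filterS cL => t; exact: leaf_R4S3.
Qed.

Lemma T_zero : T 0.
Proof.
rewrite leaf_tangent//; split; first by rewrite mul0q qmul0.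
by exists 0; rewrite scale0r.
Qed.

Lemma T_closed k u v : T u -> T v -> T (k *: u + v).
Proof.
rewrite leaf_tangent// => -[E1 [c1 F1]] [E2 [c2 F2]]; split=> /=.
  by rewrite qmulDl qmulDr qmulZl qmulZr E1 E2.
by exists (k * c1 + c2); rewrite F1 F2 scalerDl scalerA.
Qed.

Lemma lframe_tangent j : T (lframe j p).
Proof.
have [a1 Ea] := fa; rewrite leaf_tangent//; move: j; apply: ord3P; split=> //=.
- by exists 0; rewrite scale0r.
- by rewrite mul0q qmul0.
- by exists 1; rewrite scale1r.
- by rewrite {1}Ea -qmulA.
- by exists 0; rewrite scale0r.
Qed.

Lemma lframe_coord u : T u -> u = comb (lcoord p u) (lframe ^~ p).
Proof.
have [a1 Ea] := fa; have [_ _ p1] := Lp.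
rewrite leaf_tangent// => -[E1 [k E2]].
have [z] := framing_cplx fa E1; rewrite qmul_cplx => Eu.
have dD n (x y w : 'rV[R]_n) : dot x (y + w) = dot x y + dot x w.
  by rewrite /dot -big_split/=; apply: eq_bigr => j _; rewrite !mxE mulrDr.
rewrite comb3 /lframe /lcoord /=.
have q1 : dot (qmul (im s.1) p.2) (qmul (im s.1) p.2) = 1.
  by rewrite dot_qmul dot_im s1 p1 mulr1.
have ai : dot (qmul a i) (qmul a i) = 1 by rewrite dot_qmul a1 dotI mulr1.
apply: pairP => /=.
  rewrite Eu !dD !dotZr a1 dot_xI ai [dot (qmul a i) a]dotC dot_xI.
  by rewrite !(mulr1, mulr0, addr0, add0r, scaler0).
by rewrite E2 !dotZr q1 !(scaler0, mulr1, add0r, addr0).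
Qed.

End leaf_frame.

Section calibration.
Variable R : realType.
Local Notation H := 'rV[R]_4.
Local Notation index := ('rV[R]_3 * 'rV[R]_3)%type.
Local Notation amb := (R^o * (H * H))%type.
Local Notation i := (qI R).
Variable G : geometry R.
Hypothesis hG : admissible G.

Lemma A1_gt0 r : rmin G < r -> 0 < A1 G r.
Proof.
case: G hG => [c|] /= h rr; last by rewrite sqrtr_gt0 -invf_div invr_gt0 BGGG_gt0.
by rewrite mulr_gt0 ?sqrtr_gt0 ?BS_gt0// divr_gt0// (lt_trans h).
Qed.

Lemma B1_gt0 r : rmin G < r -> 0 < B1 G r.
Proof.
case: G hG => [c|] /= h rr; last by lra.
by rewrite divr_gt0 ?sqrtr_gt0// (lt_trans h).
Qed.

(** The frame of the distribution, in the order in which phi is positive. *)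
Definition dframe (y : amb) (j : 'I_3) : amb :=
  nth 0 [:: partial_r y; Tminus 0 y; Tplus 0 y] j.
Definition dlength (r : R) (j : 'I_3) : R :=
  nth 0 [:: speed G r; 2 * B1 G r; 2 * A1 G r] j.

Lemma dframe_distr y j : distr y (dframe y j).
Proof.
by move: j; apply: ord3P; [exact: distr_partial_r|exact: distr_Tminus|exact: distr_Tplus].
Qed.

Section at_point.
Variable y : amb.
Hypothesis cy : cyl G y.

Lemma dot_qmul_su2T (a : H) j k : dot a a = 1 ->
  dot (qmul a (su2T R j)) (qmul a (su2T R k)) = (j == k)%:R.
Proof.
move=> a1; rewrite dot_qmull a1 mul1r /dot (bigD1 (lift ord0 k))//= big1.
  by rewrite !mxE !eqxx/= mulr1 addr0 (inj_eq lift_inj) eq_sym.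
by move=> l lk; rewrite !mxE (negPf lk) andbF mulr0.
Qed.

Lemma dotNr n (x z : 'rV[R]_n) : dot x (- z) = - dot x z.
Proof. by rewrite -scaleN1r dotZr mulN1r. Qed.

Lemma dot0r n (x : 'rV[R]_n) : dot x 0 = 0.
Proof. by rewrite -(scale0r (0 : 'rV[R]_n)) dotZr mul0r. Qed.

Lemma eta_values :
  ((forall j, etaplus j y (Tplus 0 y) = (j == 0)%:R) *
   (forall j, etaplus j y (Tminus 0 y) = 0) *
   (forall j, etaplus j y (partial_r y) = 0)) *
  ((forall j, etaminus j y (Tplus 0 y) = 0) *
   (forall j, etaminus j y (Tminus 0 y) = (j == 0)%:R) *
   (forall j, etaminus j y (partial_r y) = 0)).
Proof.
have [_ a1 b1] := cylP cy.
rewrite /etaplus /etaminus /Tplus /Tminus /partial_r /=.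
split; split; [split|idtac|split|idtac] => j;
  by rewrite ?dotNr ?dot0r ?dot_qmul_su2T//; field.
Qed.

Lemma dt_values :
  ((dt G y (Tplus 0 y) = 0) * (dt G y (Tminus 0 y) = 0) *
   (dt G y (partial_r y) = speed G y.1)).
Proof.
have [ry _ _] := cylP cy.
by rewrite /dt /= !mulr0 mulr1 derive_tcoord.
Qed.

Lemma g_dframe j k :
  g_cyl G y (dframe y j) (dframe y k) = (j == k)%:R * dlength y.1 j ^+ 2.
Proof.
move: j; apply: ord3P; move: k; apply: ord3P; rewrite /dframe /dlength /=;
  by rewrite /g_cyl !dt_values !eta_values /=; ring.
Qed.

Lemma phi_dframe : phi_cyl G y (dframe y 0) (dframe y 1) (dframe y 2) =
  speed G y.1 * (2 * B1 G y.1) * (2 * A1 G y.1).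
Proof.
rewrite /dframe /= /phi_cyl /Omegaplus /omega /wedge111 /wedge12 /wedge11.
by rewrite !dt_values !eta_values /=; ring.
Qed.

Definition push (j : 'I_3) : H * H := 'D_(dframe y j) (toR4S3 G) y.

(** If the point is (rho a (cos t + i sin t), q), the coordinates of the images
   of d/dr, T_1^- and T_1^+ are (cos t, 0, sin t) / (2 rho),
   (- rho sin t, 2, rho cos t) and (- rho sin t, 0, rho cos t), so this order is
   positively oriented. *)
Lemma push_coord (s : index) (a : H) : framing s.1 a -> leaf s (toR4S3 G y) ->
  0 < \det (\matrix_(j, k) lcoord s a (toR4S3 G y) (push j) k).
Proof.
move=> fa Ls; have [_ a1 b1] := cylP cy; have r0 := rho_gt0 cy.
have [ea1 Ea] := fa; have [_ Ey] := leaf_framing cy Ls.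
have fy : framing s.1 y.2.1 by [].
have [_ _ q1] := Ls.
have ss : dot (im s.1) (im s.1) = 1.
  have := congr1 (fun x => dot x x) Ea; rewrite !dot_qmul ea1 dotI mul1r mulr1.
  by move=> <-.
rewrite det3E !mxE /lcoord /push /dframe /=.
rewrite derive_partial_r// derive_Tminus// derive_Tplus//=.
rewrite Ey -qmulA !dotZr !dot0r dot_qmull ss.
have -> : dot (qmul y.2.1 (qconj y.2.2)) (qmul y.2.1 (qconj y.2.2)) = 1 by [].
have [z Ya] := framing_cplx fa Ey.
have Eay : qmul (im s.1) y.2.1 = qmul a (qmul (cplx z) i).
  by rewrite -Ey Ya qmulA.
rewrite Eay Ya. 
have zz : z 0 0 ^+ 2 + z 0 1 ^+ 2 = 1.
  by move: a1; rewrite Ya dot_qmul ea1 mul1r dot_cplx dot2E => <-; ring.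
have d1 : dot a (qmul a (cplx z)) = z 0 0.
  rewrite -[X in dot X _]qmul1 dot_qmull ea1 mul1r dot4E !mxE /=; ring.
have d2 : dot (qmul a i) (qmul a (cplx z)) = z 0 1.
  by rewrite dot_qmull ea1 mul1r qIE dot4E !mxE /=; ring.
have d3 : dot a (qmul a (qmul (cplx z) i)) = - z 0 1.
  rewrite -[X in dot X _]qmul1 dot_qmull ea1 mul1r dot4E qIE !mxE /=; ring.
have d4 : dot (qmul a i) (qmul a (qmul (cplx z) i)) = z 0 0.
  by rewrite dot_qmull ea1 mul1r dot4E qIE !mxE /=; ring.
rewrite d1 d2 d3 d4.
move: r0 zz; move: (Num.sqrt _) (z 0 0) (z 0 1) => rho u v r0 uv.
rewrite [ltRHS](_ : _ = u ^+ 2 + v ^+ 2); first by rewrite uv.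
by field; rewrite gt_eqF.
Qed.

End at_point.

Variables (g : H * H -> H * H -> H * H -> R)
  (phi : H * H -> H * H -> H * H -> H * H -> R).
Hypothesis hext : g2_extension G g phi.

Section one_leaf.
Variables (s : index) (a : H).
Hypotheses (s1 : sphere 3 s.1) (fa : framing s.1 a).
Local Notation E p := (lframe s a ^~ p).
Local Notation T p := (tangent_space (leaf s) p).

Let phi_leaf p : leaf s p ->
  [/\ forall u v w, T p u -> T p v -> T p w -> phi p v u w = - phi p u v w,
      forall u v w, T p u -> T p v -> T p w -> phi p u w v = - phi p u v w &
      forall u v w z k, T p u -> T p v -> T p w -> T p z ->
        phi p (k *: u + v) w z = k * phi p u w z + phi p v w z].
Proof.
move=> Lp; have [_ [h _] _ _] := hext; have {}h := h _ (leaf_R4S3 Lp).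
have t u : T p u -> tangent_space R4S3 p u by exact: T_R4S3.
split.
- by move=> u v w Tu Tv Tw; have [] := h u v w w (t _ Tu) (t _ Tv) (t _ Tw) (t _ Tw).
- by move=> u v w Tu Tv Tw; have [] := h u v w w (t _ Tu) (t _ Tv) (t _ Tw) (t _ Tw).
- move=> u v w z k Tu Tv Tw Tz.
  by have [_ _] := h u v w z (t _ Tu) (t _ Tv) (t _ Tw) (t _ Tz); apply.
Qed.

Lemma g_leaf p : leaf s p ->
  (forall u v, T p u -> T p v -> g p u v = g p v u) /\
  (forall k u v w, T p u -> T p v -> T p w ->
     g p (k *: u + v) w = k * g p u w + g p v w).
Proof.
move=> Lp; have [[h _] _ _ _] := hext; have {}h := h _ (leaf_R4S3 Lp).
have t u : T p u -> tangent_space R4S3 p u by exact: T_R4S3.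
split.
- by move=> u v Tu Tv; have [] := h u v v (t _ Tu) (t _ Tv) (t _ Tv).
- move=> k u v w Tu Tv Tw.
  by have [_ + _] := h u v w (t _ Tu) (t _ Tv) (t _ Tw); apply.
Qed.

Lemma phi_comb p (M : 'I_3 -> 'I_3 -> R) F : leaf s p -> (forall j, T p (F j)) ->
  phi p (comb (M 0) F) (comb (M 1) F) (comb (M 2) F) =
  \det (\matrix_(j, k) M j k) * phi p (F 0) (F 1) (F 2).
Proof.
move=> Lp TF; have [h1 h2 h3] := phi_leaf Lp.
exact: (alt_comb (T_zero s1 Lp) (T_closed s1 Lp) h1 h2 h3 M TF).
Qed.

Lemma g_gram_comb p (M : 'I_3 -> 'I_3 -> R) F : leaf s p -> (forall j, T p (F j)) ->
  \det (gram (g p) (fun j => comb (M j) F)) =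
  \det (\matrix_(j, k) M j k) ^+ 2 * \det (gram (g p) F).
Proof.
move=> Lp TF; have [h1 h2] := g_leaf Lp.
exact: (gram_comb (T_zero s1 Lp) (T_closed s1 Lp) h1 h2 M TF).
Qed.

Lemma push_tangent y j : cyl G y -> leaf s (toR4S3 G y) ->
  T (toR4S3 G y) (push y j).
Proof.
move=> cy Ls; rewrite leaf_tangent_distr//; exists (dframe y j) => //.
exact: dframe_distr.
Qed.

Lemma g_push y j k : cyl G y -> g (toR4S3 G y) (push y j) (push y k) =
  (j == k)%:R * dlength y.1 j ^+ 2.
Proof.
move=> cy; have [_ _ h _] := hext.
by rewrite /push h// ?g_dframe//; apply: distr_tangent => //; exact: dframe_distr.
Qed.

Lemma phi_push y : cyl G y ->
  phi (toR4S3 G y) (push y 0) (push y 1) (push y 2) =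
  speed G y.1 * (2 * B1 G y.1) * (2 * A1 G y.1).
Proof.
move=> cy; have [_ _ _ h] := hext.
by rewrite /push h// ?phi_dframe//; apply: distr_tangent => //; exact: dframe_distr.
Qed.

(** phi is the volume form of the leaf off the zero section: there the images
   of T_1^+, T_1^- and d/dr are orthogonal, and phi takes the product of their
   lengths. *)
Lemma calibrated_off_zero p : leaf s p -> p.1 != 0 ->
  0 <= phi p (E p 0) (E p 1) (E p 2) /\
  phi p (E p 0) (E p 1) (E p 2) ^+ 2 = \det (gram (g p) (E p)).
Proof.
move=> Lp p0.
have [y cy yp] : exists2 y, cyl G y & toR4S3 G y = p.
  by apply: toR4S3_surj; apply/off_zeroP; split=> //; exact: leaf_R4S3 Lp.
subst p; have [ry _ _] := cylP cy.
pose M j := lcoord s a (toR4S3 G y) (push y j).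
have TE j : T (toR4S3 G y) (E (toR4S3 G y) j) by exact: lframe_tangent.
have pE j : push y j = comb (M j) (E (toR4S3 G y)).
  by apply: lframe_coord => //; exact: push_tangent.
have Mpos : 0 < \det (\matrix_(j, k) M j k) by exact: push_coord.
have P := phi_push cy; rewrite !pE phi_comb// in P.
have D : \det (gram (g (toR4S3 G y)) (push y)) =
    (speed G y.1 * (2 * B1 G y.1) * (2 * A1 G y.1)) ^+ 2.
  have -> : gram (g (toR4S3 G y)) (push y) = diag_mx (\row_j dlength y.1 j ^+ 2).
    apply/matrixP => j k; rewrite !mxE g_push// mulr_natl.
    by case: eqP => [->|_]; rewrite ?mulr0n.
  rewrite det_diag !big_ord_recl big_ord0 !mxE mulr1 /dlength /=.
  by rewrite !exprMn !mulrA.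
have F : push y = (fun j => comb (M j) (E (toR4S3 G y))) by apply/funext.
rewrite F g_gram_comb// -P exprMn in D.
split; last by apply/esym; apply: (mulfI _ D); rewrite sqrf_eq0 gt_eqF.
rewrite -(pmulr_rge0 _ Mpos) P !mulr_ge0//; apply: ltW.
- exact: speed_gt0.
- exact: B1_gt0.
- exact: A1_gt0.
Qed.

(* the ray from a point (0, q) of the zero section inside the leaf *)
Let path (q : H) (t : R^o) : H * H := (t *: a, q).

Let path_leaf q t : leaf s (0, q) -> leaf s (path q t).
Proof.
move=> [_ E2 q1]; split=> //=; have [_ Ea] := fa.
by rewrite qmulZl qmulZr Ea.
Qed.

Let path_continuous q (h : H * H -> R^o) : smooth_on R4S3 h -> leaf s (0, q) ->
  {for 0, continuous (fun t => h (path q t))}.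
Proof.
move=> hs L0; have R0 := leaf_R4S3 L0.
have [Q [F [oQ Q0 sF hF]]] := hs _ R0.
have P0 : path q 0 = (0, q) by rewrite /path scale0r.
have sp : smooth setT (path q) by rewrite /path; smooth.
have cp := smooth_continuous (x := 0) sp Logic.I.
have cF : {for path q 0, continuous F} by rewrite P0; exact: smooth_continuous sF Q0.
have cFp : {for 0, continuous (F \o path q)} by exact: continuous_comp.
have N : \forall t \near (0 : R^o), (F \o path q) t = h (path q t).
  have NQ : nbhs (path q 0) Q by rewrite P0; exact: open_nbhs_nbhs.
  have := cp _ NQ; apply: (@filterS _ (nbhs (0 : R^o))) => t Qt.
  by rewrite /= -hF//; apply: leaf_R4S3 (path_leaf t L0).
have A : F (path q 0) = h (path q 0) := nbhs_singleton N.
have : (F \o path q) @ 0 --> h (path q 0) by rewrite -A; exact: cFp.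
by apply: cvg_trans; exact: near_eq_cvg.
Qed.

(** On the zero section, where g and phi are not given by formulas, both
   relations are limits of those at the points (t a, q) with t nonzero. The
   sign is passed to the limit as the equation k = |k|. *)
Lemma calibrated_frame p : leaf s p ->
  0 <= phi p (E p 0) (E p 1) (E p 2) /\
  phi p (E p 0) (E p 1) (E p 2) ^+ 2 = \det (gram (g p) (E p)).
Proof.
move=> Lp; have [p0|] := eqVneq p.1 0; last exact: calibrated_off_zero.
have [q Eq] : exists q, p = (0, q) by exists p.2; case: p p0 {Lp} => ? ? /= ->.
subst p; rewrite {p0}.
pose k t := phi (path q t) (E (path q t) 0) (E (path q t) 1) (E (path q t) 2) : R^o.
pose h (j l : 'I_3) t := g (path q t) (E (path q t) j) (E (path q t) l) : R^o.
have [[_ gs] [_ ps] _ _] := hext.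
have F j := lframe_field a s1 j.
have ck : {for 0, continuous k}.
  exact: (path_continuous (ps _ _ _ (F 0) (F 1) (F 2)) Lp).
have ch j l : {for 0, continuous (h j l)}.
  exact: (path_continuous (gs _ _ (F j) (F l)) Lp).
have P0 : path q 0 = (0, q) by rewrite /path scale0r.
have offz t : t != 0 -> (path q t).1 != 0.
  move=> t0; apply/eqP => /= /eqP; rewrite scaler_eq0 (negPf t0)/= => /eqP az.
  by have [a1 _] := fa; move: a1; rewrite az dot0r => /eqP; rewrite eq_sym oner_eq0.
have C t t0 := calibrated_off_zero (path_leaf t Lp) (offz t t0).
have K1 : k 0 = `|k 0|.
  apply: (cvg_punctured (k1 := k) (k2 := fun t => `|k t| : R^o)) => //.
    by apply: continuous_comp => //; exact: norm_continuous.
  by move=> t t0; rewrite ger0_norm//; have [] := C t t0.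
have detE t : \det (gram (g (path q t)) (E (path q t))) =
    h 0 0 t * (h 1 1 t * h 2 2 t - h 1 2 t * h 2 1 t) -
    h 0 1 t * (h 1 0 t * h 2 2 t - h 1 2 t * h 2 0 t) +
    h 0 2 t * (h 1 0 t * h 2 1 t - h 1 1 t * h 2 0 t).
  by rewrite det3E !mxE.
have K2 : k 0 * k 0 = \det (gram (g (path q 0)) (E (path q 0))).
  rewrite detE; apply: (cvg_punctured (k1 := fun t => k t * k t : R^o) (k2 := fun t =>
    h 0 0 t * (h 1 1 t * h 2 2 t - h 1 2 t * h 2 1 t) -
    h 0 1 t * (h 1 0 t * h 2 2 t - h 1 2 t * h 2 0 t) +
    h 0 2 t * (h 1 0 t * h 2 1 t - h 1 1 t * h 2 0 t) : R^o)).
  - exact: continuousM.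
  - by apply: continuousD; [apply: continuousB|]; apply: continuousM => //;
      apply: continuousB; exact: continuousM.
  - by move=> t t0; rewrite -detE -expr2; have [_ ->] := C t t0.
rewrite -P0; split; first by rewrite -[phi _ _ _ _]/(k 0) K1.
by rewrite -K2 expr2.
Qed.

Definition leaf_orientation (p u v w : H * H) : R :=
  \det (\matrix_(j < 3, k < 3) lcoord s a p (nth 0 [:: u; v; w] j) k).

Lemma lcoord_lin p k u v j :
  lcoord s a p (k *: u + v) j = k * lcoord s a p u j + lcoord s a p v j.
Proof.
have dD n (x y w : 'rV[R]_n) : dot x (k *: y + w) = k * dot x y + dot x w.
  by rewrite /dot mulr_sumr -big_split/=; apply: eq_bigr => l _; rewrite !mxE; ring.
by move: j; apply: ord3P; rewrite /lcoord /= dD.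
Qed.

Lemma leaf_orientation_form : form3 (leaf s) leaf_orientation.
Proof.
have gen (m1 m2 m3 m4 m5 m6 m7 m8 m9 : R) :
  (m4 * (m2 * m9 - m3 * m8) - m5 * (m1 * m9 - m3 * m7) + m6 * (m1 * m8 - m2 * m7) =
  - (m1 * (m5 * m9 - m6 * m8) - m2 * (m4 * m9 - m6 * m7) + m3 * (m4 * m8 - m5 * m7)))
  /\ (m1 * (m8 * m6 - m9 * m5) - m2 * (m7 * m6 - m9 * m4) + m3 * (m7 * m5 - m8 * m4) =
  - (m1 * (m5 * m9 - m6 * m8) - m2 * (m4 * m9 - m6 * m7) + m3 * (m4 * m8 - m5 * m7))).
  by split; ring.
split.
  move=> p Lp u v w z _ _ _ _; rewrite /leaf_orientation; split.
  - by rewrite !det3E !mxE /=; have [-> _] := gen (lcoord s a p u 0) (lcoord s a p u 1)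
      (lcoord s a p u 2) (lcoord s a p v 0) (lcoord s a p v 1)
      (lcoord s a p v 2) (lcoord s a p w 0) (lcoord s a p w 1) (lcoord s a p w 2).
  - by rewrite !det3E !mxE /=; have [_ ->] := gen (lcoord s a p u 0) (lcoord s a p u 1)
      (lcoord s a p u 2) (lcoord s a p v 0) (lcoord s a p v 1)
      (lcoord s a p v 2) (lcoord s a p w 0) (lcoord s a p w 1) (lcoord s a p w 2).
  - move=> k; rewrite !det3E !mxE /= !lcoord_lin.
    move: (lcoord s a p) => l.
    move: (l u 0) (l u 1) (l u 2) (l v 0) (l v 1) (l v 2).
    by move: (l w 0) (l w 1) (l w 2) (l z 0) (l z 1) (l z 2) => *; ring.
move=> X Y Z [sX _] [sY _] [sZ _] p Lp.
have [U1 [F1 [oU1 U1p sF1 E1]]] := sX _ Lp.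
have [U2 [F2 [oU2 U2p sF2 E2]]] := sY _ Lp.
have [U3 [F3 [oU3 U3p sF3 E3]]] := sZ _ Lp.
pose O := U1 `&` U2 `&` U3.
have oO : open O by do 2?apply: openI.
exists O, (fun p => leaf_orientation p (F1 p) (F2 p) (F3 p)).
have f1 : smooth O F1 by apply: smooth_subset sF1 => x [[]].
have f2 : smooth O F2 by apply: smooth_subset sF2 => x [[]].
have f3 : smooth O F3 by apply: smooth_subset sF3 => x [].
split=> //; last by move=> x Lx [[x1 x2] x3]; rewrite E1// E2// E3.
have sl (F : H * H -> H * H) j : smooth O F ->
    smooth O (fun p => lcoord s a p (F p) j : R^o).
  by move=> sF; move: j; apply: ord3P; rewrite /lcoord /=; smooth.
have -> : (fun p => leaf_orientation p (F1 p) (F2 p) (F3 p)) = fun p =>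
    let m := lcoord s a p (F1 p) in let n := lcoord s a p (F2 p) in
    let k := lcoord s a p (F3 p) in
    m 0 * (n 1 * k 2 - n 2 * k 1) - m 1 * (n 0 * k 2 - n 2 * k 0) +
      m 2 * (n 0 * k 1 - n 1 * k 0).
  by apply/funext => x; rewrite /leaf_orientation det3E !mxE.
move: (sl _ 0 f1) (sl _ 1 f1) (sl _ 2 f1) (sl _ 0 f2) (sl _ 1 f2) (sl _ 2 f2).
move: (sl _ 0 f3) (sl _ 1 f3) (sl _ 2 f3) => *.
by cbv zeta; repeat first [assumption | apply: smooth_add | apply: smooth_opp
  | apply: smooth_mul].
Qed.

(** With respect to the frame an orthonormal frame e is a matrix M of positive
   determinant; phi(e) is det M times phi of the frame, and its square is
   (det M)^2 times the Gram determinant of the frame, which is that of e. *)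
Lemma leaf_calibrated : calibrated3 (leaf s) g phi.
Proof.
exists leaf_orientation; split; first exact: leaf_orientation_form.
  move=> p Lp; exists (E p 0), (E p 1), (E p 2); split; try exact: lframe_tangent.
  have [a1 _] := fa; have [_ _ p1] := Lp.
  rewrite /leaf_orientation det3E !mxE /lcoord /lframe /= !dot0r a1 dot_xI.
  by rewrite !dot_qmul dot_im dotI a1 s1 p1 !(mul0r, mulr0, subr0, mulr1, addr0) oner_neq0.
move=> p Lp e Te ortho tau0.
pose M j := lcoord s a p (e j).
have eE j : e j = comb (M j) (E p) by exact: lframe_coord.
have TE j : T p (E p j) by exact: lframe_tangent.
have Mpos : 0 < \det (\matrix_(j, k) M j k).
  move: tau0; rewrite /leaf_orientation; congr (0 < \det _).
  by apply/matrixP; apply: ord3P => k; rewrite !mxE.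
have D : \det (gram (g p) e) = 1.
  have -> : gram (g p) e = 1%:M by apply/matrixP => j k; rewrite !mxE ortho.
  exact: det1.
have [k0 k2] := calibrated_frame Lp.
have F : e = (fun j => comb (M j) (E p)) by apply/funext.
rewrite F g_gram_comb// -k2 -exprMn in D.
rewrite !eE phi_comb//; apply/eqP; rewrite -(eqrXn2 (n := 2))// ?expr1n ?D//.
by rewrite mulr_ge0// ltW.
Qed.

End one_leaf.

End calibration.

(** * Torus coordinates *)

Section circle_group.
Variable R : realType.
Local Notation H := 'rV[R]_4.
Local Notation i := (qI R).

Lemma periodic_int (f : R -> R) (T : R) (m : int) x :
  periodic f T -> f (x + T * m%:~R) = f x.
Proof.
move=> fT; case: m => n.
  by rewrite -[RHS](periodicn fT n) mulr_natr.
rewrite NegzE mulrNz mulrN -[LHS](periodicn fT n.+1).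
by rewrite -mulr_natr addrNK.
Qed.

(** Reduce the difference to [0, 2 pi), where cos takes the value 1 only at 0:
   it is injective on [0, pi], and 2 pi - d replaces d on the other half. *)
Lemma cos_sin_eq (x y : R) : (cos x = cos y /\ sin x = sin y) <->
  exists m : int, x - y = 2 * pi * m%:~R.
Proof.
have p0 := pi_gt0 R; split=> [[Ec Es]|[m E]]; last first.
  have -> : x = y + (pi *+ 2) * m%:~R by rewrite -(mulr_natl pi) -E addrC subrK.
  by split; apply: periodic_int; [exact: cosD2pi|exact: sinD2pi].
exists (Num.floor ((x - y) / (2 * pi))); set m := Num.floor _.
pose d := x - y - 2 * pi * m%:~R.
have cd : cos d = 1.
  have -> : d = x - y + (pi *+ 2) * (- m)%:~R by rewrite /d mulrNz mulrN -(mulr_natl pi).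
  rewrite periodic_int; last exact: cosD2pi.
  by rewrite cosB Ec Es -!expr2 cos2Dsin2.
have d0 : 0 <= d.
  rewrite /d subr_ge0 mulrC -ler_pdivlMr ?mulr_gt0//.
  exact: Num.Theory.floor_le.
have d2 : d < 2 * pi.
  have := Num.Theory.floorD1_gt ((x - y) / (2 * pi)); rewrite -/m ltr_pdivrMr ?mulr_gt0//.
  by rewrite intrD /d; lra.
suff : d = 0 by move/eqP; rewrite /d subr_eq0 => /eqP.
have [dp|dp] := lerP d pi.
  apply: cos_inj; [by rewrite in_itv/= d0|by rewrite in_itv/= lexx ltW|].
  by rewrite cd cos0.
have : 2 * pi - d = 0.
  apply: cos_inj; [|by rewrite in_itv/= lexx ltW|].
    by rewrite in_itv/=; apply/andP; split; lra.
  rewrite cos0 -[RHS]cd -cosN opprB -[RHS](periodic_int (-1) d (@cosD2pi R)).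
  by congr cos; rewrite mulrN1z -(mulr_natl pi); lra.
by lra.
Qed.

Lemma cos_sin_surj (x y : R) : x ^+ 2 + y ^+ 2 = 1 ->
  exists t, cos t = x /\ sin t = y.
Proof.
move=> xy; have x1 : -1 <= x <= 1.
  have h : x ^+ 2 <= 1 by rewrite -xy lerDl sqr_ge0.
  by rewrite -ler_norml -(expr_le1 (n := 2))// real_normK ?num_real.
have s : sin (acos x) = `|y|.
  by rewrite sin_acos// -xy addrAC subrr add0r sqrtr_sqr.
have [y0|y0] := lerP 0 y.
  by exists (acos x); rewrite acosK ?in_itv//= s ger0_norm.
exists (- acos x); rewrite cosN sinN acosK ?in_itv//= s ltr0_norm//.
by rewrite opprK.
Qed.

Definition cis (t : R) : H := quat (cos t) (sin t) 0 0.

Lemma dot_cis t : dot (cis t) (cis t) = 1.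
Proof. by rewrite dot4E !mxE /= mulr0 !addr0 -!expr2 cos2Dsin2. Qed.

Lemma cisI t : qmul (cis t) i = qmul i (cis t).
Proof. qring. Qed.

Lemma cis_inj t u : cis t = cis u <-> exists m : int, t - u = 2 * pi * m%:~R.
Proof.
rewrite -cos_sin_eq; split=> [E|[E1 E2]]; last by rewrite /cis E1 E2.
have := congr1 (fun x : H => x 0 0) E; have := congr1 (fun x : H => x 0 1) E.
by rewrite !mxE.
Qed.

Lemma framing_cis s a x : framing s a -> framing s x -> exists t, x = qmul a (cis t).
Proof.
move=> fa [x1 E]; have [a1 _] := fa; have [z Ez] := framing_cplx fa E.
move: x1; rewrite Ez dot_qmul a1 mul1r dot_cplx dot2E -!expr2 => /cos_sin_surj[t [E1 E2]].
by exists t; rewrite /cis E1 E2.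
Qed.

Lemma cis_framing s a t : framing s a -> framing s (qmul a (cis t)).
Proof.
move=> [a1 E]; split; first by rewrite dot_qmul a1 dot_cis mulr1.
by rewrite -qmulA cisI qmulA E qmulA.
Qed.

Lemma is_derive_cis (V : normedModType R) (h : V -> R^o) x v : differentiable h x ->
  is_derive x v (fun y => cis (h y)) ('D_v h x *: qmul (cis (h x)) i).
Proof.
move=> dh; have c := is_derive_comp1 v (is_derive_cos (h x)) dh.
have s := is_derive_comp1 v (is_derive_sin (h x)) dh.
have k := is_derive_cstf (0 : R^o) x v.
have -> : 'D_v h x *: qmul (cis (h x)) i =
    quat (- sin (h x) * 'D_v h x) (cos (h x) * 'D_v h x) 0 0.
  by apply: row4P; rewrite qIE !mxE /=; ring.
exact: is_derive_quat.
Qed.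

End circle_group.

Section torus.
Variable R : realType.
Local Notation H := 'rV[R]_4.
Local Notation index := ('rV[R]_3 * 'rV[R]_3)%type.
Local Notation amb := (R^o * (H * H))%type.
Local Notation i := (qI R).
Variable G : geometry R.
Variables (s : index) (a b : H).
Hypotheses (fa : framing s.1 a) (fb : framing s.2 b).

Definition ycoord (x : 'rV[R]_3) : amb :=
  (x 0 0, (qmul a (cis (2^-1 * (x 0 1 + x 0 2))), qmul b (cis (2^-1 * (x 0 1 - x 0 2))))).

Definition Psi (x : 'rV[R]_3) : H * H := toR4S3 G (ycoord x).

(** Off the zero section the leaf consists of the images of the (r, a, b) with
   a i a^-1 = s1 and b i b^-1 = s2, which is a torus orbit for each r. *)
Lemma leaf_toR4S3 y : cyl G y ->
  leaf s (toR4S3 G y) <-> framing s.1 y.2.1 /\ framing s.2 y.2.2.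
Proof.
move=> cy; have [ry a1 b1] := cylP cy; split=> [Ls|[f1 f2]].
  have f1 := leaf_framing cy Ls; split=> //; split=> //.
  have [_ /= E2 _] := Ls; have [_ Ea] := f1.
  have : qmul (qconj y.2.2) (im s.2) = qmul i (qconj y.2.2).
    rewrite -[LHS](qmulKl a1) [qmul y.2.1 (qmul _ _)]qmulA E2.
    by rewrite [qmul (im s.1) _]qmulA -Ea -qmulA qmulKl.
  move=> E; have -> : i = qmul (qmul (qconj y.2.2) (im s.2)) y.2.2.
    by rewrite E -qmulA qunitl// qmul1.
  by rewrite -qmulA qmulVKl.
have [_ Ea] := f1; have [_ Eb] := f2; split=> /=.
- by rewrite qmulZl qmulZr Ea.
- by rewrite -qmulA -(framing_conj f2) !qmulA Ea.
- by rewrite dot_qmul dot_qconj a1 b1 mulr1.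
Qed.

Lemma ycoord_cyl (x : 'rV[R]_3) : rmin G < x 0 0 -> cyl G (ycoord x).
Proof.
have [a1 _] := fa; have [b1 _] := fb.
by move=> rx; split=> //; split; rewrite /sphere/= dot_qmul dot_cis ?a1 ?b1 mulr1.
Qed.

Lemma toR4S3_inj y z : cyl G y -> cyl G z -> toR4S3 G y = toR4S3 G z -> y = z.
Proof.
move=> cy cz [/= E1 E2]; have [ry a1 b1] := cylP cy; have [rz c1 d1] := cylP cz.
have ry0 := rho_gt0 cy; have rz0 := rho_gt0 cz.
have Er : y.1 = z.1.
  have := congr1 (fun x => dot x x) E1; rewrite !dotZ a1 c1 !mulr1.
  by rewrite !sqr_sqrtr ?subr_ge0 ?ltW// => /addIr.
have Ea : y.2.1 = z.2.1.
  by move: E1; rewrite Er; apply: scalerI; rewrite gt_eqF.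
have Eb : y.2.2 = z.2.2.
  apply: (can_inj (@qconjK R)).
  by rewrite -[LHS](qmulKl a1) E2 Ea qmulKl.
by apply: pairP => //; exact: pairP.
Qed.

Lemma smooth_cis (V : normedModType R) (O : set V) (h : V -> R^o) : open O ->
  smooth O h -> smooth O (fun x => cis (h x)).
Proof.
move=> oO hh; apply: smooth_quat => //.
- exact: smooth_compT (@smooth_cos R) oO hh.
- exact: smooth_compT (@smooth_sin R) oO hh.
- exact: smooth_cst.
- exact: smooth_cst.
Qed.

Lemma smooth_angle (O : set 'rV[R]_3) (k : R) : open O ->
  smooth O (fun x : 'rV[R]_3 => 2^-1 * (x 0 1 + k * x 0 2) : R^o).
Proof. by move=> oO; smooth. Qed.

Lemma smooth_ycoord : smooth setT ycoord.
Proof.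
rewrite /ycoord; apply: smooth_pair; [exact: openT|by smooth|].
apply: smooth_pair; [exact: openT| |]; apply: smooth_qmul;
  by [exact: openT|exact: smooth_cst|apply: smooth_cis; [exact: openT|smooth]].
Qed.

Local Notation dom := [set x : 'rV[R]_3 | rmin G < x 0 0].

Lemma open_dom : open dom.
Proof.
apply: (@open_comp _ _ (fun x : 'rV[R]_3 => x 0 0) [set r | rmin G < r]).
  by move=> x _; exact: coord_continuous.
exact: open_gt.
Qed.

Lemma smooth_Psi : smooth dom Psi.
Proof.
have oO := open_dom.
have sy : smooth dom ycoord by exact: smooth_subset smooth_ycoord.
have h : smooth dom (fun x => Num.sqrt ((ycoord x).1 - rmin G) : R^o).
  apply: smooth_sqrtf => // [x|]; first by rewrite subr_gt0.
  by apply: smooth_sub_fun => //; [exact: smooth_fst|exact: smooth_cst].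
rewrite /Psi /toR4S3; move: (ycoord) sy h => yc sy h.
by smooth.
Qed.

(** Right multiplication by exp(i alpha) and exp(i beta) generates (a i, 0) and
   (0, b i), and alpha = (theta_1 + theta_2)/2, beta = (theta_1 - theta_2)/2. *)
Lemma derive_ycoord x (u : 'rV[R]_3) : 'D_u ycoord x =
  u 0 0 *: partial_r (ycoord x) + (u 0 1 / 2) *: Tplus 0 (ycoord x) +
  (u 0 2 / 2) *: Tminus 0 (ycoord x).
Proof.
have I := is_derive_idf x u.
have ang (k : R) : is_derive x u (fun x : 'rV[R]_3 => 2^-1 * (x 0 1 + k * x 0 2) : R^o)
    (2^-1 * (u 0 1 + k * u 0 2)).
  have := is_derive_mul (is_derive_cstf (2^-1 : R^o) x u)
   (is_derive_add (is_derive_coord 1 I)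
     (is_derive_mul (is_derive_cstf (k : R^o) x u) (is_derive_coord 2 I))).
  by rewrite !mul0r !add0r.
have cs (k : R) : is_derive x u (fun x : 'rV[R]_3 => cis (2^-1 * (x 0 1 + k * x 0 2)))
    ((2^-1 * (u 0 1 + k * u 0 2)) *: qmul (cis (2^-1 * (x 0 1 + k * x 0 2))) i).
  have [_ E] := ang k; rewrite -[X in X *: _]E; apply: is_derive_cis.
  exact: smooth_differentiable (smooth_angle k openT) Logic.I.
have qc (c : H) k := is_derive_qmul (is_derive_cstf c x u) (cs k).
have D := is_derive_pair (is_derive_coord 0 I) (is_derive_pair (qc a 1) (qc b (-1))).
have Ey : (fun y : 'rV[R]_3 => (y 0 0 : R^o,
    (qmul a (cis (2^-1 * (y 0 1 + 1 * y 0 2))),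
     qmul b (cis (2^-1 * (y 0 1 + -1 * y 0 2)))))) = ycoord.
  by apply/funext => y; rewrite mul1r mulN1r.
rewrite Ey in D; have [_ ->] := D; rewrite !mul0q !add0r !mul1r !mulN1r.
apply: pairP => /=; first by rewrite /GRing.scale/= mulr1 !mulr0 !addr0.
apply: pairP => /=; rewrite ?scaler0 ?add0r -/i qmulZr qmulA.
  by rewrite -scalerDl; congr (_ *: _); field.
by rewrite scalerN -scalerBl; congr (_ *: _); field.
Qed.

Lemma derive_Psi x (u : 'rV[R]_3) : dom x -> 'D_u Psi x =
  u 0 0 *: 'D_(partial_r (ycoord x)) (toR4S3 G) (ycoord x) +
  (u 0 1 / 2) *: 'D_(Tplus 0 (ycoord x)) (toR4S3 G) (ycoord x) +
  (u 0 2 / 2) *: 'D_(Tminus 0 (ycoord x)) (toR4S3 G) (ycoord x).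
Proof.
move=> rx.
have df : differentiable (toR4S3 G) (ycoord x).
  exact: smooth_differentiable (@smooth_toR4S3 R G) _.
have dy : differentiable ycoord x by exact: smooth_differentiable smooth_ycoord Logic.I.
have dP : differentiable Psi x by exact: differentiable_comp.
rewrite [LHS]deriveE// diff_comp//= -[X in 'd (toR4S3 G) _ X]deriveE// derive_ycoord.
by rewrite !linearD !linearZ !deriveE.
Qed.

Lemma Psi_torus : torus_coordinates G (leaf s) Psi.
Proof.
have [a1 _] := fa; have [b1 _] := fb; split.
- exact: smooth_Psi.
- apply/seteqP; split=> p.
    move=> [x rx <-]; have cy := ycoord_cyl rx; split.
      by apply/leaf_toR4S3 => //; split; exact: cis_framing.
    by have [_ p0] := toR4S3_off_zero cy; case=> /eqP; rewrite (negPf p0).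
  move=> [Lp Zp]; have [|y cy yp] := @toR4S3_surj _ G p.
    by split=> //; exact: leaf_R4S3 Lp.
  move: Lp; rewrite -yp => /(leaf_toR4S3 cy)[f1 f2].
  have [al Eal] := framing_cis fa f1; have [be Ebe] := framing_cis fb f2.
  have [ry _ _] := cylP cy.
  exists (\row_(j < 3) nth 0 [:: y.1 : R; al + be; al - be] j) => /=.
    by rewrite mxE.
  congr toR4S3; rewrite /ycoord !mxE /=.
  apply: pairP => //=; apply: pairP; rewrite /= ?Eal ?Ebe;
    by congr (qmul _ (cis _)); lra.
- move=> x y rx ry; split.
    move=> /(toR4S3_inj (ycoord_cyl rx) (ycoord_cyl ry)) [E0 E1 E2]; split=> //.
    have := congr1 (qmul (qconj a)) E1; rewrite !qmulKl// => /cis_inj[m Em].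
    have := congr1 (qmul (qconj b)) E2; rewrite !qmulKl// => /cis_inj[n En].
    by exists m, n; rewrite intrD intrB; split; lra.
  move=> [E0 [m [n [E1 E2]]]]; rewrite /Psi /ycoord E0.
  rewrite intrD in E1; rewrite intrB in E2.
  congr (toR4S3 G (_, (qmul _ _, qmul _ _))); apply/cis_inj; [exists m|exists n]; lra.
- move=> x rx; exists (ycoord x); first by split=> //; exact: ycoord_cyl.
  have dE j k : (delta_mx 0 j : 'rV[R]_3) 0 k = (k == j)%:R by rewrite !mxE.
  have E j : 'D_(delta_mx 0 j) Psi x =
      (0 == j)%:R *: 'D_(partial_r (ycoord x)) (toR4S3 G) (ycoord x) +
      ((1 == j)%:R / 2) *: 'D_(Tplus 0 (ycoord x)) (toR4S3 G) (ycoord x) +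
      ((2 == j)%:R / 2) *: 'D_(Tminus 0 (ycoord x)) (toR4S3 G) (ycoord x).
    by rewrite derive_Psi// !dE.
  split; [reflexivity|rewrite E|rewrite E|rewrite E].
  + move: ('D_(Tplus _ _) _ _) ('D_(Tminus _ _) _ _) ('D_(partial_r _) _ _) => P Q S.
    by rewrite (_ : (1 == 0 :> 'I_3) = false)// (_ : (2 == 0 :> 'I_3) = false)// !mul0r
      !scale0r !addr0 scale1r.
  + move: ('D_(Tplus _ _) _ _) ('D_(Tminus _ _) _ _) ('D_(partial_r _) _ _) => P Q S.
    by rewrite (_ : (0 == 1 :> 'I_3) = false)// (_ : (2 == 1 :> 'I_3) = false)// !mul0r
      !scale0r addr0 add0r scalerA mul1r mulfV ?scale1r// pnatr_eq0.
  + move: ('D_(Tplus _ _) _ _) ('D_(Tminus _ _) _ _) ('D_(partial_r _) _ _) => P Q S.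
    by rewrite (_ : (0 == 2 :> 'I_3) = false)// (_ : (1 == 2 :> 'I_3) = false)// !mul0r
      !scale0r !add0r scalerA mul1r mulfV ?scale1r// pnatr_eq0.
Qed.

Hypothesis hG : admissible G.
Variables (g : H * H -> H * H -> H * H -> R)
  (phi : H * H -> H * H -> H * H -> H * H -> R).
Hypothesis hext : g2_extension G g phi.
Hypothesis s1 : sphere 3 s.1.

Lemma fibre_metricE (x : 'rV[R]_3) : dom x -> fibre_metric G x =
  diag_mx (\row_j nth 0 [:: speed G (x 0 0) ^+ 2; A1 G (x 0 0) ^+ 2; B1 G (x 0 0) ^+ 2] j).
Proof.
move=> rx; rewrite /fibre_metric; congr diag_mx; apply: row3P; rewrite !mxE /=;
  case: G hG rx => [c|] /= h rx.
- by rewrite expr_div_n expr1n sqr_sqrtr// ltW// BS_gt0.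
- by rewrite sqr_sqrtr// ltW// BGGG_gt0.
- rewrite exprMn sqr_sqrtr; last by rewrite ltW// BS_gt0.
  by rewrite expr_div_n; move: (1 - _) => w; field.
- by rewrite sqr_sqrtr// -invf_div invr_ge0 ltW// BGGG_gt0.
- by rewrite expr_div_n sqr_sqrtr.
- by rewrite expr_div_n exprMn; field.
Qed.

(** d/dr, T_1^- and T_1^+ are orthogonal, with lengths dt/dr, 2 B_1 and 2 A_1, and
   the coordinate vectors of the angles are halves of the last two. *)
Lemma Psi_metric (x u v : 'rV[R]_3) : dom x ->
  g (Psi x) ('D_u Psi x) ('D_v Psi x) = (u *m fibre_metric G x *m v^T) 0 0.
Proof.
move=> rx; have cy := ycoord_cyl rx; set y := ycoord x in cy *.
have Ls : leaf s (toR4S3 G y) by apply/leaf_toR4S3 => //; split; exact: cis_framing.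
pose m (w : 'rV[R]_3) (j : 'I_3) : R := nth 0 [:: w 0 0; w 0 2 / 2; w 0 1 / 2] j.
have E w : 'D_w Psi x = comb (m w) (push G y).
  rewrite derive_Psi// comb3 /m /= -/y.
  rewrite -[push G y 0]/('D_(partial_r y) (toR4S3 G) y).
  rewrite -[push G y 1]/('D_(Tminus 0 y) (toR4S3 G) y).
  rewrite -[push G y 2]/('D_(Tplus 0 y) (toR4S3 G) y).
  move: ('D_(Tplus _ _) _ _) ('D_(Tminus _ _) _ _) ('D_(partial_r _) _ _) => P Q S.
  by rewrite -!addrA [_ *: P + _]addrC.
have [gs gl] := g_leaf hext Ls.
have Tp j : tangent_space (leaf s) (toR4S3 G y) (push G y j) by exact: push_tangent.
rewrite !E /Psi -/y.
rewrite (bilin_comb (T_zero s1 Ls) (T_closed s1 Ls) gs gl)//.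
have -> : \sum_j \sum_k m u j * m v k * g (toR4S3 G y) (push G y j) (push G y k) =
   \sum_j m u j * m v j * dlength G y.1 j ^+ 2.
  apply: eq_bigr => j _; rewrite (bigD1 j)//= big1 ?addr0.
    by rewrite (g_push hG hext)// eqxx mul1r.
  by move=> k kj; rewrite (g_push hG hext)// eq_sym (negPf kj) mul0r mulr0.
rewrite fibre_metricE// mul_mx_diag !mxE !sum_ord3 !mxE /m /dlength /=.
by field.
Qed.

End torus.

(** * Symbol classes *)

Section symbols.
Variables (R : realType) (R0 : R).
Hypothesis R0_ge1 : 1 <= R0.
Implicit Types (p q : R) (f h : R^o -> R^o).

(** A symbol of order p is a function whose m-th derivative is O(r^(p - m)) for
   all m; here for m up to n and on r > R0. *)
Fixpoint symbol_n (n : nat) p f : Prop :=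
  (exists C, forall r, R0 < r -> `|f r| <= C * r `^ p) /\
  if n is n'.+1 then
    (forall r, R0 < r -> derivable f r 1) /\ symbol_n n' (p - 1) ('D_1 f)
  else True.

Definition symbol p f := forall n, symbol_n n p f.

Lemma gtR0 r : R0 < r -> 0 < r.
Proof. by move=> h; apply: lt_trans h; apply: lt_le_trans R0_ge1; exact: ltr01. Qed.

Lemma near_R0 f h r : (forall x, R0 < x -> f x = h x) -> R0 < r ->
  \forall x \near (r : R^o), f x = h x.
Proof.
by move=> E rr; apply: (@open_near _ _ [set x : R^o | R0 < x]).
Qed.

Lemma symbol_n_ext n p f h : (forall r, R0 < r -> f r = h r) ->
  symbol_n n p f -> symbol_n n p h.
Proof.
elim: n p f h => [|n IH] p f h E [[C b] d].
  by split=> //; exists C => r rr; rewrite -E//; exact: b.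
split; first by exists C => r rr; rewrite -E//; exact: b.
have [d1 d2] := d; split.
  by move=> r rr; apply: near_eq_derivable (d1 r rr); exact: near_R0.
apply: IH d2 => r rr; apply: near_eq_derive; exact: near_R0.
Qed.

Lemma symbol_n_pred n p f : symbol_n n.+1 p f -> symbol_n n p f.
Proof.
elim: n p f => [|n IH] p f [b [d1 d2]]; first by [].
by split=> //; split=> //; exact: IH.
Qed.

Lemma powR_gtR0 r p : R0 < r -> 0 < r `^ p.
Proof. by move=> /gtR0 r0; exact: powR_gt0. Qed.

Lemma symbol_n_weaken n p q f : p <= q -> symbol_n n p f -> symbol_n n q f.
Proof.
have bnd f' p' q' : p' <= q' -> (exists C, forall r, R0 < r -> `|f' r| <= C * r `^ p') ->
    exists C, forall r, R0 < r -> `|f' r : R^o| <= C * r `^ q'.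
  move=> pq [C b]; exists `|C| => r rr; apply: (le_trans (b r rr)).
  apply: (@le_trans _ _ (`|C| * r `^ p')).
    by rewrite ler_wpM2r ?ler_norm// ltW// powR_gtR0.
  by rewrite ler_wpM2l// ler_powR//; apply: le_trans R0_ge1 (ltW rr).
elim: n p q f => [|n IH] p q f pq [b d]; split=> //; try exact: bnd b.
by have [d1 d2] := d; split=> //; apply: IH d2; rewrite lerB.
Qed.

Lemma symbol_n0 n p : symbol_n n p (fun=> 0).
Proof.
elim: n p => [|n IH] p.
  by split=> //; exists 0 => r _; rewrite normr0 mul0r.
split; first by exists 0 => r _; rewrite normr0 mul0r.
split; first by move=> r _; exact: derivable_cst.
apply: symbol_n_ext (IH _) => r _.
by rewrite (derive_cst (0 : R^o) (r : R^o) 1).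
Qed.

Lemma symbol_n_cst n p (c : R) : 0 <= p -> symbol_n n p (fun=> c).
Proof.
move=> p0; have b : exists C, forall r, R0 < r -> `|c| <= C * r `^ p.
  exists `|c| => r rr; rewrite ler_peMr// -(powRr0 r) ler_powR//.
  exact: le_trans R0_ge1 (ltW rr).
case: n => [|n]; split=> //; split; first by move=> r _; exact: derivable_cst.
apply: symbol_n_ext (symbol_n0 n _) => r _.
by rewrite (derive_cst (c : R^o) (r : R^o) 1).
Qed.

Lemma symbol_n_add n p f h : symbol_n n p f -> symbol_n n p h ->
  symbol_n n p (fun r => f r + h r).
Proof.
elim: n p f h => [|n IH] p f h [[C b] d] [[C' b'] d'].
  split=> //; exists (C + C') => r rr; rewrite mulrDl.
  by apply: (le_trans (ler_normD _ _)); apply: lerD; auto.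
split.
  exists (C + C') => r rr; rewrite mulrDl.
  by apply: (le_trans (ler_normD _ _)); apply: lerD; auto.
have [d1 d2] := d; have [d1' d2'] := d'; split.
  by move=> r rr; apply: derivableD; auto.
apply: symbol_n_ext (IH _ _ _ d2 d2') => r rr.
by rewrite [RHS](deriveD (d1 _ rr) (d1' _ rr)).
Qed.

Lemma symbol_n_mul n p q f h : symbol_n n p f -> symbol_n n q h ->
  symbol_n n (p + q) (fun r => f r * h r).
Proof.
have bnd p' q' (f' h' : R^o -> R^o) C C' :
   (forall r, R0 < r -> `|f' r| <= C * r `^ p') ->
   (forall r, R0 < r -> `|h' r| <= C' * r `^ q') ->
   exists C, forall r, R0 < r -> `|f' r * h' r| <= C * r `^ (p' + q').
  move=> b b'; exists (C * C') => r rr; rewrite normrM powRD; last first.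
    by apply/implyP => _; rewrite gt_eqF// gtR0.
  by rewrite mulrACA ler_pM//; auto.
elim: n p q f h => [|n IH] p q f h hf hh.
  have [[[C b] _] [[C' b'] _]] := (hf, hh).
  by split=> //; exact: bnd b b'.
have [[[C b] [d1 d2]] [[C' b'] [d1' d2']]] := (hf, hh).
split; first exact: bnd b b'.
split; first by move=> r rr; apply: derivableM; auto.
have A := IH _ _ _ _ d2 (symbol_n_pred hh).
have B := IH _ _ _ _ (symbol_n_pred hf) d2'.
have e1 : p - 1 + q = p + q - 1 by lra.
have e2 : p + (q - 1) = p + q - 1 by lra.
rewrite e1 in A; rewrite e2 in B.
apply: symbol_n_ext (symbol_n_add A B) => r rr.
have D := is_derive_mul (derivableP (d1 _ rr)) (derivableP (d1' _ rr)).
by have [_ ->] := D.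
Qed.

Lemma symbol_add p f h : symbol p f -> symbol p h -> symbol p (fun r => f r + h r).
Proof. by move=> hf hh n; exact: symbol_n_add. Qed.

Lemma symbol_mul p q f h : symbol p f -> symbol q h ->
  symbol (p + q) (fun r => f r * h r).
Proof. by move=> hf hh n; exact: symbol_n_mul. Qed.

Lemma symbol_cst (c : R) : symbol 0 (fun=> c).
Proof. by move=> n; exact: symbol_n_cst. Qed.

Lemma symbol_0 p : symbol p (fun=> 0).
Proof. by move=> n; exact: symbol_n0. Qed.

Lemma symbol_ext p f h : (forall r, R0 < r -> f r = h r) -> symbol p f -> symbol p h.
Proof. by move=> E hf n; exact: symbol_n_ext (hf n). Qed.

Lemma symbol_weaken p q f : p <= q -> symbol p f -> symbol q f.
Proof. by move=> pq hf n; exact: symbol_n_weaken (hf n). Qed.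

Lemma symbol_id : symbol 1 (fun r => r).
Proof.
have b : exists C, forall r, R0 < r -> `|r| <= C * r `^ 1.
  exists 1 => r rr; have r0 := gtR0 rr.
  by rewrite powRr1 ?(ltW r0)// mul1r gtr0_norm.
case=> [|n]; split=> //; split; first by move=> r _; exact: derivable_id.
apply: (@symbol_n_ext _ _ (fun=> 1)) => [r _|].
  by have [_ ->] := is_derive_idf (r : R^o) (1 : R^o).
by apply: symbol_n_cst; rewrite subrr.
Qed.

(** An elliptic symbol of order 0 has an inverse of order 0; the derivative of
   1/f is - f' times the square of 1/f, so the bounds follow by induction. *)
Lemma symbol_inv f d : 0 < d -> (forall r, R0 < r -> d <= f r) -> symbol 0 f ->
  symbol 0 (fun r => (f r)^-1).
Proof.
move=> d0 df hf.
have f0 r : R0 < r -> 0 < f r by move=> /df; exact: lt_le_trans.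
have b : exists C, forall r, R0 < r -> `|(f r)^-1| <= C * r `^ 0.
  exists d^-1 => r rr; rewrite powRr0 mulr1 normfV gtr0_norm ?f0//.
  by rewrite lef_pV2 ?posrE ?f0// df.
elim=> [|n IH]; first by split.
have [_ [d1 _]] := hf 1%N; have [_ [_ d2]] := hf n.+1.
have D r : R0 < r -> is_derive (r : R^o) 1 (fun x => (f x)^-1 : R^o)
    (-1 * ('D_1 f r * ((f r)^-1 * (f r)^-1))).
  move=> rr; have fr := f0 r rr.
  have H := is_deriveV (lt0r_neq0 fr) (derivableP (d1 r rr)).
  apply: is_derive_eq H _.
  by rewrite /GRing.scale/= -exprVn expr2; lra.
split=> //; split; first by move=> r rr; have [] := D r rr.
have A := symbol_n_mul (symbol_n_cst n (-1) (lexx 0))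
  (symbol_n_mul d2 (symbol_n_mul IH IH)).
rewrite !addr0 add0r in A.
by apply: symbol_n_ext A => r rr; have [_ ->] := D r rr.
Qed.

Lemma symbol_rinv : symbol (-1) (fun r => r^-1).
Proof.
have b : exists C, forall r, R0 < r -> `|r^-1| <= C * r `^ (-1).
  exists 1 => r rr; have r0 := gtR0 rr.
  by rewrite powR_inv1 ?(ltW r0)// mul1r gtr0_norm ?invr_gt0.
elim=> [|n IH]; first by split.
have D r : R0 < r -> is_derive (r : R^o) 1 (fun x => x^-1 : R^o) (-1 * (r^-1 * r^-1)).
  move=> rr; have r0 := gtR0 rr.
  have H := is_deriveV (lt0r_neq0 r0) (is_derive_idf (r : R^o) 1).
  apply: is_derive_eq H _.
  by rewrite /GRing.scale/= -exprVn expr2; lra.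
split=> //; split; first by move=> r rr; have [] := D r rr.
have A := symbol_n_mul (symbol_n_cst n (-1) (lexx 0)) (symbol_n_mul IH IH).
rewrite add0r in A.
apply: symbol_n_weaken (symbol_n_ext _ A); first by lra.
by move=> r rr; have [_ ->] := D r rr.
Qed.

Lemma symbol_exprV k : symbol (- k%:R) (fun r => (r ^+ k)^-1).
Proof.
elim: k => [|k IH].
  rewrite oppr0; apply: symbol_ext (symbol_cst 1) => r _.
  by rewrite expr0 invr1.
have -> : - k.+1%:R = -1 + - k%:R :> R by rewrite -natr1; lra.
by apply: symbol_ext (symbol_mul symbol_rinv IH) => r rr; rewrite exprS invfM.
Qed.

Lemma symbol_expr k : symbol k%:R (fun r => r ^+ k).
Proof.
elim: k => [|k IH]; first by apply: symbol_ext (symbol_cst 1) => r _; rewrite expr0.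
have -> : k.+1%:R = 1 + k%:R :> R by rewrite -natr1; lra.
by apply: symbol_ext (symbol_mul symbol_id IH) => r rr; rewrite exprS.
Qed.

(** * Metrics with symbol coefficients *)

Local Notation E := 'rV[R]_3.
Implicit Types F : E -> R.

(** The values for r at most R0 are irrelevant for the asymptotics. *)
Definition symbolE p F := exists2 f, symbol p f &
  forall x : E, R0 < x 0 0 -> F x = f (x 0 0).

Lemma symbolE_0 p : symbolE p (fun=> 0).
Proof. by exists (fun=> 0) => //; exact: symbol_0. Qed.

Lemma symbolE_cst (c : R) : symbolE 0 (fun=> c).
Proof. by exists (fun=> c) => //; exact: symbol_cst. Qed.

Lemma symbolE_add p F F' : symbolE p F -> symbolE p F' -> symbolE p (fun x => F x + F' x).
Proof.
move=> [f hf Ef] [h hh Eh]; exists (fun r => f r + h r); first exact: symbol_add.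
by move=> x xr; rewrite Ef// Eh.
Qed.

Lemma symbolE_mul p q F F' : symbolE p F -> symbolE q F' ->
  symbolE (p + q) (fun x => F x * F' x).
Proof.
move=> [f hf Ef] [h hh Eh]; exists (fun r => f r * h r); first exact: symbol_mul.
by move=> x xr; rewrite Ef// Eh.
Qed.

Lemma symbolE_scale p (c : R) F : symbolE p F -> symbolE p (fun x => c * F x).
Proof. by move=> hF; rewrite -[p]add0r; apply: symbolE_mul => //; exact: symbolE_cst. Qed.

Lemma symbolE_sub p F F' : symbolE p F -> symbolE p F' -> symbolE p (fun x => F x - F' x).
Proof.
move=> hF hF'; apply: symbolE_add => //.
have -> : (fun x => - F' x) = (fun x => -1 * F' x).
  by apply/funext => x; rewrite mulN1r.
exact: symbolE_scale.
Qed.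

Lemma symbolE_sum (I : Type) (r : seq I) p (F : I -> E -> R) :
  (forall i, symbolE p (F i)) -> symbolE p (fun x => \sum_(i <- r) F i x).
Proof.
move=> hF; elim: r => [|i r IH].
  have -> : (fun x => \sum_(i <- [::]) F i x) = fun=> 0.
    by apply/funext => x; rewrite big_nil.
  exact: symbolE_0.
have -> : (fun x => \sum_(i <- i :: r) F i x) = fun x => F i x + \sum_(i <- r) F i x.
  by apply/funext => x; rewrite big_cons.
exact: symbolE_add.
Qed.

Lemma symbolE_prod (I : Type) (r : seq I) (p : I -> R) (F : I -> E -> R) :
  (forall i, symbolE (p i) (F i)) ->
  symbolE (\sum_(i <- r) p i) (fun x => \prod_(i <- r) F i x).
Proof.
move=> hF; elim: r => [|i r IH].
  rewrite big_nil; have -> : (fun x => \prod_(i <- [::]) F i x) = fun=> 1.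
    by apply/funext => x; rewrite big_nil.
  exact: symbolE_cst.
rewrite big_cons.
have -> : (fun x => \prod_(i <- i :: r) F i x) = fun x => F i x * \prod_(i <- r) F i x.
  by apply/funext => x; rewrite big_cons.
exact: symbolE_mul.
Qed.

Lemma symbolE_pd p k F : symbolE p F ->
  if k == 0 then symbolE (p - 1) (pd k F) else forall q, symbolE q (pd k F).
Proof.
move=> [f hf Ef].
have D j (x : E) : R0 < x 0 0 -> pd j F x = 'D_1 f (x 0 0) * (j == 0)%:R.
  move=> xr; rewrite /pd.
  have N : \near x, (fun y : E => f (y 0 0) : R^o) x = F x.
    apply: (@open_near _ _ [set y : E | R0 < y 0 0]) => //.
    - apply: (@open_comp _ _ (fun y : E => y 0 0) [set r | R0 < r]); last exact: open_gt.
      by move=> y _; exact: coord_continuous.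
    - by move=> y yr; rewrite Ef.
  have sc : smooth setT (fun y : E => y 0 0 : R^o) by smooth.
  have dc := smooth_differentiable (x := x) sc Logic.I.
  have [_ [d1 _]] := hf 1%N.
  have Df := is_derive_comp1 (delta_mx 0 j) (derivableP (d1 _ xr)) dc.
  have [_ ->] := near_eq_is_derive N Df.
  have [_ ->] := is_derive_coord 0 (is_derive_idf x (delta_mx 0 j)).
  by rewrite mxE eqxx eq_sym.
case: eqP => [->|/eqP k0].
  exists ('D_1 f) => [n|x xr]; first by have [_ [_]] := hf n.+1.
  by rewrite D// eqxx mulr1.
move=> q; exists (fun=> 0) => [|x xr]; first exact: symbol_0.
by rewrite D// (negPf k0) mulr0.
Qed.

(** The weight of a coordinate is the order of growth of its coordinate vector:
   0 for r and for an angle on circles of bounded length, 1 for an angle on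
   circles of length linear in r. A tensor is of order p in norm, together with
   its derivatives, if its component on I is a symbol of order p plus the weight
   of I. *)
Variable wt : 'I_3 -> nat.
Hypothesis wt0 : wt 0 = 0%N.
Local Notation w i := ((wt i)%:R : R).

(** Differentiation in r lowers the order by 1; the components do not depend on
   the angles, and 0 is a symbol of every order. *)
Lemma symbolE_pd_wt p k F : symbolE p F -> symbolE (p - 1 + w k) (pd k F).
Proof.
move=> /(symbolE_pd k); case: eqP => [->|_ h]; last exact: h.
by rewrite wt0 addr0.
Qed.

Variables (g h : E -> 'M[R]_3) (nu : R).
Hypothesis hh : forall i j, symbolE (w i + w j) (fun x => h x i j).
Hypothesis hinv : forall i j, symbolE (- (w i + w j)) (fun x => invmx (h x) i j).
Hypothesis hdiff : forall i j, symbolE (nu + (w i + w j)) (fun x => (g x - h x) i j).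

Lemma symbolE_eq p q F : q = p -> symbolE p F -> symbolE q F.
Proof. by move=> ->. Qed.

Lemma symbolE_christoffel l i j :
  symbolE (-1 + w i + w j - w l) (christoffel h l i j).
Proof.
apply: symbolE_sum => m.
have -> : (fun x => invmx (h x) l m * (pd i (fun y => h y j m) x
     + pd j (fun y => h y i m) x - pd m (fun y => h y i j) x) / 2) =
   (fun x => 2^-1 * (invmx (h x) l m * (pd i (fun y => h y j m) x
     + pd j (fun y => h y i m) x - pd m (fun y => h y i j) x))).
  by apply/funext => x; rewrite mulrC.
apply: symbolE_scale.
have -> : -1 + w i + w j - w l = - (w l + w m) + (-1 + w i + w j + w m) by lra.
apply: symbolE_mul => //; apply: symbolE_sub; first apply: symbolE_add.
- by apply: symbolE_eq (symbolE_pd_wt i (hh j m)); lra.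
- by apply: symbolE_eq (symbolE_pd_wt j (hh i m)); lra.
- by apply: symbolE_eq (symbolE_pd_wt m (hh i j)); lra.
Qed.

Definition weight (I : seq 'I_3) : R := \sum_(i <- I) w i.

Lemma weight_set_nth J s l : (s < size J)%N ->
  weight (set_nth 0 J s l) = weight J - w (nth 0 J s) + w l.
Proof.
rewrite /weight; elim: J s => [//|k J IH] [|s] /=.
  by move=> _; rewrite !big_cons; lra.
by rewrite ltnS => /IH E; rewrite !big_cons E; lra.
Qed.

(** In the second term of nabla the weights of the Christoffel symbol replace
   the weight of the summation index by that of the index J_s and add that of
   the new index k. *)
Lemma symbolE_nabla n p (T : E -> seq 'I_3 -> R) :
  (forall I, size I = n -> symbolE (p + weight I) (T ^~ I)) ->
  forall I, size I = n.+1 -> symbolE (p - 1 + weight I) (nabla h T ^~ I).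
Proof.
move=> hT [//|k J] [sJ]; rewrite /nabla /weight big_cons -/(weight J).
apply: symbolE_sub.
  by apply: symbolE_eq (symbolE_pd_wt k (hT J sJ)); lra.
apply: symbolE_sum => s; apply: symbolE_sum => l.
have sJ' : size (set_nth 0 J s l) = n.
  by rewrite size_set_nth; move/maxn_idPr: (ltn_ord s) => ->.
apply: symbolE_eq (symbolE_mul (symbolE_christoffel l k (nth 0 J s)) (hT _ sJ')).
by rewrite weight_set_nth//; lra.
Qed.

Lemma symbolE_iter_nabla j I : size I = j.+2 ->
  symbolE (nu - j%:R + weight I) (iter j (nabla h) (metric_diff g h) ^~ I).
Proof.
elim: j I => [|j IH] I sI.
  case: I sI => [//|i1 [//|i2 [|//]]] _.
  rewrite subr0 /weight !big_cons big_nil addr0; exact: hdiff.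
rewrite iterS; apply: symbolE_eq (symbolE_nabla IH sI).
by rewrite -natr1; lra.
Qed.

(** Every term of the squared norm has the order determined by the weights,
   since the weights of the inverse metric cancel those of the two factors. *)
Lemma asymptotic_symbols : nu < 0 -> asymptotic_metrics g h.
Proof.
move=> nu0; exists nu => // j.
pose T := iter j (nabla h) (metric_diff g h).
pose S x := \sum_(I : j.+2.-tuple 'I_3) \sum_(J : j.+2.-tuple 'I_3)
  (\prod_(s < j.+2) invmx (h x) (tnth I s) (tnth J s)) * T x I * T x J.
have [f hf Ef] : symbolE ((nu - j%:R) + (nu - j%:R)) S.
  apply: symbolE_sum => I; apply: symbolE_sum => J.
  have A := symbolE_prod (index_enum 'I_j.+2) (fun s => hinv (tnth I s) (tnth J s)).
  have B := symbolE_iter_nabla (size_tuple I).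
  have C := symbolE_iter_nabla (size_tuple J).
  apply: symbolE_eq (symbolE_mul (symbolE_mul A B) C).
  by rewrite /weight !big_tuple sumrN big_split/=; lra.
have [[C b] _] := hf 0%N; exists (Num.sqrt `|C|), R0 => x xr.
have r0 := gtR0 xr; have e0 := powR_gtR0 (nu - j%:R) xr.
rewrite /tensor_norm -/T -/(S x) Ef//.
have -> : x 0 0 `^ (nu - j%:R) = Num.sqrt ((x 0 0 `^ (nu - j%:R)) ^+ 2).
  by rewrite sqrtr_sqr gtr0_norm.
rewrite -sqrtrM//.
apply: ler_wsqrtr; apply: (le_trans (ler_norm _)); apply: (le_trans (b _ xr)).
rewrite powRD -?expr2; last by apply/implyP => _; rewrite gt_eqF.
by rewrite ler_wpM2r ?ler_norm// sqr_ge0.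
Qed.

End symbols.

(** * Asymptotics of the fibre metrics *)

Section fibre_asymptotics.
Variable R : realType.
Local Notation E := 'rV[R]_3.

Lemma invmx_diag n (d : 'rV[R]_n) : (forall j, d 0 j != 0) ->
  invmx (diag_mx d) = diag_mx (\row_j (d 0 j)^-1).
Proof.
move=> d0; have M : diag_mx d *m diag_mx (\row_j (d 0 j)^-1) = 1%:M.
  apply/matrixP => j k; rewrite mul_diag_mx !mxE.
  by have [->|jk] := eqVneq j k; rewrite ?mulr0// mulr1n mulfV.
have [u _] := mulmx1_unit M.
by rewrite -[LHS]mulmx1 -M mulKmx.
Qed.

(** For diagonal metrics with coefficients depending on r only the conditions
   concern nine functions of one variable. *)
Lemma asymptotic_diag (R0 nu : R) (wt : 'I_3 -> nat) (g h : E -> 'M[R]_3)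
    (dg dh : 'I_3 -> R -> R) : 1 <= R0 -> nu < 0 -> wt 0 = 0%N ->
  (forall x : E, R0 < x 0 0 -> g x = diag_mx (\row_j dg j (x 0 0))) ->
  (forall x : E, R0 < x 0 0 -> h x = diag_mx (\row_j dh j (x 0 0))) ->
  (forall j r, R0 < r -> dh j r != 0) ->
  (forall j, symbol R0 (wt j + wt j)%:R (dh j)) ->
  (forall j, symbol R0 (- (wt j + wt j)%:R) (fun r => (dh j r)^-1)) ->
  (forall j, symbol R0 (nu + (wt j + wt j)%:R) (fun r => dg j r - dh j r)) ->
  asymptotic_metrics g h.
Proof.
move=> R1 nu0 wt0 Eg Eh h0 s1 s2 s3.
have off p (F : E -> 'M[R]_3) (f : 'I_3 -> R -> R) i j :
    (forall x : E, R0 < x 0 0 -> F x = diag_mx (\row_j f j (x 0 0))) ->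
    (i = j -> symbol R0 p (f j)) -> symbolE R0 p (fun x => F x i j).
  move=> EF sf; have [ij|ij] := eqVneq i j.
    by exists (f j) => [|x xr]; [exact: sf|rewrite EF// !mxE ij eqxx mulr1n].
  exists (fun=> 0) => [|x xr]; first exact: symbol_0.
  by rewrite EF// !mxE (negPf ij).
apply: (asymptotic_symbols R1 wt0 _ _ _ nu0) => i j.
- by apply: off Eh _ => ->; rewrite -natrD.
- apply: (off _ (fun x => invmx (h x)) (fun j r => (dh j r)^-1)) => [x xr|->].
    rewrite Eh// invmx_diag; last by move=> k; rewrite mxE h0.
    by congr diag_mx; apply/rowP => k; rewrite !mxE.
  by rewrite -natrD.
- apply: (off _ (fun x => g x - h x) (fun j r => dg j r - dh j r)) => [x xr|->].
    rewrite Eg// Eh//; apply/matrixP => k l; rewrite !mxE.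
    by case: eqP => _; rewrite ?mulr1n// !mulr0n subr0.
  by rewrite -natrD.
Qed.

Lemma symbol_scale (R0 p c : R) f : 1 <= R0 -> symbol R0 p f ->
  symbol R0 p (fun r => c * f r).
Proof. by move=> R1 hf; rewrite -[p]add0r; apply: symbol_mul => //; exact: symbol_cst. Qed.

Lemma symbol_one_minus (R0 c : R) k : 1 <= R0 ->
  symbol R0 0 (fun r => 1 - c * (r ^+ k)^-1).
Proof.
move=> R1; apply: (@symbol_ext _ _ _ (fun r => 1 + (- c) * (r ^+ k)^-1)).
  by move=> r _; rewrite mulNr.
apply: symbol_add; first exact: symbol_cst.
by apply: symbol_weaken (symbol_scale (- c) R1 (symbol_exprV R1 k)).
Qed.

Lemma symbol_inv_one_minus (R0 c : R) k : 1 <= R0 ->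
  (forall r, R0 < r -> c * (r ^+ k)^-1 <= 1 / 2) ->
  symbol R0 0 (fun r => (1 - c * (r ^+ k)^-1)^-1).
Proof.
move=> R1 H; apply: (@symbol_inv _ _ _ _ (1 / 2)) => //.
- by move=> r /H; lra.
- exact: symbol_one_minus.
Qed.

(** The metric differs from the cone metric dr^2 + r^2 (dtheta_1^2 / 9 +
   dtheta_2^2 / 3) by c^3 r^-3 / (1 - c^3 r^-3) in the dr^2 coefficient and by
   - c^3 / (9 r) in the dtheta_1^2 coefficient. Both have rate -3, since the
   second one has weight 2. *)
Lemma conical_BS (c : R) : 0 < c ->
  asymptotically_conical (fibre_metric (BryantSalamon c)).
Proof.
move=> c0; have [d [d0 d1]] : exists d : 'rV[R]_2, d 0 0 = 9^-1 /\ d 0 1 = 3^-1.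
  by exists (\row_j nth 0 [:: 9^-1; 3^-1] j); rewrite !mxE.
have d_gt0 j : 0 < d 0 j by move: j; apply: ord2P; rewrite ?d0 ?d1 invr_gt0.
exists (fun=> diag_mx d).
  split; [exact: smooth_cst|by []|move=> x; split; first exact: tr_diag_mx].
  move=> v v0; rewrite mul_mx_diag !mxE; under eq_bigr do rewrite !mxE.
  rewrite sum_ord2 ![v _ _ * d _ _]mulrC -!mulrA -!expr2.
  have h j : 0 <= d 0 j * v 0 j ^+ 2 by rewrite mulr_ge0 ?sqr_ge0// ltW.
  have p j : v 0 j != 0 -> 0 < d 0 j * v 0 j ^+ 2.
    by move=> vj; rewrite mulr_gt0// lt_neqAle sqr_ge0 andbT eq_sym sqrf_eq0.
  have [v1|/p v1] := eqVneq (v 0 0) 0; last by apply: ltr_pwDl => //; exact: h.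
  have [v2|/p v2] := eqVneq (v 0 1) 0; last by apply: ltr_wpDl => //; exact: h.
  by move: v0; rewrite (_ : v = 0) ?eqxx//; apply: row2P; rewrite mxE.
(* r > 2 c makes c^3 r^-3 at most 1/8 *)
pose R0 : R := 1 + 2 * c.
have R1 : 1 <= R0 by rewrite /R0; lra.
have r0 r : R0 < r -> 0 < r by rewrite /R0; lra.
have cb r : R0 < r -> c ^+ 3 * (r ^+ 3)^-1 <= 1 / 2.
  move=> rr; have rp := r0 r rr; rewrite -expr_div_n.
  have h : c / r <= 1 / 2 by rewrite ler_pdivrMr//; move: rr; rewrite /R0; lra.
  have h0 : 0 <= c / r by rewrite divr_ge0// ltW.
  apply: (@le_trans _ _ ((1 / 2) ^+ 3)); last by lra.
  by rewrite lerXn2r// nnegrE; lra.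
apply: (@asymptotic_diag R0 (-3) (fun j => nth 0%N [:: 0; 1; 1] j) _ _
  (fun j r => nth 0 [:: 1 / (1 - c ^+ 3 * r ^- 3);
            r ^+ 2 * (1 - c ^+ 3 * r ^- 3) / 9; r ^+ 2 / 3] j)
  (fun j r => nth 0 [:: 1; r ^+ 2 / 9; r ^+ 2 / 3] j)) => //.
- move=> x xr; apply/matrixP => i j; rewrite !mxE.
  case: (@splitP 1 2 i) => i' Ei; rewrite !mxE;
    case: (@splitP 1 2 j) => j' Ej; rewrite !mxE.
  + have -> : i = 0 by apply: val_inj; rewrite /= Ei ord1.
    have -> : j = 0 by apply: val_inj; rewrite /= Ej ord1.
    by rewrite ord1 (ord1 j') eqxx.
  + have -> : i = 0 by apply: val_inj; rewrite /= Ei ord1.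
    by case: eqP => // E; move: Ej; rewrite -E.
  + have -> : j = 0 by apply: val_inj; rewrite /= Ej ord1.
    by case: eqP => // E; move: Ei; rewrite E.
  + move: i' j' Ei Ej; apply: ord2P; apply: ord2P => /= Ei Ej.
    * have -> : i = 1 by apply: val_inj; rewrite /= Ei.
      have -> : j = 1 by apply: val_inj; rewrite /= Ej.
      by rewrite !eqxx /= !mulr1n ?d0 ?d1.
    * have -> : i = 1 by apply: val_inj; rewrite /= Ei.
      have -> : j = 2 by apply: val_inj; rewrite /= Ej.
      by rewrite /= !mulr0n mulr0.
    * have -> : i = 2 by apply: val_inj; rewrite /= Ei.
      have -> : j = 1 by apply: val_inj; rewrite /= Ej.
      by rewrite /= !mulr0n mulr0.
    * have -> : i = 2 by apply: val_inj; rewrite /= Ei.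
      have -> : j = 2 by apply: val_inj; rewrite /= Ej.
      by rewrite !eqxx /= !mulr1n ?d0 ?d1.
- move=> j r rr; have rp := r0 r rr; move: j; apply: ord3P => //=.
    by rewrite gt_eqF// divr_gt0// exprn_gt0.
  by rewrite gt_eqF// divr_gt0// exprn_gt0.
- apply: ord3P => /=; first exact: symbol_cst.
    apply: symbol_ext (symbol_scale 9^-1 R1 (symbol_expr R1 2)) => r _.
    by rewrite mulrC.
  apply: symbol_ext (symbol_scale 3^-1 R1 (symbol_expr R1 2)) => r _.
  by rewrite mulrC.
- apply: ord3P => /=.
  + rewrite oppr0; apply: symbol_ext (symbol_cst R1 1) => r _; by rewrite invr1.
  + apply: symbol_ext (symbol_scale 9 R1 (symbol_exprV R1 2)) => r _.
    by rewrite invf_div.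
  + apply: symbol_ext (symbol_scale 3 R1 (symbol_exprV R1 2)) => r _.
    by rewrite invf_div.
- apply: ord3P => /=.
  + have := symbol_mul R1 (symbol_scale (c ^+ 3) R1 (symbol_exprV R1 3))
      (symbol_inv_one_minus R1 cb).
    rewrite !addr0; apply: symbol_ext => r rr; have rp := r0 r rr.
    have := cb r rr; set u := c ^+ 3 * _ => hu; field.
    by rewrite gt_eqF//; lra.
  + have -> : -3 + (1 + 1)%:R = -1 :> R by rewrite natrD; lra.
    apply: symbol_ext (symbol_scale (- (c ^+ 3 / 9)) R1 (symbol_rinv R1)) => r rr.
    by have rp := r0 r rr; field; rewrite gt_eqF.
  + apply: symbol_ext (symbol_0 _ _) => r _; by rewrite subrr.
Qed.

Lemma flat_product_diag (a b : R) (x : E) : flat_product_metric a b x =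
  diag_mx (\row_j nth 0 [:: 1; a ^+ 2; b ^+ 2 * x 0 0 ^+ 2] j).
Proof.
have D (u : E) : 'D_u (cylindrical a b) x = \row_(i < 3) nth 0
    [:: u 0 0 * cos (b * x 0 2) - x 0 0 * b * u 0 2 * sin (b * x 0 2);
        u 0 0 * sin (b * x 0 2) + x 0 0 * b * u 0 2 * cos (b * x 0 2);
        a * u 0 1] i.
  have I := is_derive_idf x u; have C k := is_derive_coord k I.
  have sb : smooth setT (fun y : E => b * y 0 2 : R^o) by smooth.
  have db := smooth_differentiable (x := x) sb Logic.I.
  have Db := is_derive_mul (is_derive_cstf (b : R^o) x u) (C 2).
  rewrite mul0r add0r in Db; have [_ Eb] := Db.
  have Dc := is_derive_comp1 u (is_derive_cos (b * x 0 2)) db.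
  have Ds := is_derive_comp1 u (is_derive_sin (b * x 0 2)) db.
  rewrite Eb in Dc Ds.
  have D0 := is_derive_mul (C 0) Dc; have D1 := is_derive_mul (C 0) Ds.
  have D2 := is_derive_mul (is_derive_cstf (a : R^o) x u) (C 1).
  suff H : is_derive x u (cylindrical a b) (\row_(i < 3) nth 0
    [:: u 0 0 * cos (b * x 0 2) - x 0 0 * b * u 0 2 * sin (b * x 0 2);
        u 0 0 * sin (b * x 0 2) + x 0 0 * b * u 0 2 * cos (b * x 0 2);
        a * u 0 1] i) by have [_ ->] := H.
  apply: is_derive_row => j.
  have -> : (fun y => cylindrical a b y 0 j) = (fun y : E => nth 0
      [:: y 0 0 * cos (b * y 0 2); y 0 0 * sin (b * y 0 2); a * y 0 1] j).
    by apply/funext => y; rewrite mxE.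
  rewrite mxE; move: j; apply: ord3P => /=.
  - have -> : u 0 0 * cos (b * x 0 2) - x 0 0 * b * u 0 2 * sin (b * x 0 2) =
      u 0 0 * cos (b * x 0 2) + x 0 0 * (- sin (b * x 0 2) * (b * u 0 2)) by lra.
    exact: D0.
  - have -> : x 0 0 * b * u 0 2 * cos (b * x 0 2) =
      x 0 0 * (cos (b * x 0 2) * (b * u 0 2)) by lra.
    exact: D1.
  - by rewrite mul0r add0r in D2.
have cs := cos2Dsin2 (b * x 0 2).
apply/matrixP => i j; rewrite !mxE !D dot3E !mxE /=.
move: (cos _) (sin _) (x 0 0) cs => co si r cs; move: i j.
have e01 : (0 == 1 :> 'I_3) = false by [].
have e02 : (0 == 2 :> 'I_3) = false by [].
have e10 : (1 == 0 :> 'I_3) = false by [].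
have e12 : (1 == 2 :> 'I_3) = false by [].
have e20 : (2 == 0 :> 'I_3) = false by [].
have e21 : (2 == 1 :> 'I_3) = false by [].
apply: ord3P; apply: ord3P; rewrite !(eqxx, e01, e02, e10, e12, e20, e21) /=
  ?mulr1n ?mulr0n; try ring.
- transitivity (co ^+ 2 + si ^+ 2); [by ring|exact: cs].
- transitivity (b ^+ 2 * r ^+ 2 * (co ^+ 2 + si ^+ 2)); first by ring.
  by rewrite cs mulr1.
Qed.

(** The first two coefficients differ from 1 by terms of order r^-2, and the
   third one is exactly that of polar coordinates with angle (2/3) theta_2. *)
Lemma flat_BGGG : asymptotically_flat_product (fibre_metric (@BGGG R)).
Proof.
exists 1, (2 / 3); split; [by lra|by lra|].
pose R0 : R := 6; have R1 : 1 <= R0 by rewrite /R0; lra.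
have r0 r : R0 < r -> 0 < r by rewrite /R0; lra.
have bd (k r : R) : 0 <= k -> k <= 6 -> R0 < r -> k * (r ^+ 2)^-1 <= 1 / 2.
  move=> k0 k6 rr; have rp := r0 r rr; move: rr; rewrite /R0 => rr.
  by rewrite ler_pdivrMr ?exprn_gt0// expr2; nra.
apply: (@asymptotic_diag R0 (-2) (fun j => nth 0%N [:: 0; 0; 1] j) _ _
  (fun j r => nth 0 [:: ((r - 3 / 4) * (r + 3 / 4)) / ((r - 9 / 4) * (r + 9 / 4));
            ((r - 9 / 4) * (r + 9 / 4)) / ((r - 3 / 4) * (r + 3 / 4));
            4 * r ^+ 2 / 9] j)
  (fun j r => nth 0 [:: 1; 1 ^+ 2; (2 / 3) ^+ 2 * r ^+ 2] j)) => //.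
- by move=> x _; exact: flat_product_diag.
- move=> j r rr; have rp := r0 r rr; move: j; apply: ord3P => //=.
  by rewrite mulf_neq0// ?expf_neq0// ?gt_eqF//; lra.
- apply: ord3P => /=; try exact: symbol_cst.
  exact: symbol_scale (symbol_expr R1 2).
- apply: ord3P => /=.
  + rewrite oppr0; apply: symbol_ext (symbol_cst R1 1) => r _; by rewrite invr1.
  + rewrite oppr0; apply: symbol_ext (symbol_cst R1 1) => r _.
    by rewrite expr1n invr1.
  + apply: symbol_ext (symbol_scale ((2 / 3) ^+ 2)^-1 R1 (symbol_exprV R1 2)) => r _.
    exact/esym/invfM.
- apply: ord3P => /=.
  + have h : symbol R0 0 (fun r => (1 - 81 / 16 * (r ^+ 2)^-1)^-1).
      by apply: symbol_inv_one_minus => // r rr; apply: bd => //; lra.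
    have := symbol_mul R1 (symbol_scale (9 / 2) R1 (symbol_exprV R1 2)) h.
    rewrite !addr0; apply: symbol_ext => r rr; have rp := r0 r rr.
    move: rr; rewrite /R0 => rr.
    field; rewrite !gt_eqF//=; nra.
  + have h : symbol R0 0 (fun r => (1 - 9 / 16 * (r ^+ 2)^-1)^-1).
      by apply: symbol_inv_one_minus => // r rr; apply: bd => //; lra.
    have := symbol_mul R1 (symbol_scale (- (9 / 2)) R1 (symbol_exprV R1 2)) h.
    rewrite !addr0; apply: symbol_ext => r rr; have rp := r0 r rr.
    move: rr; rewrite /R0 => rr.
    field; rewrite !gt_eqF//=; nra.
  + apply: symbol_ext (symbol_0 _ _) => r _; by field.
Qed.

End fibre_asymptotics.

Theorem mainTheorem3 (R : realType) (G : geometry R)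
    (g : 'rV[R]_4 * 'rV[R]_4 -> 'rV[R]_4 * 'rV[R]_4 -> 'rV[R]_4 * 'rV[R]_4 -> R)
    (phi : 'rV[R]_4 * 'rV[R]_4 -> 'rV[R]_4 * 'rV[R]_4 ->
           'rV[R]_4 * 'rV[R]_4 -> 'rV[R]_4 * 'rV[R]_4 -> R)
    (hG : admissible G) (hext : g2_extension G g phi) :
  let S2S2 := (sphere 3 `*` sphere 3 : set ('rV[R]_3 * 'rV[R]_3)) in
  (* involutivity *)
  (forall y, cyl G y ->
     [/\ lie_bracket (@Tplus R 0) (@Tminus R 0) y = 0,
         lie_bracket (@Tplus R 0) (@partial_r R) y = 0 &
         lie_bracket (@Tminus R 0) (@partial_r R) y = 0]) /\
  involutive_distribution (cyl G) (@distr R) /\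
  (exists leaf : 'rV[R]_3 * 'rV[R]_3 -> set ('rV[R]_4 * 'rV[R]_4),
     (* the associative foliation *)
     foliation_of G leaf /\
     (forall s, S2S2 s -> calibrated3 (leaf s) g phi) /\
     (forall s, S2S2 s ->
        diffeomorphic (leaf s) ([set: 'rV[R]_2] `*` (sphere 2 : set 'rV[R]_2))) /\
     (forall s s', S2S2 s -> S2S2 s' -> leaf s = leaf s' -> s = s') /\
     (* intersections along the zero section *)
     (forall s, S2S2 s ->
        diffeomorphic (leaf s `&` zero_section) (sphere 2 : set 'rV[R]_2)) /\
     (forall p, zero_section p ->
        diffeomorphic [set s | S2S2 s /\ leaf s p] (sphere 3 : set 'rV[R]_3)) /\
     (~ exists (X : Type) (proj : 'rV[R]_4 * 'rV[R]_4 -> X), forall s, S2S2 s ->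
          exists x, leaf s = R4S3 `&` [set p | proj p = x]) /\
     (* the fibration of the complement of the zero section *)
     (exists2 proj : 'rV[R]_4 * 'rV[R]_4 -> 'rV[R]_3 * 'rV[R]_3,
        fibre_bundle (R4S3 `\` zero_section) S2S2 (halfline `*` torus) proj &
        forall s, S2S2 s ->
          leaf s `\` zero_section =
          (R4S3 `\` zero_section) `&` [set p | proj p = s]) /\
     (* the fibre metrics *)
     (forall s, S2S2 s -> exists2 Psi, torus_coordinates G (leaf s) Psi &
        forall x : 'rV[R]_3, rmin G < x 0 0 -> forall u v : 'rV[R]_3,
          g (Psi x) ('D_u Psi x) ('D_v Psi x) =
          (u *m fibre_metric G x *m v^T) 0 0)) /\
  (* their asymptotics *)
  match G with
  | BryantSalamon _ => asymptotically_conical (fibre_metric G)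
  | BGGG => asymptotically_flat_product (fibre_metric G)
  end.
Proof.
move=> S2S2.
split; first by move=> y _; exact: brackets.
split; first exact: distr_involutive.
split; last first.
  by case: G hG {hext} => [c|] /= h; [exact: conical_BS|exact: flat_BGGG].
exists (@leaf R); split; first exact: leaf_foliation.
split.
  move=> s [s1 _]; have [a fa] := framing_exists s1.
  exact: (leaf_calibrated hG hext s1 fa).
split; first exact: leaf_diffeo.
split; first exact: leaf_inj.
split; first exact: leaf_zero_diffeo.
split; first exact: leaf_family.
split; first exact: leaf_no_fibration.
split.
  exists (@proj R); first exact: proj_fibre_bundle.
  by move=> s _; exact: leaf_minus_zero.
move=> s [s1 s2].
have [a fa] := framing_exists s1; have [b fb] := framing_exists s2.
exists (Psi G a b); first exact: Psi_torus fa fb.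
by move=> x rx u v; exact: (Psi_metric fa fb hG hext s1).
Qed.
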